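(* Let $q\in F^\times$. If the characteristic of $F$ equals $\mathrm{char}_q(F)$, then the cyclotomic Yokonuma–Hecke algebra $\widehat{\mathrm Y}^\Lambda_{d,n}(q)$ is isomorphic, as an $F$-algebra, to its rational degeneration $\widehat{\mathrm Y}^\Lambda_{d,n}(1)$. This applies in particular when $F$ has characteristic $0$ and $q$ is generic (not a root of unity).
   Context: Fix integers $d,n\ge1$ and a field $F$ containing a primitive $d$-th root of unity. For $q\in F^\times$ let $e$ be the smallest integer $\ge1$ with $1+q+\dots+q^{e-1}=0$ in $F$ ($e=\infty$ if there is none); $\mathrm{char}_q(F)=e$ if $e<\infty$ and $\mathrm{char}_q(F)=0$ if $e=\infty$ (so $\mathrm{char}_1(F)$ is the usual characteristic). Put $I=\mathbb Z/\mathrm{char}_q(F)\mathbb Z$, $J=\mathbb Z/d\mathbb Z$, $s_a=(a,a+1)\in\mathfrak S_n$. Let $\Lambda=(\Lambda_i)_{i\in I}$ be a finitely supported tuple of non-negative integers with $\sum_i\Lambda_i>0$. In both algebras below $e_a=\frac1d\sum_{j\in J}t_a^jt_{a+1}^{-j}$. For $q\neq1$, $\widehat{\mathrm Y}^\Lambda_{d,n}(q)$ is the unital associative $F$-algebra generated by $g_1,\dots,g_{n-1},t_1,\dots,t_n,X_1$ with relations $t_a^d=1$, $t_at_b=t_bt_a$, $t_bg_a=g_at_{s_a(b)}$, $g_a^2=q+(q-1)g_ae_a$, $g_ag_b=g_bg_a$ if $|a-b|>1$, $g_{a+1}g_ag_{a+1}=g_ag_{a+1}g_a$, $X_1g_1X_1g_1=g_1X_1g_1X_1$,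 $X_1g_a=g_aX_1$ for $a>1$, $X_1t_b=t_bX_1$, $\prod_{i\in I}(X_1-q^i)^{\Lambda_i}=0$. The degenerate cyclotomic Yokonuma–Hecke algebra $\widehat{\mathrm Y}^\Lambda_{d,n}(1)$ (where now $I=\mathbb Z/\mathrm{char}(F)\mathbb Z$, whose elements are regarded as elements of $F$) is the unital associative $F$-algebra generated by $f_1,\dots,f_{n-1},t_1,\dots,t_n,x_1,\dots,x_n$ with relations $t_a^d=1$, $t_at_b=t_bt_a$, $t_bf_a=f_at_{s_a(b)}$, $f_a^2=1$, $f_af_b=f_bf_a$ if $|a-b|>1$, $f_{a+1}f_af_{a+1}=f_af_{a+1}f_a$, $x_ax_b=x_bx_a$, $f_ax_{a+1}=x_af_a+e_a$, $f_ax_b=x_bf_a$ if $b\ne a,a+1$, $x_at_b=t_bx_a$, $\prod_{i\in I}(x_1-i)^{\Lambda_i}=0$. *)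

(* Defs.v *)
From HB Require Import structures.
From mathcomp Require Import all_boot all_order all_algebra.
From mathcomp Require Import perm finmap monalg.
From mathcomp Require Import boolp.

Set Implicit Arguments.
Unset Strict Implicit.
Unset Printing Implicit Defensive.

Import GRing.Theory.
Local Open Scope ring_scope.
Local Open Scope quotient_scope.

Notation freealg F G := {malg F[{fmonom G}]}.

Definition fgen (F : fieldType) (G : choiceType) (x : G) : freealg F G :=
  << fmu x >>.

(* [rels u v] reads "u = v is a defining relation". *)
Record presentation (F : fieldType) := Presentation {
  gens : choiceType;
  rels : freealg F gens -> freealg F gens -> Prop
}.

Section PresentedAlgebra.
Variables (F : fieldType) (P : presentation F).
Local Notation FA := (freealg F (gens P)).
Implicit Types (c : F) (x y : FA).

Inductive rel_ideal : FA -> Prop :=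
| rel_ideal_rel x y : rels x y -> rel_ideal (x - y)
| rel_ideal0 : rel_ideal 0
| rel_idealD x y : rel_ideal x -> rel_ideal y -> rel_ideal (x + y)
| rel_idealMl x y : rel_ideal y -> rel_ideal (x * y)
| rel_idealMr x y : rel_ideal x -> rel_ideal (x * y).

Definition in_rel_ideal : {pred FA} := fun x => `[< rel_ideal x >].

Lemma in_rel_idealP x : reflect (rel_ideal x) (x \in in_rel_ideal).
Proof. exact: asboolP. Qed.

Fact in_rel_ideal_zmod_closed : zmod_closed in_rel_ideal.
Proof.
split=> [|x y /in_rel_idealP Hx /in_rel_idealP Hy]; apply/in_rel_idealP.
  exact: rel_ideal0.
by rewrite -mulN1r; apply/rel_idealD/rel_idealMl.
Qed.
HB.instance Definition _ :=
  GRing.isZmodClosed.Build FA in_rel_ideal in_rel_ideal_zmod_closed.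

(* The carrier of the algebra presented by P.  MathComp's algType requires
   1 != 0, which an arbitrary presentation does not guarantee, so the F-algebra
   structure is given by the pzRingType and lmodType instances together with
   palg_scalerAl and palg_scalerAr. *)
Definition palg := Quotient.quot in_rel_ideal.
HB.instance Definition _ := GRing.Zmodule.on palg.
HB.instance Definition _ := EqQuotient.on palg.

Lemma palg_eqP x y : reflect (rel_ideal (x - y)) (\pi_palg x == \pi_palg y).
Proof.
by rewrite -(Quotient.idealrBE in_rel_ideal x y); apply: in_rel_idealP.
Qed.

Lemma palg_repr x : rel_ideal (x - repr (\pi_palg x)).
Proof. by apply/palg_eqP; rewrite reprK. Qed.

Definition palg_one : palg := \pi_palg 1.
Definition palg_mul (u v : palg) : palg := \pi_palg (repr u * repr v).
Definition palg_scale c (u : palg) : palg := \pi_palg (c *: repr u).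

Lemma palg_piD x y : \pi_palg (x + y) = \pi_palg x + \pi_palg y.
Proof. exact: Quotient.pi_add. Qed.

Lemma palg_piM x y : \pi_palg (x * y) = palg_mul (\pi_palg x) (\pi_palg y).
Proof.
apply/eqP/palg_eqP; set x' := repr _; set y' := repr _.
have -> : x * y - x' * y' = (x - x') * y + x' * (y - y').
  by rewrite mulrBl mulrBr addrA subrK.
apply: rel_idealD.
  by apply: rel_idealMr; apply: palg_repr.
by apply: rel_idealMl; apply: palg_repr.
Qed.

Lemma palg_piZ c x : \pi_palg (c *: x) = palg_scale c (\pi_palg x).
Proof.
apply/eqP/palg_eqP; rewrite -scalerBr -[_ - _]mul1r scalerAl.
apply: rel_idealMl; exact: palg_repr.
Qed.

Lemma palg_piP (u : palg) : exists x, u = \pi_palg x.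
Proof. by exists (repr u); rewrite reprK. Qed.

Fact palg_mulA : associative palg_mul.
Proof.
move=> u v w.
have [x ->] := palg_piP u; have [y ->] := palg_piP v.
have [z ->] := palg_piP w.
by rewrite -(palg_piM y z) -(palg_piM x y) -(palg_piM x) -palg_piM mulrA.
Qed.

Fact palg_mul1l : left_id palg_one palg_mul.
Proof. by move=> u; have [x ->] := palg_piP u; rewrite -palg_piM mul1r. Qed.

Fact palg_mul1r : right_id palg_one palg_mul.
Proof. by move=> u; have [x ->] := palg_piP u; rewrite -palg_piM mulr1. Qed.

Fact palg_mulDl : left_distributive palg_mul +%R.
Proof.
move=> u v w.
have [x ->] := palg_piP u; have [y ->] := palg_piP v.
have [z ->] := palg_piP w.
by rewrite -(palg_piM x z) -(palg_piM y z) -!palg_piD -palg_piM mulrDl.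
Qed.

Fact palg_mulDr : right_distributive palg_mul +%R.
Proof.
move=> u v w.
have [x ->] := palg_piP u; have [y ->] := palg_piP v.
have [z ->] := palg_piP w.
by rewrite -(palg_piM x y) -(palg_piM x z) -!palg_piD -palg_piM mulrDr.
Qed.

HB.instance Definition _ := GRing.Zmodule_isPzRing.Build palg
  palg_mulA palg_mul1l palg_mul1r palg_mulDl palg_mulDr.

Fact palg_scaleA a b u : palg_scale a (palg_scale b u) = palg_scale (a * b) u.
Proof.
by have [x ->] := palg_piP u; rewrite -(palg_piZ b x) -!palg_piZ scalerA.
Qed.

Fact palg_scale1 : left_id 1 palg_scale.
Proof. by move=> u; have [x ->] := palg_piP u; rewrite -palg_piZ scale1r. Qed.

Fact palg_scaleDr : right_distributive palg_scale +%R.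
Proof.
move=> c u v; have [x ->] := palg_piP u; have [y ->] := palg_piP v.
by rewrite -(palg_piZ c x) -(palg_piZ c y) -!palg_piD -palg_piZ scalerDr.
Qed.

Fact palg_scaleDl u : {morph palg_scale^~ u : a b / a + b}.
Proof.
move=> a b; have [x ->] := palg_piP u.
by rewrite -(palg_piZ a x) -(palg_piZ b x) -palg_piD -palg_piZ scalerDl.
Qed.

HB.instance Definition _ := GRing.Zmodule_isLmodule.Build F palg
  palg_scaleA palg_scale1 palg_scaleDr palg_scaleDl.

Lemma palg_scalerAl c (u v : palg) : c *: (u * v) = (c *: u) * v.
Proof.
have [x ->] := palg_piP u; have [y ->] := palg_piP v.
rewrite -[_ * _]palg_piM -[c *: \pi_palg x]palg_piZ.
by rewrite -[LHS]palg_piZ -[RHS]palg_piM scalerAl.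
Qed.

Lemma freealg_scalerAr c x y : c *: (x * y) = x * (c *: y).
Proof.
apply/malgP=> k; rewrite mcoeffZ mcoeffMl.
rewrite (mcoeffMlw _ (fsubset_refl _) (msuppZ_le c y)) mulr_sumr.
apply: eq_bigr => k1 _; rewrite mulr_sumr; apply: eq_bigr => k2 _.
by rewrite mcoeffZ mulrnAr mulrCA.
Qed.

Lemma palg_scalerAr c (u v : palg) : c *: (u * v) = u * (c *: v).
Proof.
have [x ->] := palg_piP u; have [y ->] := palg_piP v.
rewrite -[\pi_palg x * \pi_palg y]palg_piM -[c *: \pi_palg y]palg_piZ.
by rewrite -[LHS]palg_piZ -[RHS]palg_piM freealg_scalerAr.
Qed.

End PresentedAlgebra.

Definition palg_isomorphic (F : fieldType) (P Q : presentation F) : Prop :=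
  exists f : {rmorphism palg P -> palg Q}, scalable f /\ bijective f.

(* The unique prime p with p = 0 in F, or 0 if there is none. *)
Definition characteristic (F : fieldType) : nat :=
  if pselect (exists p, p \in [pchar F]) is left h then ex_minn h else 0%N.

Definition char_q (F : fieldType) (q : F) : nat :=
  if pselect (exists e, (0 < e)%N && (\sum_(k < e) q ^+ k == 0)) is left h
  then ex_minn h else 0%N.

(* Z/cZ as an index set: Z itself for c = 0, and {0, ..., c-1} otherwise. *)
Definition Zmod (c : nat) : choiceType := if c is c'.+1 then 'I_c'.+1 else int.

Definition Zmod_repr (c : nat) : Zmod c -> int :=
  if c is c'.+1 then fun i : 'I_c'.+1 => (i : nat)%:Z else id.

Definition weight (c : nat) := {fsfun Zmod c -> nat with 0%N}.

Definition level (c : nat) (L : weight c) : nat :=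
  (\sum_(i <- finsupp L) L i)%N.

(* Indices are shifted down by one: a : 'I_n.-1 stands for a+1 in 1..n-1, and
   pos a, pos_succ a : 'I_n stand for a+1, a+2 in 1..n. *)
Section Indices.
Variable n : nat.
Implicit Type a : 'I_n.-1.

Definition pos a : 'I_n := widen_ord (leq_pred n) a.

Fact pos_succ_subproof a : (a.+1 < n)%N.
Proof. by rewrite -ltn_predRL. Qed.

Definition pos_succ a : 'I_n := Ordinal (pos_succ_subproof a).

Definition s_ a : {perm 'I_n} := tperm (pos a) (pos_succ a).
End Indices.

Section Yokonuma.
Variables (F : fieldType) (c d n : nat).

Section Idempotent.
Variables (G : choiceType) (t : 'I_n -> freealg F G).
(* As t ^+ d = 1, the power t^-j is t ^+ (d - j). *)
Definition eY (a : 'I_n.-1) : freealg F G :=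
  d%:R^-1 *: \sum_(j < d) t (pos a) ^+ j * t (pos_succ a) ^+ (d - j).
End Idempotent.

Definition YHgens : choiceType := (('I_n.-1 + 'I_n) + unit)%type.
Definition YH_g (a : 'I_n.-1) := fgen F (inl (inl a) : YHgens).
Definition YH_t (b : 'I_n) := fgen F (inl (inr b) : YHgens).
Definition YH_X1 := fgen F (inr tt : YHgens).

Section NonDegenerate.
Variables (q : F) (L : weight c).
Local Notation g := YH_g.
Local Notation t := YH_t.
Local Notation X1 := YH_X1.
Local Notation e := (eY YH_t).
Implicit Type b : 'I_n.

Inductive YHrels : freealg F YHgens -> freealg F YHgens -> Prop :=
| YH_torder b : YHrels (t b ^+ d) 1
| YH_tt b b' : YHrels (t b * t b') (t b' * t b)
| YH_tg b a : YHrels (t b * g a) (g a * t (s_ a b))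
| YH_gg a : YHrels (g a ^+ 2) (q *: 1 + (q - 1) *: (g a * e a))
| YH_gC (a a' : 'I_n.-1) : (a.+1 < a')%N || (a'.+1 < a)%N ->
    YHrels (g a * g a') (g a' * g a)
| YH_braid (a a' : 'I_n.-1) : a' = a.+1 :> nat ->
    YHrels (g a' * g a * g a') (g a * g a' * g a)
| YH_Xbraid (a : 'I_n.-1) : a = 0%N :> nat ->
    YHrels (X1 * g a * X1 * g a) (g a * X1 * g a * X1)
| YH_Xg (a : 'I_n.-1) : (0 < a)%N -> YHrels (X1 * g a) (g a * X1)
| YH_Xt b : YHrels (X1 * t b) (t b * X1)
| YH_cyclotomic :
    YHrels (\prod_(i <- finsupp L) (X1 - (q ^ Zmod_repr i) *: 1) ^+ L i) 0.

Definition YHpres : presentation F := Presentation YHrels.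
End NonDegenerate.

Definition dYHgens : choiceType := (('I_n.-1 + 'I_n) + 'I_n)%type.
Definition dYH_f (a : 'I_n.-1) := fgen F (inl (inl a) : dYHgens).
Definition dYH_t (b : 'I_n) := fgen F (inl (inr b) : dYHgens).
Definition dYH_x (b : 'I_n) := fgen F (inr b : dYHgens).

Section Degenerate.
Variable L : weight c.
Local Notation f := dYH_f.
Local Notation t := dYH_t.
Local Notation x := dYH_x.
Local Notation e := (eY dYH_t).
Implicit Type b : 'I_n.

Inductive dYHrels : freealg F dYHgens -> freealg F dYHgens -> Prop :=
| dYH_torder b : dYHrels (t b ^+ d) 1
| dYH_tt b b' : dYHrels (t b * t b') (t b' * t b)
| dYH_tf b a : dYHrels (t b * f a) (f a * t (s_ a b))
| dYH_ff a : dYHrels (f a ^+ 2) 1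
| dYH_fC (a a' : 'I_n.-1) : (a.+1 < a')%N || (a'.+1 < a)%N ->
    dYHrels (f a * f a') (f a' * f a)
| dYH_braid (a a' : 'I_n.-1) : a' = a.+1 :> nat ->
    dYHrels (f a' * f a * f a') (f a * f a' * f a)
| dYH_xx b b' : dYHrels (x b * x b') (x b' * x b)
| dYH_fx a : dYHrels (f a * x (pos_succ a)) (x (pos a) * f a + e a)
| dYH_fxC a b : b != pos a -> b != pos_succ a ->
    dYHrels (f a * x b) (x b * f a)
| dYH_xt b b' : dYHrels (x b * t b') (t b' * x b)
| dYH_cyclotomic b : b = 0%N :> nat ->
    dYHrels (\prod_(i <- finsupp L) (x b - (Zmod_repr i)%:~R *: 1) ^+ L i) 0.

Definition dYHpres : presentation F := Presentation dYHrels.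
End Degenerate.

(* The intended modulus is c = char_q q; q ^ i (for q != 1) and i%:~R (for
   q = 1) then depend only on the class of i modulo c. *)
Definition cycYH (q : F) (L : weight c) : presentation F :=
  if q == 1 then dYHpres L else YHpres q L.

End Yokonuma.

(* Main.v *)
Require Import Defs.
From HB Require Import structures.
From mathcomp Require Import all_boot all_order all_algebra.
From mathcomp Require Import perm finmap monalg fraction.
From mathcomp Require Import boolp.
From mathcomp Require Import mpoly.
From mathcomp Require Import ring zify.

Set Implicit Arguments.
Unset Strict Implicit.
Unset Printing Implicit Defensive.

Import GRing.Theory.
Local Open Scope ring_scope.

(* If F has characteristic p = char_q q > 0, then
   (q - 1)^p = q^p - 1 = (q - 1)(1 + q + ... + q^(p-1)) = 0, so q = 1 and there is
   nothing to prove.  Otherwise F has characteristic 0 and q is 1 or not a root of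
   unity.  In each of the two algebras the t_b and the Jucys-Murphy elements x_b
   (resp. X_b) generate a commutative subalgebra, in which every strand b has
   orthogonal idempotents indexed by a color (eigenvalue of t_b) and an integer k
   (x_b has generalized eigenvalue k, resp. X_b has q^k) and a nilpotent z_b with
   x_b = k + z_b, resp. X_b = q^k (1 + z_b), on the corresponding block.  One
   formula defines X from the blocks of x and conversely.  The generators are
   exchanged by g_a = f_a C_a + D_a and f_a = g_a C_a^-1 - D_a C_a^-1, where, on
   strands of the same color, with x, x' and X, X' the values at a and a+1,
     C = (X - q X')/(X - X') * (x - x')/(x - x' - 1),
     D = ((X - q X')/(x - x' - 1) - (q - 1) X')/(X - X');
   on strands of different colors C is q or 1 and D = 0.

   The relations for the new generators are not computed in the algebra.  Both
   algebras act formally on functions of n distinct labels with values in a field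
   of rational functions, f_a becoming v |-> alpha * (v o s_a) + beta * v, and
   operators given by distinct reduced words are linearly independent over that
   field.  An identity between such operators therefore lifts to the algebra, the
   denominators being units there as nonzero constants plus nilpotents. *)

(** * Presented algebras *)

(** The formulas for C and D are dictated by the operators: comparing coefficients gives C, with its
    two arguments exchanged, as the ratio of the two alphas, and D as the difference beta_q - beta_1
    C. What has to be arranged is regularity at nilpotents, and this is the merit of taking both x =
    k + z and X = q^k (1 + z) affine in the same z. If k = k' + 1 then X - q X' and x - x' - 1 are
    both multiples of z - z'; if k = k' then so are X - X' and x - x'; each time the nilpotent
    factor cancels. For this k = k' + 1 must hold exactly when q^k = q q^k', hence the need for
    characteristic 0 and q of infinite order. Linear independence of words is asked of the operators
    and never of the algebra: an element is expanded over words by the same rewriting as its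
    operator, so a zero operator forces zero coefficients. Neither algebra is known beforehand to be
    nonzero, whereas an [algType] must be. The construction applied to a nonzero one of them maps
    the other to it, so they vanish together, and the zero case is treated apart. *)

Section NontrivialPresentedAlgebra.
Variables (F : fieldType) (P : presentation F).
Hypothesis nz : 1 != 0 :> palg P.

(** The proof of [1 != 0] is a phantom argument of this copy of [palg P], so that the instances
    depending on it can be inferred from the type. *)
Definition palg_alg of 1 != 0 :> palg P := palg P.
HB.instance Definition _ := GRing.PzRing.on (palg_alg nz).
HB.instance Definition _ := GRing.Lmodule.on (palg_alg nz).
HB.instance Definition _ :=
  GRing.PzSemiRing_isNonZero.Build (palg_alg nz) nz.
HB.instance Definition _ :=
  GRing.Lmodule_isLalgebra.Build F (palg_alg nz) (@palg_scalerAl F P).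
HB.instance Definition _ :=
  GRing.Lalgebra_isAlgebra.Build F (palg_alg nz) (@palg_scalerAr F P).
End NontrivialPresentedAlgebra.

Section FreeEvaluation.
Variables (F : fieldType) (G : choiceType) (A : algType F) (phi : G -> A).
Local Notation FA := (freealg F G).

Definition word_eval (m : {fmonom G}) : A := \prod_(i <- m) phi i.

Fact word_eval_mmorphism : mmorphism word_eval.
Proof.
split=> [m1 m2|]; rewrite /word_eval; first by rewrite fmM big_cat.
by rewrite fm1 big_nil.
Qed.
HB.instance Definition _ :=
  isMultiplicative.Build {fmonom G} A word_eval word_eval_mmorphism.

Definition free_eval : FA -> A := monalg.mmap (in_alg A) word_eval.

Lemma free_evalD : {morph free_eval : x y / x + y}.
Proof. exact: raddfD. Qed.

Lemma free_evalB : {morph free_eval : x y / x - y}.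
Proof. exact: raddfB. Qed.

Lemma free_eval_sum I r (Q : pred I) (E : I -> FA) :
  free_eval (\sum_(i <- r | Q i) E i) = \sum_(i <- r | Q i) free_eval (E i).
Proof. exact: raddf_sum. Qed.

Lemma free_evalM : {morph free_eval : x y / x * y}.
Proof.
by case: (@monalg.commr_mmap_is_multiplicative _ _ _ (in_alg A) word_eval) => // g m m';
  rewrite /GRing.comm /= mulr_algl mulr_algr.
Qed.

Lemma free_eval1 : free_eval 1 = 1.
Proof. exact: monalg.mmap1. Qed.

Lemma free_evalX x k : free_eval (x ^+ k) = free_eval x ^+ k.
Proof.
by elim: k => [|k IH]; rewrite ?free_eval1 // !exprS free_evalM IH.
Qed.

Lemma free_eval_prod I r (Q : pred I) (E : I -> FA) :
  free_eval (\prod_(i <- r | Q i) E i) = \prod_(i <- r | Q i) free_eval (E i).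
Proof. exact: (big_morph _ free_evalM free_eval1). Qed.

Lemma free_evalZ c x : free_eval (c *: x) = c *: free_eval x.
Proof. by rewrite /free_eval monalg.mmapZ /= mulr_algl. Qed.

Lemma free_eval_gen i : free_eval (fgen F i) = phi i.
Proof.
by rewrite /free_eval /fgen monalg.mmapU /= scale1r mul1r /word_eval fmuE
           big_seq1.
Qed.

Lemma free_eval_unique (m : FA -> A) :
  {morph m : x y / x + y} -> m 1 = 1 -> {morph m : x y / x * y} ->
  (forall c x, m (c *: x) = c *: m x) ->
  (forall i, m (fgen F i) = phi i) -> m =1 free_eval.
Proof.
move=> mD m1 mM mZ mG x; rewrite (monalgE x).
have m0 : m 0 = 0 by rewrite -(scale0r (0 : FA)) mZ scale0r.
rewrite (big_morph m mD m0) free_eval_sum; apply: eq_bigr => k _.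
have -> c : (<< c *g k >> : FA) = c *: << k >>.
  by apply/malgP=> k'; rewrite monalg.mcoeffZ !monalg.mcoeffU mulrnAr mulr1.
rewrite mZ free_evalZ; congr (_ *: _).
case: k => s; elim: s => [|i s IH].
  have -> : (<< FMonom [::] >> : FA) = 1.
    by congr (<< _ >>); apply/val_inj; rewrite /= fm1.
  by rewrite m1 free_eval1.
have -> : (<< FMonom (i :: s) >> : FA) = fgen F i * << FMonom s >>.
  rewrite malgM_def fgmulUU mulr1; congr (<< _ >>); apply/val_inj.
  by rewrite /= fmM fmU.
by rewrite mM free_evalM mG free_eval_gen IH.
Qed.

End FreeEvaluation.

Section UniversalProperty.
Local Open Scope quotient_scope.
Variables (F : fieldType) (P : presentation F).
Variables (A : algType F) (phi : gens P -> A).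
Local Notation free_eval := (free_eval phi).

(** The source is the bare [palg P], possibly zero: a unital map from it to a nonzero algebra then
    also proves that it is nonzero. *)
Lemma palg_lift :
  (forall x y, rels x y -> free_eval x = free_eval y) ->
  exists h : {rmorphism palg P -> A},
    scalable h /\ forall i, h (\pi_(palg P) (fgen F i)) = phi i.
Proof.
move=> relP.
have ker x : rel_ideal x -> free_eval x = 0.
  elim=> {x} [x y /relP E||x y _ Hx _ Hy|x y _ Hy|x y _ Hx].
  - by rewrite free_evalB E subrr.
  - exact: raddf0.
  - by rewrite free_evalD Hx Hy addr0.
  - by rewrite free_evalM Hy mulr0.
  - by rewrite free_evalM Hx mul0r.
pose h (u : palg P) : A := free_eval (repr u).
have hpi x : h (\pi_(palg P) x) = free_eval x.
  by apply/eqP; rewrite eq_sym -subr_eq0 -free_evalB ker //; apply: palg_repr.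
have hB : zmod_morphism h.
  move=> u v; have [x ->] := palg_piP u; have [y ->] := palg_piP v.
  suff -> : \pi_(palg P) x - \pi_(palg P) y = \pi_(palg P) (x - y).
    by rewrite !hpi free_evalB.
  apply: (addIr (\pi_(palg P) y)).
  by rewrite -palg_piD !subrK.
have hM : monoid_morphism h.
  split=> [|u v]; first by rewrite [LHS]hpi free_eval1.
  have [x ->] := palg_piP u; have [y ->] := palg_piP v.
  by rewrite -[_ * _ in LHS]palg_piM !hpi free_evalM.
pose hA := GRing.isZmodMorphism.Build _ _ h hB.
pose hR := GRing.isMonoidMorphism.Build _ _ h hM.
pose H : {rmorphism palg P -> A} := HB.pack h hA hR.
exists H; split=> [c u|i] /=; last by rewrite hpi free_eval_gen.
by have [x ->] := palg_piP u; rewrite -[_ *: _ in LHS]palg_piZ !hpi free_evalZ.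
Qed.

End UniversalProperty.

Section CanonicalMap.
Local Open Scope quotient_scope.
Variables (F : fieldType) (P : presentation F) (nz : 1 != 0 :> palg P).

Definition pgen (i : gens P) : palg_alg nz := \pi_(palg P) (fgen F i).

Lemma free_eval_pi x : free_eval pgen x = \pi_(palg P) x.
Proof.
pose m (x : freealg F (gens P)) : palg_alg nz := \pi_(palg P) x.
have mD : {morph m : x y / x + y} by move=> u v; exact: palg_piD.
have mM : {morph m : x y / x * y} by move=> u v; exact: palg_piM.
have mZ c u : m (c *: u) = c *: m u by exact: palg_piZ.
have m1 : m 1 = 1 by [].
have mG i : m (fgen F i) = pgen i by [].
exact: esym (free_eval_unique mD m1 mM mZ mG x).
Qed.

Lemma free_eval_rels x y : rels x y -> free_eval pgen x = free_eval pgen y.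
Proof.
by move=> r; rewrite !free_eval_pi; apply/eqP/palg_eqP/rel_ideal_rel.
Qed.
End CanonicalMap.

Section MorphismExtensionality.
Local Open Scope quotient_scope.
Variables (F : fieldType) (P : presentation F).

Lemma palg_alg_lift (nz : 1 != 0 :> palg P) (A : algType F) (phi : gens P -> A) :
  (forall x y, rels x y -> free_eval phi x = free_eval phi y) ->
  exists h : {lrmorphism palg_alg nz -> A}, forall i, h (pgen nz i) = phi i.
Proof.
case/palg_lift=> h [hZ hG]; pose h' : palg_alg nz -> A := h.
have hB : zmod_morphism h' by exact: rmorphB.
have hM : monoid_morphism h' by split; [exact: rmorph1 | exact: rmorphM].
pose mA := GRing.isZmodMorphism.Build _ _ h' hB.
pose mR := GRing.isMonoidMorphism.Build _ _ h' hM.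
pose mZ := GRing.isScalable.Build _ _ _ _ h' hZ.
pose H : {lrmorphism palg_alg nz -> A} := HB.pack h' mA mR mZ.
by exists H.
Qed.

Lemma palg_alg_ext (nz : 1 != 0 :> palg P) (A : algType F)
    (h h' : {lrmorphism palg_alg nz -> A}) :
  (forall i, h (pgen nz i) = h' (pgen nz i)) -> h =1 h'.
Proof.
move=> E u; have [x ->] := palg_piP u.
have ev (k : {lrmorphism palg_alg nz -> A}) y :
    k (\pi_(palg P) y) = free_eval (fun i => k (pgen nz i)) y.
  pose m (y : freealg F (gens P)) : A := k (\pi_(palg P) y).
  apply: (@free_eval_unique _ _ _ _ m) => // [y1 y2||y1 y2|c y1]; rewrite /m.
  - by rewrite palg_piD; apply: rmorphD.
  - exact: rmorph1.
  - by rewrite palg_piM; apply: rmorphM.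
  - by rewrite palg_piZ; apply: linearZ.
rewrite !ev; congr (free_eval _ x); exact: funext.
Qed.

Lemma palg_isomorphic_refl : palg_isomorphic P P.
Proof. by exists idfun; split=> //; exists idfun. Qed.
End MorphismExtensionality.

Section Isomorphisms.
Variables (F : fieldType) (P Q : presentation F).

Lemma palg_isomorphic_inverses (nzP : 1 != 0 :> palg P) (nzQ : 1 != 0 :> palg Q)
    (h : {lrmorphism palg_alg nzP -> palg_alg nzQ})
    (k : {lrmorphism palg_alg nzQ -> palg_alg nzP}) :
  (forall i, k (h (pgen nzP i)) = pgen nzP i) ->
  (forall i, h (k (pgen nzQ i)) = pgen nzQ i) -> palg_isomorphic P Q.
Proof.
move=> kh hk; pose h' : palg P -> palg Q := h.
have hB : zmod_morphism h' by exact: (rmorphB h).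
have hM : monoid_morphism h' by split; [exact: (rmorph1 h) | exact: (rmorphM h)].
pose mA := GRing.isZmodMorphism.Build _ _ h' hB.
pose mR := GRing.isMonoidMorphism.Build _ _ h' hM.
pose H : {rmorphism palg P -> palg Q} := HB.pack h' mA mR.
exists H; split; first by move=> c u; exact: (linearZZ h c u).
exists (k : palg Q -> palg P).
  exact: (palg_alg_ext (h := k \o h) (h' := idfun)).
exact: (palg_alg_ext (h := h \o k) (h' := idfun)).
Qed.

Lemma palg_isomorphic_trivial :
  1 = 0 :> palg P -> 1 = 0 :> palg Q -> palg_isomorphic P Q.
Proof.
move=> P0 Q0; pose h (u : palg P) : palg Q := 0.
have hB : zmod_morphism h by move=> u v; rewrite subrr.
have hM : monoid_morphism h by split=> [|u v]; rewrite /h ?mulr0.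
pose mA := GRing.isZmodMorphism.Build _ _ h hB.
pose mR := GRing.isMonoidMorphism.Build _ _ h hM.
pose H : {rmorphism palg P -> palg Q} := HB.pack h mA mR.
exists H; split=> [c u|]; first by rewrite [RHS]scaler0.
exists (fun=> 0) => u; first by rewrite -[RHS]mul1r P0 mul0r.
by rewrite -[RHS]mul1r Q0 mul0r.
Qed.

End Isomorphisms.

(** * Commutative subalgebras containing their inverses *)

(* The bicommutant of a commuting family is commutative, and it contains the
   inverse of each of its elements that is invertible in it. *)
Section Bicommutant.
Variables (F : fieldType) (A : algType F) (S : A -> Prop).
Hypothesis commS : forall a b, S a -> S b -> a * b = b * a.

Definition commutes_with (X : A -> Prop) (b : A) :=
  forall a, X a -> a * b = b * a.
Definition bicomm : {pred A} :=
  fun b => `[< commutes_with (commutes_with S) b >].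

Fact bicomm_subalg : subalg_closed bicomm.
Proof.
split=> [|k a b /asboolP ca /asboolP cb|a b /asboolP ca /asboolP cb];
  apply/asboolP => c Sc.
- by rewrite mulr1 mul1r.
- by rewrite mulrDr mulrDl -scalerAr -scalerAl ca // cb.
- by rewrite mulrA ca // -mulrA cb // mulrA.
Qed.
HB.instance Definition _ :=
  GRing.isSubalgClosed.Build F A bicomm bicomm_subalg.

(** The commutation proof is a phantom argument, because the commutativity instance on this type
    depends on it. *)
Definition bicommT of (forall a b, S a -> S b -> a * b = b * a) :=
  {a : A | a \in bicomm}.
Local Notation R := (bicommT commS).
HB.instance Definition _ := [isSub of R for sval].
HB.instance Definition _ := [Choice of R by <:].
HB.instance Definition _ := [SubChoice_isSubAlgebra of R by <:].

(** As [S] commutes, it lies in its own commutant, so the bicommutant lies in the commutant; and a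
    member of the bicommutant commutes with everything in the commutant. *)
Fact bicomm_mulC : commutative (@GRing.mul R).
Proof.
move=> [a Ra] [b Rb]; apply/val_inj => /=.
move/asboolP: Ra => ca; move/asboolP: (Rb) => cb.
apply: cb => c Sc; apply: ca => x Sx; exact: commS.
Qed.
HB.instance Definition _ :=
  GRing.PzSemiRing_hasCommutativeMul.Build R bicomm_mulC.

Definition bicomm_unit : {pred R} := fun x => `[< exists y, y * x = 1 >].
Definition bicomm_inv (x : R) : R :=
  if pselect (exists y, y * x = 1) is left h then projT1 (cid h) else x.

Fact bicomm_mulVx : {in bicomm_unit, left_inverse 1 bicomm_inv *%R}.
Proof.
move=> x /asboolP h; rewrite /bicomm_inv; case: pselect => // h'.
exact: projT2 (cid h').
Qed.
Fact bicomm_unitPl x y : y * x = 1 -> bicomm_unit x.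
Proof. by move=> h; apply/asboolP; exists y. Qed.
Fact bicomm_inv_out : {in [predC bicomm_unit], bicomm_inv =1 id}.
Proof.
move=> x /negP h; rewrite /bicomm_inv; case: pselect => // h'.
by case: h; apply/asboolP.
Qed.
HB.instance Definition _ := GRing.ComNzRing_hasMulInverse.Build R
  bicomm_mulVx bicomm_unitPl bicomm_inv_out.

Definition bicomm_val : R -> A := \val.
HB.instance Definition _ := GRing.RMorphism.on bicomm_val.
HB.instance Definition _ := GRing.Linear.on bicomm_val.

Lemma commutative_envelope :
  exists (R : comUnitAlgType F) (i : {lrmorphism R -> A}),
    [/\ injective i, forall a, S a -> exists r, i r = a &
        forall c, (forall a, S a -> a * c = c * a) ->
          forall r, i r * c = c * i r].
Proof.
exists R, bicomm_val; split=> [|a Sa|c Sc r].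
- exact: val_inj.
- have Ra : a \in bicomm by apply/asboolP => c Sc; rewrite Sc.
  by exists (Sub a Ra).
- by have /asboolP/(_ c Sc) := valP r.
Qed.
End Bicommutant.

Lemma unit_add_nilpotent (R : comUnitRingType) (u y : R) N :
  u \is a GRing.unit -> y ^+ N = 0 -> u + y \is a GRing.unit.
Proof.
move=> Uu yN; pose w := - (u^-1 * y).
have wN : w ^+ N = 0 by rewrite exprNn exprMn yN !mulr0.
have -> : u + y = u * (1 - w).
  by rewrite /w opprK mulrDr mulr1 mulrA divrr // mul1r.
rewrite unitrM Uu /=; apply/unitrPr; exists (\sum_(i < N) w ^+ i).
have := subrX1 w N; rewrite wN sub0r => /esym/eqP.
by rewrite -eqr_oppLR -mulNr opprB => /eqP.
Qed.

Lemma nilpotentD (R : comNzRingType) (x y : R) N M :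
  x ^+ N = 0 -> y ^+ M = 0 -> (x + y) ^+ (N + M) = 0.
Proof.
move=> xN yM; rewrite exprDn big1 // => -[i /= lti] _.
case: (leqP M i) => [leMi|ltiM].
  by rewrite -(subnKC leMi) exprD yM mul0r mulr0 mul0rn.
by rewrite -addnBA ?(ltnW ltiM) // exprD xN !mul0r mul0rn.
Qed.

(** * Block functions *)

(* A label is a block together with a strand, the strand standing for an
   independent variable (the generic value of z); a configuration assigns a label
   to each position and is good when its variables are distinct. *)
Section Labels.
Variables (F : fieldType) (n : nat) (T : finType) (L : fieldType).
Variable tof : {rmorphism mpoly n F -> L}.
Hypothesis tof_inj : injective tof.

Definition rconst (c : F) : L := tof (@mpolyC n F c).
HB.instance Definition _ := GRing.RMorphism.copy rconst (tof \o @mpolyC n F).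
Definition rvar (i : 'I_n) : L := tof ('X_i : mpoly n F).

Definition label := (T * 'I_n)%type.
Definition conf := {ffun 'I_n -> label}.
Implicit Types (c : conf) (a : 'I_n.-1).
Definition good c := injective (fun i => (c i).2).
Definition cswap a c : conf := [ffun i => c (s_ a i)].
(** The tautological configuration: position i carries variable i, so a block function evaluated
    here is literally the rational function of the z_i on the block [t]. *)
Definition cbase (t : {ffun 'I_n -> T}) : conf := [ffun i => (t i, i)].
Definition lz (l : label) : L := rvar l.2.

Lemma rvar_linE (c0 c1 c2 : F) i j (v : 'I_n -> F) :
  rconst c0 + rconst c1 * rvar i + rconst c2 * rvar j = 0 ->
  c0 + c1 * v i + c2 * v j = 0.
Proof.
rewrite /rconst /rvar -!rmorphM -!rmorphD -(rmorph0 tof) => /tof_inj.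
move/(congr1 (meval v)); rewrite meval0.
by rewrite !mevalD !mevalM !mevalC !mevalXU.
Qed.

Lemma rvar_lin_neq0 (c0 c1 c2 : F) i j : c0 != 0 ->
  rconst c0 + rconst c1 * rvar i + rconst c2 * rvar j != 0.
Proof.
move=> nz; apply/negP => /eqP E; have /eqP := rvar_linE (fun=> 0) E.
by rewrite !mulr0 !addr0 (negPf nz).
Qed.

Lemma rvar_lin_neq0_distinct (c0 c1 c2 : F) i j : i != j -> c1 != 0 ->
  rconst c0 + rconst c1 * rvar i + rconst c2 * rvar j != 0.
Proof.
move=> neq nz; apply/negP => /eqP E.
have := rvar_linE (fun k => (k == i)%:R) E.
have := rvar_linE (fun=> 0) E.
rewrite eqxx eq_sym (negPf neq) !mulr0 !addr0 mulr1 => -> /eqP.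
by rewrite add0r (negPf nz).
Qed.

Lemma good_cswap a c : good c -> good (cswap a c).
Proof.
by move=> gc i j; rewrite !ffunE => /gc; apply: perm_inj.
Qed.

Lemma good_cbase t : good (cbase t).
Proof. by move=> i j; rewrite !ffunE. Qed.

Lemma cswapK a : involutive (cswap a).
Proof.
by move=> c; apply/ffunP=> i; rewrite !ffunE /s_ tpermK.
Qed.
End Labels.

Section BlockFunctions.
Variables (F : fieldType) (n : nat) (T : finType) (L : fieldType).
Variable tof : {rmorphism mpoly n F -> L}.
Hypothesis tof_inj : injective tof.
Variable R : comUnitAlgType F.
Variables (eps : 'I_n -> T -> R) (z : 'I_n -> R) (N : nat).
Hypothesis eps_sum : forall i, \sum_t eps i t = 1.
Hypothesis eps_orth : forall i t t', eps i t * eps i t' = (t == t')%:R * eps i t.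
Hypothesis z_nil : forall i, z i ^+ N = 0.
Local Notation conf := (conf n T).
Implicit Types (c : conf) (a : 'I_n.-1) (i j : 'I_n) (t : {ffun 'I_n -> T}).

Lemma lin_unit (c0 c1 c2 : F) i j : c0 != 0 ->
  c0%:A + c1 *: z i + c2 *: z j \is a GRing.unit.
Proof.
move=> nz; rewrite -addrA.
apply: (@unit_add_nilpotent _ _ _ (N + N)).
  by rewrite -in_algE rmorph_unit ?unitfE.
by apply: nilpotentD; rewrite exprZn z_nil scaler0.
Qed.

(* [blockfun G b]: the element b of R is given, on each block, by the rational
   function G in the variables z. *)
Inductive blockfun : (conf -> L) -> R -> Prop :=
| bf_ext G b H : blockfun G b -> (forall c, good c -> G c = H c) -> blockfun H b
| bf_const k : blockfun (fun=> rconst tof k) k%:A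
| bf_z i : blockfun (fun c => lz tof (c i)) (z i)
| bf_eps i s : blockfun (fun c => ((c i).1 == s)%:R) (eps i s)
| bf_inv (c0 c1 c2 : F) i j : c0 != 0 ->
    blockfun
      (fun c => (rconst tof c0 + rconst tof c1 * lz tof (c i)
                 + rconst tof c2 * lz tof (c j))^-1)
      (c0%:A + c1 *: z i + c2 *: z j)^-1
| bf_add G1 b1 G2 b2 : blockfun G1 b1 -> blockfun G2 b2 ->
    blockfun (fun c => G1 c + G2 c) (b1 + b2)
| bf_mul G1 b1 G2 b2 : blockfun G1 b1 -> blockfun G2 b2 ->
    blockfun (fun c => G1 c * G2 c) (b1 * b2).

Definition block t : R := \prod_i eps i (t i).

Lemma sum_block : \sum_t block t = 1.
Proof.
rewrite /block -(bigA_distr_bigA eps); apply: big1 => i _; exact: eps_sum.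
Qed.

Lemma eps_block i s t : eps i s * block t = (t i == s)%:R * block t.
Proof.
rewrite /block (bigD1 i) //= mulrA eps_orth [s == _]eq_sym.
case: (t i =P s) => [->|_]; by rewrite ?mul1r ?mul0r.
Qed.

Local Notation "P ^z" := (mmap (in_alg R) z P) (at level 2).

(** The bridge between the two sides: on each block one fraction P/Q describes both the function and
    the element. It is stated with Q multiplied out because only polynomials, not elements of [L],
    can be evaluated at nilpotents. *)
Lemma blockfun_rational G b : blockfun G b -> forall t,
  exists P Q : mpoly n F, [/\ Q^z \is a GRing.unit,
    G (cbase t) * tof Q = tof P & b * Q^z * block t = P^z * block t].
Proof.
elim=> {G b}.
- move=> G b H _ IH E t; have [P [Q [uQ eG eb]]] := IH t.
  by exists P, Q; rewrite -E //; apply: good_cbase.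
- move=> k t; exists (@mpolyC n F k), 1; rewrite !rmorph1 unitr1 !mulr1 mmapC.
  by [].
- move=> i t; exists 'X_i, 1; rewrite !rmorph1 unitr1 !mulr1 mmapX mmap1U.
  by split=> //; rewrite /lz ffunE.
- move=> i s t; exists (t i == s)%:R, 1; rewrite !rmorph1 unitr1 !mulr1.
  by rewrite !rmorph_nat eps_block ffunE.
- move=> c0 c1 c2 i j nz t.
  pose Q : mpoly n F := mpolyC n c0 + mpolyC n c1 * 'X_i + mpolyC n c2 * 'X_j.
  have Qz : Q^z = c0%:A + c1 *: z i + c2 *: z j.
    by rewrite !rmorphD !rmorphM /= !mmapC !mmapX !mmap1U /= !mulr_algl.
  have uQ : Q^z \is a GRing.unit by rewrite Qz lin_unit.
  exists 1, Q; rewrite !rmorph1 -Qz mulVr //; split=> //.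
  rewrite /Q !rmorphD !rmorphM /lz !ffunE /= mulVf //.
  exact: rvar_lin_neq0.
- move=> G1 b1 G2 b2 _ IH1 _ IH2 t.
  have [P1 [Q1 [u1 e1 f1]]] := IH1 t; have [P2 [Q2 [u2 e2 f2]]] := IH2 t.
  exists (P1 * Q2 + P2 * Q1), (Q1 * Q2).
  rewrite !(rmorphD, rmorphM) /= unitrM u1 u2; split=> //.
    by rewrite -e1 -e2; ring.
  transitivity (b1 * Q1^z * block t * Q2^z + b2 * Q2^z * block t * Q1^z).
    by ring.
  by rewrite f1 f2; ring.
move=> G1 b1 G2 b2 _ IH1 _ IH2 t.
have [P1 [Q1 [u1 e1 f1]]] := IH1 t; have [P2 [Q2 [u2 e2 f2]]] := IH2 t.
exists (P1 * P2), (Q1 * Q2).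
rewrite !(rmorphD, rmorphM) /= unitrM u1 u2; split=> //.
  by rewrite -e1 -e2; ring.
transitivity (b1 * Q1^z * (b2 * Q2^z * block t)); first by ring.
rewrite f2; transitivity (b1 * Q1^z * block t * P2^z); first by ring.
by rewrite f1; ring.
Qed.

(** If G vanishes then P = 0 by injectivity of [tof], and Q is a unit at z, so b is zero on every
    block. The converse fails: a power of some z_i is zero in [R] but not as a function. *)
Lemma blockfun_eq0 G b : blockfun G b ->
  (forall t, G (cbase t) = 0) -> b = 0.
Proof.
move=> /blockfun_rational rat G0.
rewrite -[b]mulr1 -sum_block mulr_sumr big1 // => t _.
have [P [Q [uQ]]] := rat t; rewrite G0 mul0r -(rmorph0 tof) => /tof_inj <- e.
by rewrite -[b](mulrK uQ) mulrAC e rmorph0 !mul0r.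
Qed.

Lemma bf_opp G b : blockfun G b -> blockfun (fun c => - G c) (- b).
Proof.
move=> h; have := bf_mul (bf_const (-1)) h; rewrite mulr_algl scaleN1r.
by move/bf_ext; apply=> c _; rewrite rmorphN1 mulN1r.
Qed.

Lemma bf_sub G1 b1 G2 b2 : blockfun G1 b1 -> blockfun G2 b2 ->
  blockfun (fun c => G1 c - G2 c) (b1 - b2).
Proof. by move=> h1 h2; apply: bf_add h1 (bf_opp h2). Qed.

Lemma blockfun_inj G b H b' : blockfun G b -> blockfun H b' ->
  (forall c, good c -> G c = H c) -> b = b'.
Proof.
move=> h h' E; apply/eqP; rewrite -subr_eq0; apply/eqP.
apply: (blockfun_eq0 (bf_sub h h')) => t; rewrite E ?subrr //.
exact: good_cbase.
Qed.

Lemma bf_sum (I : finType) (G : I -> conf -> L) (b : I -> R) :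
  (forall k, blockfun (G k) (b k)) ->
  blockfun (fun c => \sum_k G k c) (\sum_k b k).
Proof.
move=> h; elim: (index_enum I) => [|k r IH].
  rewrite big_nil -(scale0r 1); apply: bf_ext (bf_const 0) _ => c _.
  by rewrite big_nil rmorph0.
rewrite big_cons; apply: bf_ext (bf_add (h k) IH) _ => c _.
by rewrite big_cons.
Qed.

(** At a given configuration only the summand of its own two blocks survives, so formulas chosen
    separately on each pair of blocks can be glued. *)
Lemma bf_blocks2 i j (G : T -> T -> conf -> L) (b : T -> T -> R) :
  (forall s s', blockfun (G s s') (b s s')) ->
  blockfun (fun c => G (c i).1 (c j).1 c)
    (\sum_s \sum_s' eps i s * eps j s' * b s s').
Proof.
move=> h; have h' s s' := bf_mul (bf_mul (bf_eps i s) (bf_eps j s')) (h s s').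
apply: bf_ext (bf_sum (fun s => bf_sum (h' s))) _ => c _.
rewrite (bigD1 (c i).1) //= (bigD1 (c j).1) //= !eqxx !mul1r !big1 ?addr0 //.
- by move=> s /negPf ne; apply: big1 => s' _;
    rewrite [_ == s]eq_sym ne !mul0r.
- by move=> s' /negPf ne; rewrite [_ == s']eq_sym ne !(mulr0, mul0r).
Qed.
End BlockFunctions.

(** * Hecke operators on functions of configurations *)

Section Operators.
Variables (n : nat) (T : finType) (L : fieldType).
Local Notation label := (label n T).
Local Notation conf := (conf n T).
Implicit Types (c : conf) (a : 'I_n.-1) (v : conf -> L).
Variables (alpha beta : label -> label -> L).

Definition hecke_op a v : conf -> L := fun c =>
  alpha (c (pos a)) (c (pos_succ a)) * v (cswap a c)
  + beta (c (pos a)) (c (pos_succ a)) * v c.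

Definition opw (w : seq 'I_n.-1) v := foldr hecke_op v w.

Lemma op_ext a v1 v2 : (forall c, good c -> v1 c = v2 c) ->
  forall c, good c -> hecke_op a v1 c = hecke_op a v2 c.
Proof. by move=> E c gc; rewrite /hecke_op !E //; apply: good_cswap. Qed.

Lemma opw_ext w v1 v2 : (forall c, good c -> v1 c = v2 c) ->
  forall c, good c -> opw w v1 c = opw w v2 c.
Proof. by move=> E; elim: w => //= a w IH; apply: op_ext. Qed.

Lemma opwD w v1 v2 c :
  opw w (fun c => v1 c + v2 c) c = opw w v1 c + opw w v2 c.
Proof.
by elim: w c => //= a w IH c; rewrite /hecke_op !IH; ring.
Qed.

Lemma opwZ w k v c : opw w (fun c => k * v c) c = k * opw w v c.
Proof.
by elim: w c => //= a w IH c; rewrite /hecke_op !IH; ring.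
Qed.

Lemma opw_cat w1 w2 v : opw (w1 ++ w2) v = opw w1 (opw w2 v).
Proof. by rewrite /opw foldr_cat. Qed.

Section Adjacent.
Variables (a b : 'I_n.-1).
Hypothesis ab : b = a.+1 :> nat.

Lemma pos_adjacent : pos b = pos_succ a.
Proof. exact: val_inj. Qed.

Lemma pos_neq (x : 'I_n.-1) : pos x != pos_succ x.
Proof. by rewrite -val_eqE /= neq_ltn ltnSn. Qed.

Lemma pos_neq2 : pos a != pos_succ b.
Proof. by rewrite -val_eqE /= ab neq_ltn ltnW. Qed.

Lemma s_adjacent : ((s_ a (pos a) = pos_succ a) * (s_ a (pos_succ a) = pos a)
  * (s_ a (pos_succ b) = pos_succ b) * (s_ b (pos a) = pos a)
  * (s_ b (pos_succ a) = pos_succ b) * (s_ b (pos_succ b) = pos_succ a))%type.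
Proof.
have n1 := pos_neq a; have n2 := pos_neq b; have n3 := pos_neq2.
rewrite -pos_adjacent /s_ pos_adjacent in n1 n2 *.
by rewrite !(tpermL, tpermR) !tpermD // eq_sym.
Qed.

Lemma s_braid i : s_ a (s_ b (s_ a i)) = s_ b (s_ a (s_ b i)).
Proof.
have S := s_adjacent.
have [->|n1] := eqVneq i (pos a); first by rewrite !S.
have [->|n2] := eqVneq i (pos_succ a); first by rewrite !S.
have [->|n3] := eqVneq i (pos_succ b); first by rewrite !S.
have ea : s_ a i = i by rewrite /s_ tpermD // eq_sym.
have eb : s_ b i = i by rewrite /s_ tpermD // ?pos_adjacent // eq_sym.
by rewrite !(ea, eb).
Qed.

Lemma cswap_braid c :
  cswap a (cswap b (cswap a c)) = cswap b (cswap a (cswap b c)).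
Proof. by apply/ffunP => i; rewrite !ffunE s_braid. Qed.

(** One reduced word for each of the six elements of the copy of S_3 generated by [s_ a] and
    [s_ b]. *)
Definition braid_words : seq (seq 'I_n.-1) :=
  [:: [::]; [:: a]; [:: b]; [:: a; b]; [:: b; a]; [:: a; b; a]].

Hypothesis alpha_neq0 : forall l l', l.2 != l'.2 -> alpha l l' != 0.

Lemma alpha_good_neq0 c i j : good c -> i != j -> alpha (c i) (c j) != 0.
Proof. by move=> gc nij; apply: alpha_neq0; apply: contraNneq nij => /gc ->. Qed.

Lemma delta_good c0 i j c' : good c0 -> i != j -> c' i = c0 j ->
  (c' == c0) = false.
Proof.
move=> gc nij e; apply: contraNF nij => /eqP E; apply/eqP/gc.
by rewrite /= -e E.
Qed.

(** A triangularity argument. Evaluated at a translate of [c0], a word sees the delta function at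
    [c0] only through subwords leading back to it; taking the translates by decreasing length
    isolates one coefficient at a time, multiplied by a product of nonzero alphas. *)
Lemma braid_words_independent (c0 : conf) (k : seq 'I_n.-1 -> L) : good c0 ->
  (forall c, good c ->
     \sum_(w <- braid_words) k w * opw w (fun c' => (c' == c0)%:R) c = 0) ->
  forall w, w \in braid_words -> k w = 0.
Proof.
move=> g0 sum0.
have S := s_adjacent; have n1 := pos_neq a; have n3 := pos_neq2.
have n2 := pos_neq b; rewrite pos_adjacent in n2.
pose ca := cswap a c0; pose cb := cswap b c0.
pose cab := cswap a cb; pose cba := cswap b ca; pose caba := cswap a cba.
(* Table of the action of both swaps on the six translates of [c0]; the braid relation enters only
   in the two entries linking [cab] with the longest translate. *)
have actE : ((cswap a c0 = ca) * (cswap a ca = c0) * (cswap a cb = cab)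
  * (cswap a cab = cb) * (cswap a cba = caba) * (cswap a caba = cba)
  * (cswap b c0 = cb) * (cswap b cb = c0) * (cswap b ca = cba)
  * (cswap b cba = ca) * (cswap b cab = caba) * (cswap b caba = cab))%type.
  do ![split]; rewrite ?cswapK //.
    by rewrite /cab /cb /caba /cba /ca cswap_braid.
  by rewrite /caba /cba /ca cswap_braid cswapK.
(* The orbit is free: each translate differs from [c0] at a position where it carries another of the
   distinct variables. *)
have dE : ((ca == c0 = false) * (cb == c0 = false) * (cab == c0 = false)
  * (cba == c0 = false) * (caba == c0 = false))%type.
  do ![split].
  - by apply: (delta_good g0 n1); rewrite ffunE S.
  - by apply: (delta_good g0 n2); rewrite ffunE S.
  - by apply: (delta_good g0 n3); rewrite !ffunE !S.
  - by apply: (delta_good g0 n1); rewrite !ffunE !S.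
  - by apply: (delta_good g0 n3); rewrite !ffunE !S.
have ga := @good_cswap _ _ a _ g0; have gb := @good_cswap _ _ b _ g0.
have gab := @good_cswap _ _ a _ gb; have gba := @good_cswap _ _ b _ ga.
have gaba := @good_cswap _ _ a _ gba.
have A0 c (gc : good c) : alpha (c (pos a)) (c (pos_succ a)) != 0.
  exact: alpha_good_neq0.
have B0 c (gc : good c) : alpha (c (pos b)) (c (pos_succ b)) != 0.
  by apply: alpha_good_neq0 => //; apply: pos_neq.
have expand c : good c -> _ := fun gc => sum0 c gc.
rewrite /braid_words in expand.
have red := (big_cons, big_nil, actE, dE, eqxx, mulr0, addr0, add0r, mulr1).
have e6 : k [:: a; b; a] = 0.
  have := expand _ gaba; rewrite !big_cons big_nil /= /hecke_op !red => /eqP.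
  by rewrite !mulf_eq0 ?(negPf (A0 _ _)) ?(negPf (B0 _ _)) // !orbF => /eqP.
have e4 : k [:: a; b] = 0.
  have := expand _ gab; rewrite !big_cons big_nil e6 mul0r /= /hecke_op !red => /eqP.
  by rewrite !mulf_eq0 ?(negPf (A0 _ _)) ?(negPf (B0 _ _)) // !orbF => /eqP.
have e5 : k [:: b; a] = 0.
  have := expand _ gba; rewrite !big_cons big_nil e6 e4 !mul0r /= /hecke_op !red => /eqP.
  by rewrite !mulf_eq0 ?(negPf (A0 _ _)) ?(negPf (B0 _ _)) // !orbF => /eqP.
have e2 : k [:: a] = 0.
  have := expand _ ga; rewrite !big_cons big_nil e6 e4 e5 !mul0r /= /hecke_op !red => /eqP.
  by rewrite !mulf_eq0 ?(negPf (A0 _ _)) ?(negPf (B0 _ _)) // !orbF => /eqP.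
have e3 : k [:: b] = 0.
  have := expand _ gb; rewrite !big_cons big_nil e6 e4 e5 e2 !mul0r /= /hecke_op !red => /eqP.
  by rewrite !mulf_eq0 ?(negPf (A0 _ _)) ?(negPf (B0 _ _)) // !orbF => /eqP.
have e1 : k [::] = 0.
  by have := expand _ g0; rewrite !big_cons big_nil e6 e4 e5 e2 e3 !mul0r /= !red.
move=> w; rewrite !inE.
by do 5?[case/predU1P=> [->//|]] => /eqP->.
Qed.
End Adjacent.

Lemma pair_words_independent a (c0 : conf) (k : seq 'I_n.-1 -> L) :
  (forall l l', l.2 != l'.2 -> alpha l l' != 0) -> good c0 ->
  (forall c, good c ->
     \sum_(w <- [:: [::]; [:: a]]) k w * opw w (fun c' => (c' == c0)%:R) c = 0) ->
  forall w, w \in [:: [::]; [:: a]] -> k w = 0.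
Proof.
move=> alpha_neq0 g0 sum0; have n1 := pos_neq a.
have d : (cswap a c0 == c0) = false.
  by apply: (delta_good g0 n1); rewrite ffunE /s_ tpermL.
have e2 : k [:: a] = 0.
  have := sum0 _ (@good_cswap _ _ a _ g0).
  rewrite !big_cons big_nil /= /hecke_op cswapK d eqxx !mulr0 !addr0 mulr1 add0r.
  move/eqP; rewrite mulf_eq0 => /orP[/eqP//|].
  rewrite (negPf (alpha_neq0 _ _ _)) //.
  by apply: contraNneq n1 => /(@good_cswap _ _ a _ g0) ->.
have e1 : k [::] = 0.
  by have := sum0 _ g0;
     rewrite !big_cons big_nil /= e2 eqxx mul0r !addr0 mulr1.
by move=> w; rewrite !inE => /orP[]/eqP->.
Qed.
End Operators.

(** * Combinations of words with commuting coefficients, and their operators *)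

Section Span.
Variables (F : fieldType) (n : nat) (T : finType) (L : fieldType).
Variable tof : {rmorphism mpoly n F -> L}.
Hypothesis tof_inj : injective tof.
Variable R : comUnitAlgType F.
Variables (eps : 'I_n -> T -> R) (z : 'I_n -> R) (N : nat).
Hypothesis eps_sum : forall i, \sum_t eps i t = 1.
Hypothesis eps_orth : forall i t t', eps i t * eps i t' = (t == t')%:R * eps i t.
Hypothesis z_nil : forall i, z i ^+ N = 0.
Variables (A : algType F) (iota : {lrmorphism R -> A}).
Local Notation label := (label n T).
Local Notation conf := (conf n T).
Variables (f : 'I_n.-1 -> A) (alpha beta : label -> label -> L).
Local Notation blockfun := (blockfun tof eps z).
Local Notation op := (hecke_op alpha beta).
Local Notation opw := (opw alpha beta).
Implicit Types (c : conf) (a : 'I_n.-1) (v : conf -> L) (w : seq 'I_n.-1).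

(** The twisted Leibniz rule: multiplication by G followed by the exchange of both strands leaves a
    Demazure term [beta] times the difference of G and its swap. Here the algebra is required to
    obey the rule of the operators. *)
Definition commutation a (G : conf -> L) b := blockfun G b /\
  exists b' b'', [/\ blockfun (fun c => G (cswap a c)) b',
    blockfun (fun c => beta (c (pos a)) (c (pos_succ a))
                       * (G c - G (cswap a c))) b''
    & iota b * f a = f a * iota b' + iota b''].

Lemma commutation_ext a G b H : commutation a G b ->
  (forall c, good c -> G c = H c) -> commutation a H b.
Proof.
move=> [h [b' [b'' [h' h'' E]]]] e; split; first exact: bf_ext h e.
exists b', b''; split=> //.
  by apply: bf_ext h' _ => c gc; apply/e/good_cswap.
by apply: bf_ext h'' _ => c gc; rewrite !e //; apply: good_cswap.
Qed.

Lemma commutation_const a k : commutation a (fun=> rconst tof k) k%:A.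
Proof.
split; first exact: bf_const.
exists k%:A, 0; split; first exact: bf_const.
  rewrite -[0](scale0r 1); apply: bf_ext (bf_const tof eps z 0) _ => c _.
  by rewrite subrr mulr0 rmorph0.
by rewrite rmorph0 addr0 rmorph_alg mulr_algl mulr_algr.
Qed.

Lemma commutation_add a G1 b1 G2 b2 :
  commutation a G1 b1 -> commutation a G2 b2 ->
  commutation a (fun c => G1 c + G2 c) (b1 + b2).
Proof.
move=> [h1 [b1' [b1'' [p1 q1 E1]]]] [h2 [b2' [b2'' [p2 q2 E2]]]].
split; first exact: bf_add.
exists (b1' + b2'), (b1'' + b2''); split; first exact: bf_add.
  by apply: bf_ext (bf_add q1 q2) _ => c _; ring.
by rewrite !rmorphD mulrDl E1 E2 mulrDr addrACA.
Qed.

Lemma commutation_mul a G1 b1 G2 b2 :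
  commutation a G1 b1 -> commutation a G2 b2 ->
  commutation a (fun c => G1 c * G2 c) (b1 * b2).
Proof.
move=> [h1 [b1' [b1'' [p1 q1 E1]]]] [h2 [b2' [b2'' [p2 q2 E2]]]].
split; first exact: bf_mul.
exists (b1' * b2'), (b1'' * b2' + b1 * b2''); split; first exact: bf_mul.
  apply: bf_ext (bf_add (bf_mul q1 p2) (bf_mul h1 q2)) _ => c _; ring.
rewrite !(rmorphM, rmorphD) -mulrA E2 mulrDr mulrA E1 mulrDl -!mulrA.
by rewrite -addrA.
Qed.

Hypothesis comm_z : forall a i, commutation a (fun c => lz tof (c i)) (z i).
Hypothesis comm_eps :
  forall a i s, commutation a (fun c => ((c i).1 == s)%:R) (eps i s).

(** The rule is stable under sums and products, so the generators and the inverses remain. If b f =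
    f b' + b'', then f b'^-1 = b^-1 f + b^-1 b'' b'^-1, which is the rule for the inverse. *)
Lemma blockfun_comm a G b : blockfun G b -> commutation a G b.
Proof.
elim=> {G b}.
- by move=> G b H _ IH E; apply: commutation_ext IH E.
- exact: commutation_const.
- exact: comm_z.
- exact: comm_eps.
- move=> c0 c1 c2 i j nz.
  have lin k l : blockfun (fun c => rconst tof c0 + rconst tof c1 * lz tof (c k)
      + rconst tof c2 * lz tof (c l)) (c0%:A + c1 *: z k + c2 *: z l).
    rewrite -(mulr_algl c1) -(mulr_algl c2).
    by apply: bf_add; [apply: bf_add|]; [apply: bf_const| |];
      apply: bf_mul; (try apply: bf_const); apply: bf_z.
  have := commutation_add (commutation_add (commutation_const a c0)
    (commutation_mul (commutation_const a c1) (comm_z a i)))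
    (commutation_mul (commutation_const a c2) (comm_z a j)).
  rewrite !mulr_algl => -[h [b' [b'' [h' h'' E]]]].
  (* The element [b'] is known only through its block function; it must be identified to see that it
     is a unit. *)
  have eb' : b' = c0%:A + c1 *: z (s_ a i) + c2 *: z (s_ a j).
    apply: (blockfun_inj tof_inj eps_sum eps_orth z_nil h' (lin (s_ a i) (s_ a j))).
    by move=> c _; rewrite /cswap !ffunE.
  have U := lin_unit z_nil c1 c2 i j nz.
  have U' : b' \is a GRing.unit by rewrite eb' (lin_unit z_nil).
  set b := _ + _ + _ in U h E *.
  split; first exact: bf_inv.
  have hinv := bf_inv tof eps z c1 c2 i j nz.
  have hinv' := bf_inv tof eps z c1 c2 (s_ a i) (s_ a j) nz; rewrite -eb' in hinv'.
  exists b'^-1, (- (b^-1 * b'' * b'^-1)); split.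
  + by apply: bf_ext hinv' _ => c _; rewrite !ffunE.
  + apply: bf_ext (bf_opp (bf_mul (bf_mul hinv h'') hinv')) _ => c _ /=.
    rewrite !ffunE.
    have n1 := rvar_lin_neq0 tof_inj c1 c2 (c i).2 (c j).2 nz.
    have n2 := rvar_lin_neq0 tof_inj c1 c2 (c (s_ a i)).2 (c (s_ a j)).2 nz.
    by rewrite /lz; field; rewrite n1 n2.
  have bV : iota b^-1 * iota b = 1 by rewrite -rmorphM mulVr // rmorph1.
  have b'V : iota b' * iota b'^-1 = 1 by rewrite -rmorphM mulrV // rmorph1.
  have e1 : iota b * f a * iota b'^-1 = f a + iota b'' * iota b'^-1.
    by rewrite E mulrDl -mulrA b'V mulr1.
  have e2 : f a * iota b'^-1 =
      iota b^-1 * f a + iota b^-1 * iota b'' * iota b'^-1.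
    by rewrite -[LHS]mul1r -bV -mulrA [X in _ * X = _]mulrA e1 mulrDr mulrA.
  by rewrite e2 rmorphN !rmorphM addrK.
- by move=> *; apply: commutation_add.
- by move=> *; apply: commutation_mul.
Qed.

Definition word_product w : A := \prod_(a <- w) f a.
Local Notation fw := word_product.

Section Words.
Variable W : seq (seq 'I_n.-1).

(* [span m x]: x is a combination of the words in W with coefficients in R on the
   right, and m is the corresponding operator on functions of configurations. *)
Definition span (m : (conf -> L) -> conf -> L) (x : A) :=
  exists (G : seq 'I_n.-1 -> conf -> L) (b : seq 'I_n.-1 -> R),
  [/\ forall w, blockfun (G w) (b w), x = \sum_(w <- W) fw w * iota (b w) &
      forall v c, good c ->
        m v c = \sum_(w <- W) opw w (fun c => G w c * v c) c].

Lemma span_ext m x m' : span m x ->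
  (forall v c, good c -> m v c = m' v c) -> span m' x.
Proof.
move=> [G [b [h E M]]] e; exists G, b; split=> // v c gc.
by rewrite -e // M.
Qed.

Lemma span0 : span (fun _ _ => 0) 0.
Proof.
exists (fun _ _ => rconst tof 0), (fun=> 0%:A); split.
- by move=> w; apply: bf_const.
- by rewrite big1 // => w _; rewrite scale0r rmorph0 mulr0.
- move=> v c _; rewrite big1 // => w _.
  by rewrite opwZ rmorph0 mul0r.
Qed.

Lemma span_add m1 x1 m2 x2 : span m1 x1 -> span m2 x2 ->
  span (fun v c => m1 v c + m2 v c) (x1 + x2).
Proof.
move=> [G1 [b1 [h1 E1 M1]]] [G2 [b2 [h2 E2 M2]]].
exists (fun w c => G1 w c + G2 w c), (fun w => b1 w + b2 w); split.
- by move=> w; apply: bf_add.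
- rewrite E1 E2 -big_split; apply: eq_bigr => w _.
  by rewrite rmorphD mulrDr.
move=> v c gc; rewrite M1 // M2 // -big_split; apply: eq_bigr => w _ /=.
by rewrite -opwD; apply: opw_ext gc => c' _; rewrite mulrDl.
Qed.

Lemma span_bf m x G b : span m x -> blockfun G b ->
  span (fun v => m (fun c => G c * v c)) (x * iota b).
Proof.
move=> [G1 [b1 [h1 E1 M1]]] h.
exists (fun w c => G1 w c * G c), (fun w => b1 w * b); split.
- by move=> w; apply: bf_mul.
- by rewrite E1 mulr_suml; apply: eq_bigr => w _; rewrite rmorphM mulrA.
move=> v c gc; rewrite M1 //; apply: eq_bigr => w _ /=.
by apply: opw_ext gc => c' _; rewrite mulrA.
Qed.

Lemma span_opp m x : span m x -> span (fun v c => - m v c) (- x).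
Proof.
move=> s; have := span_bf s (bf_const tof eps z (-1)).
rewrite rmorph_alg mulr_algr scaleN1r => /span_ext; apply=> v c gc.
case: s => [G [b [_ _ M]]]; rewrite !M // -sumrN; apply: eq_bigr => w _.
rewrite rmorphN1 -[RHS]mulN1r -opwZ; apply: opw_ext gc => c' _; ring.
Qed.

Lemma span_word w : uniq W -> w \in W -> span (opw w) (fw w).
Proof.
move=> uW Ww.
exists (fun w' _ => rconst tof (w' == w)%:R), (fun w' => (w' == w)%:R%:A); split.
- by move=> w'; apply: bf_const.
- rewrite (bigD1_seq w) //= eqxx scale1r rmorph1 mulr1 big1 ?addr0 //.
  by move=> w' /negPf ->; rewrite scale0r rmorph0 mulr0.
move=> v c gc; rewrite (bigD1_seq w) //= eqxx big1 ?addr0 => [|w' /negPf ->].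
  by apply: opw_ext gc => c' _; rewrite rmorph1 mul1r.
by rewrite opwZ rmorph0 mul0r.
Qed.

Lemma span_mul_f a m x :
  (forall w, w \in W -> span (fun v => opw w (op a v)) (fw w * f a)) ->
  (forall w, w \in W -> span (opw w) (fw w)) ->
  span m x -> span (fun v => m (op a v)) (x * f a).
Proof.
move=> cW sW [G [b [h -> M]]].
(* The induction runs over a sublist of words, but the span stays that of the whole [W], since a
   word times [f a] may leave the sublist. *)
suff: forall W', {subset W' <= W} ->
  span (fun v c => \sum_(w <- W') opw w (fun c => G w c * op a v c) c)
    ((\sum_(w <- W') fw w * iota (b w)) * f a).
  move/(_ W (fun _ => id))/span_ext; apply=> v c gc.
  by rewrite M.
elim=> [|w W' IH] sub.
  rewrite big_nil mul0r; apply: span_ext span0 _ => v c _.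
  by rewrite big_nil.
have Ww : w \in W by apply: sub; rewrite inE eqxx.
have {}IH := IH (fun w' h' => sub w' (mem_behead (h' : w' \in behead (w :: W')))).
have [_ [b' [b'' [h' h'' E]]]] := blockfun_comm a (h w).
rewrite big_cons mulrDl -mulrA E mulrDr mulrA.
apply: span_ext
  (span_add (span_add (span_bf (cW w Ww) h') (span_bf (sW w Ww) h'')) IH) _.
move=> v c gc; rewrite big_cons; congr (_ + _); rewrite -opwD.
by apply: opw_ext gc => c' _; rewrite /hecke_op cswapK; ring.
Qed.

(** Constant coefficients and delta functions at the [cbase t] suffice, because [blockfun_eq0] asks
    only for the values at these configurations. *)
Definition independent := forall (t : {ffun 'I_n -> T}) (k : seq 'I_n.-1 -> L),
  (forall c, good c ->
     \sum_(w <- W) k w * opw w (fun c' => (c' == cbase t)%:R) c = 0) ->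
  forall w, w \in W -> k w = 0.

Lemma span_eq0 m x : independent -> span m x ->
  (forall v c, good c -> m v c = 0) -> x = 0.
Proof.
move=> indep [G [b [h -> M]]] m0; rewrite big_seq big1 // => w Ww.
rewrite (blockfun_eq0 tof_inj eps_sum eps_orth z_nil (h w)) ?rmorph0 ?mulr0 //.
(* On the delta function at [cbase t], multiplication by [G w] is multiplication by the constant
   [G w (cbase t)]. *)
move=> t; apply: (indep t (fun w => G w (cbase t))) Ww => c gc.
rewrite -[RHS](m0 (fun c' => (c' == cbase t)%:R) c gc) M //.
apply: eq_bigr => w' _; rewrite -opwZ; apply: opw_ext gc => c' _.
by case: eqP => [->|_]; rewrite ?mulr0.
Qed.

Lemma span_inj m x m' x' : independent -> span m x -> span m' x' ->
  (forall v c, good c -> m v c = m' v c) -> x = x'.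
Proof.
move=> indep h h' e; apply/eqP; rewrite -subr_eq0; apply/eqP.
apply: (span_eq0 indep (span_add h (span_opp h'))) => v c gc.
by rewrite e ?subrr.
Qed.
End Words.
End Span.

Section HeckeOperators.
Variables (n d : nat) (T : finType) (L : fieldType) (col : T -> 'I_d).
Local Notation label := (label n T).
Local Notation conf := (conf n T).
Implicit Types (c : conf) (a b : 'I_n.-1) (v : conf -> L) (l : label).

Definition same_color l l' : L := (col l.1 == col l'.1)%:R.

(** The value of [beta] is imposed by the relation between [f a] and the spectral variables. The
    quadratic relation constrains [alpha l l'] only through its product with [alpha l' l]; the
    remaining freedom is fixed for equal colors and left open for different ones. *)
Record hecke_symbols (h0 h1 : L) (xi : label -> L)
    (alpha beta : label -> label -> L) : Prop := HeckeSymbols {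
  symbol_xi : forall l l', l.2 != l'.2 -> xi l != xi l';
  symbol_beta : forall l l', l.2 != l'.2 ->
    beta l l' = - (same_color l l' * (h0 + h1 * xi l')) / (xi l - xi l');
  symbol_alpha : forall l l', l.2 != l'.2 -> col l.1 = col l'.1 ->
    alpha l l' = 1 + h1 - beta l l';
  symbol_alpha_diff : forall l l', l.2 != l'.2 -> col l.1 != col l'.1 ->
    alpha l l' * alpha l' l = 1 + h1;
  symbol_alpha_neq0 : forall l l', l.2 != l'.2 -> alpha l l' != 0 }.

Variables (h0 h1 : L) (xi : label -> L) (alpha beta : label -> label -> L).
Hypothesis S : hecke_symbols h0 h1 xi alpha beta.
Local Notation op := (hecke_op alpha beta).

Lemma good_labels_neq c i j : good c -> i != j -> (c i).2 != (c j).2.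
Proof. by move=> gc; apply: contraNneq => /gc ->. Qed.

Lemma xi_sub_neq0 l l' : l.2 != l'.2 -> xi l - xi l' != 0.
Proof. by rewrite subr_eq0; apply: symbol_xi S _ _. Qed.

Lemma same_colorC l l' : same_color l' l = same_color l l'.
Proof. by rewrite /same_color eq_sym. Qed.

Lemma cswap_pos a c : (cswap a c (pos a) = c (pos_succ a))
  * (cswap a c (pos_succ a) = c (pos a)).
Proof. by split; rewrite ffunE /s_ ?tpermL ?tpermR. Qed.

Lemma beta_diff l l' : l.2 != l'.2 -> col l.1 != col l'.1 -> beta l l' = 0.
Proof.
move=> n2 n1; rewrite (symbol_beta S n2) /same_color (negPf n1).
by rewrite mul0r oppr0 mul0r.
Qed.

Lemma op_quad a v c : good c -> op a (op a v) c =
  (1 + h1) * v c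
  + h1 * op a (fun c => same_color (c (pos a)) (c (pos_succ a)) * v c) c.
Proof.
move=> gc; rewrite /hecke_op cswapK !cswap_pos.
have n12 := good_labels_neq gc (pos_neq a).
have n21 : (c (pos_succ a)).2 != (c (pos a)).2 by rewrite eq_sym.
move: (c (pos a)) (c (pos_succ a)) n12 n21 => l l' n12 n21.
rewrite (same_colorC l l').
case: (eqVneq (col l.1) (col l'.1)) => [e|ne].
  have sc : same_color l l' = 1 by rewrite /same_color e eqxx.
  rewrite !(symbol_alpha S) // sc !(symbol_beta S) // (same_colorC l l') sc.
  have := xi_sub_neq0 n12; have := xi_sub_neq0 n21.
  move: (xi l) (xi l') (v c) (v _) => x y v1 v2 nx ny.
  by field; rewrite nx ny.
rewrite !beta_diff // 1?eq_sym // !mul0r !addr0 mulrA.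
rewrite (symbol_alpha_diff S) // /same_color (negPf ne).
by rewrite !(mul0r, mulr0) addr0.
Qed.

(** A formula in [beta] alone, uniform in the colors, which reduces the braid relation to identities
    between the betas. *)
Lemma alphaM l l' : l.2 != l'.2 -> alpha l l' * alpha l' l =
  1 + h1 + h1 * beta l l' - beta l l' ^+ 2.
Proof.
move=> n12; have n21 : l'.2 != l.2 by rewrite eq_sym.
case: (eqVneq (col l.1) (col l'.1)) => [e|ne]; last first.
  by rewrite (symbol_alpha_diff S) // beta_diff // mulr0 expr0n subr0 addr0.
have sc : same_color l l' = 1 by rewrite /same_color e eqxx.
rewrite !(symbol_alpha S) // !(symbol_beta S) // (same_colorC l l') sc.
have := xi_sub_neq0 n12; have := xi_sub_neq0 n21.
by move: (xi l) (xi l') => x y nx ny; field; rewrite nx ny.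
Qed.

(** The difference of the two sides of the braid relation is a combination of these three
    identities, each a computation with rational functions for every pattern of equal colors. *)
Lemma beta_yang_baxter l1 l2 l3 :
  l1.2 != l2.2 -> l2.2 != l3.2 -> l1.2 != l3.2 ->
  [/\ beta l1 l3 * beta l2 l1 + beta l1 l2 * beta l2 l3
        = beta l2 l3 * beta l1 l3,
      beta l1 l3 * beta l3 l2 + beta l2 l3 * beta l1 l2
        = beta l1 l2 * beta l1 l3 &
      beta l1 l3 * (alpha l1 l2 * alpha l2 l1) + beta l1 l2 ^+ 2 * beta l2 l3
        = beta l1 l3 * (alpha l2 l3 * alpha l3 l2)
          + beta l2 l3 ^+ 2 * beta l1 l2].
Proof.
move=> n12 n23 n13.
have n21 : l2.2 != l1.2 by rewrite eq_sym.
have n32 : l3.2 != l2.2 by rewrite eq_sym.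
rewrite !alphaM // !(symbol_beta S) // (same_colorC l1 l2) (same_colorC l2 l3).
have := xi_sub_neq0 n12; have := xi_sub_neq0 n21; have := xi_sub_neq0 n23.
have := xi_sub_neq0 n32; have := xi_sub_neq0 n13.
rewrite /same_color.
move: (xi l1) (xi l2) (xi l3) => x1 x2 x3 m13 m32 m23 m21 m12.
move: (col l1.1) (col l2.1) (col l3.1) => c1 c2 c3.
have [e12|ne12] := altP (c1 =P c2); have [e23|ne23] := altP (c2 =P c3);
  rewrite ?e12 ?e23 ?eqxx -?e23 ?(negPf ne12) ?(negPf ne23) /=;
  try (case: (_ == _)); rewrite ?mulr1n ?mulr0n;
  split; field; rewrite ?m12 ?m13 ?m23 ?m32 ?m21 //.
Qed.

Lemma op_braid a b v c : b = a.+1 :> nat -> good c ->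
  op a (op b (op a v)) c = op b (op a (op b v)) c.
Proof.
move=> ab gc; have Sw := s_adjacent ab.
have n1 := good_labels_neq gc (pos_neq a).
have n2 := good_labels_neq gc (pos_neq b).
have n3 := good_labels_neq gc (pos_neq2 ab).
rewrite (pos_adjacent ab) in n2.
rewrite /hecke_op !(pos_adjacent ab) !ffunE !Sw !cswapK -!(cswap_braid ab).
move: (v c) (v (cswap b c)) (v _) (v _) (v _) (v _).
move: (c (pos a)) (c (pos_succ a)) (c (pos_succ b)) n1 n2 n3.
move=> l1 l2 l3 n1 n2 n3 v1 v2 v3 v4 v5 v6.
have [e1 e2 e3] := beta_yang_baxter n1 n2 n3.
move/eqP: e1; rewrite -subr_eq0 => /eqP e1.
move/eqP: e2; rewrite -subr_eq0 => /eqP e2.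
move/eqP: e3; rewrite -subr_eq0 => /eqP e3.
(* The right-hand side 0 is replaced by the combination of the three identities with multipliers
   [alpha l1 l2 * v3], [- alpha l2 l3 * v2] and [v4], after which both sides agree formally. *)
apply: subr0_eq; rewrite -[RHS](addr0 0) -{1}(addr0 0).
rewrite -{1}(mulr0 (alpha l1 l2 * v3)) -{1}e1.
rewrite -{1}(mulr0 (- alpha l2 l3 * v2)) -{1}e2.
by rewrite -{1}(mulr0 v4) -{1}e3; ring.
Qed.

Lemma cswap_far a b c : (a.+1 < b)%N || (b.+1 < a)%N ->
  (cswap a c (pos b) = c (pos b)) * (cswap a c (pos_succ b) = c (pos_succ b)).
Proof.
by move=> far; rewrite !ffunE /s_ !tpermD // -val_eqE /=; lia.
Qed.
End HeckeOperators.

(** * Affine Hecke relations and their transfer *)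

Section AffineHecke.
Variables (F : fieldType) (A : algType F) (n d : nat).

Definition color_idem (t : 'I_n -> A) (a : 'I_n.-1) : A :=
  d%:R^-1 *: \sum_(j < d) t (pos a) ^+ j * t (pos_succ a) ^+ (d - j).

Definition exchange (h0 h1 : F) (t x : 'I_n -> A) a : A :=
  color_idem t a * (h0%:A + h1 *: x (pos_succ a)).

(* (h0, h1) = (1, 0) gives the degenerate relations and (0, q - 1) the others. *)
Record affine_hecke (h0 h1 : F) (f : 'I_n.-1 -> A) (t x : 'I_n -> A) : Prop :=
  AffineHecke {
  ah_tpow : forall b, t b ^+ d = 1;
  ah_tt : forall b b', t b * t b' = t b' * t b;
  ah_xx : forall b b', x b * x b' = x b' * x b;
  ah_xt : forall b b', x b * t b' = t b' * x b;
  ah_tf : forall a b, t b * f a = f a * t (s_ a b);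
  ah_xf : forall a b, b != pos a -> b != pos_succ a -> x b * f a = f a * x b;
  ah_xf1 : forall a, x (pos a) * f a
    = f a * x (pos_succ a) - exchange h0 h1 t x a;
  ah_xf2 : forall a, x (pos_succ a) * f a
    = f a * x (pos a) + exchange h0 h1 t x a;
  ah_ff : forall a, f a * f a = (1 + h1)%:A + h1 *: (f a * color_idem t a);
  ah_far : forall a b : 'I_n.-1, (a.+1 < b)%N || (b.+1 < a)%N -> f a * f b = f b * f a;
  ah_braid : forall a b : 'I_n.-1, b = a.+1 :> nat ->
    f a * f b * f a = f b * f a * f b }.
End AffineHecke.

Lemma color_idem_morph (F : fieldType) (A B : algType F) n d
    (h : {lrmorphism A -> B}) (t : 'I_n -> A) a :
  h (color_idem d t a) = color_idem d (h \o t) a.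
Proof.
rewrite /color_idem linearZ rmorph_sum; congr (_ *: _); apply: eq_bigr => j _.
by rewrite rmorphM !rmorphXn.
Qed.

(** Orthogonality of the characters of a cyclic group: the sum is geometric, with ratio the d-th
    root of unity [w ^+ c / w ^+ c']. *)
Lemma sum_prim_root (F : fieldType) d (w : F) (c c' : 'I_d) :
  d.-primitive_root w -> d%:R != 0 :> F ->
  d%:R^-1 * \sum_(j < d) (w ^+ c) ^+ j * (w ^+ c') ^+ (d - j) = (c == c')%:R.
Proof.
move=> pw nzd; have wd := prim_expr_order pw.
have w0 : w != 0.
  apply/eqP=> w0; have := wd; rewrite w0 expr0n gtn_eqF ?(prim_order_gt0 pw) //.
  by move/esym/eqP; rewrite oner_eq0.
have wcd (k : 'I_d) : (w ^+ k) ^+ d = 1 by rewrite exprAC wd expr1n.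
pose y := w ^+ c / w ^+ c'.
have yd : y ^+ d = 1 by rewrite expr_div_n !wcd divr1.
have -> : \sum_(j < d) (w ^+ c) ^+ j * (w ^+ c') ^+ (d - j)
    = \sum_(j < d) y ^+ j.
  apply: eq_bigr => j _; rewrite expr_div_n; congr (_ * _).
  have nz : (w ^+ c') ^+ j != 0 by rewrite !expf_neq0.
  by apply: (mulIf nz); rewrite mulVf // -exprD subnK ?wcd ?(ltnW (ltn_ord j)).
have [e|ne] := eqVneq c c'.
  rewrite /y e divff ?expf_neq0 //.
  under eq_bigr do rewrite expr1n.
  by rewrite sumr_const card_ord mulVf.
have ny : y - 1 != 0.
  rewrite subr_eq0; apply: contraNneq ne => y1.
  have : w ^+ c = w ^+ c' by rewrite -[RHS]mul1r -y1 divfK ?expf_neq0.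
  by move/eqP; rewrite (eq_prim_root_expr pw) !modn_small.
rewrite [X in _ * X](_ : _ = 0) ?mulr0 //; apply: (mulfI ny).
by rewrite -subrX1 yd subrr mulr0.
Qed.

Section Transfer.
Variables (F : fieldType) (n d : nat) (T : finType) (L : fieldType).
Variable tof : {rmorphism mpoly n F -> L}.
Hypothesis tof_inj : injective tof.
Variable R : comUnitAlgType F.
Variables (eps : 'I_n -> T -> R) (z : 'I_n -> R) (N : nat).
Hypothesis eps_sum : forall i, \sum_t eps i t = 1.
Hypothesis eps_orth : forall i t t', eps i t * eps i t' = (t == t')%:R * eps i t.
Hypothesis z_nil : forall i, z i ^+ N = 0.
Variables (A : algType F) (iota : {lrmorphism R -> A}).
Variables (col : T -> 'I_d) (w : F).
Hypotheses (w_prim : d.-primitive_root w) (d_neq0 : d%:R != 0 :> F).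
Local Notation label := (label n T).
Local Notation conf := (conf n T).
Local Notation blockfun := (blockfun tof eps z).
Implicit Types (c : conf) (a b : 'I_n.-1) (v : conf -> L).

Definition tcoord (i : 'I_n) : R := \sum_s eps i s * (w ^+ col s)%:A.
(** From the same idempotents and nilpotents, the pair (kappa, 1) gives x = k + z and the pair
    (theta, theta) gives X = q^k (1 + z). *)
Definition spectral (p p' : T -> F) (i : 'I_n) : R :=
  \sum_s eps i s * ((p s)%:A + p' s *: z i).
Definition tlabel (l : label) : L := rconst tof (w ^+ col l.1).
Definition spectral_label (p p' : T -> F) (l : label) : L :=
  rconst tof (p l.1) + rconst tof (p' l.1) * lz tof l.

Lemma bf_blocks1 i (G : T -> conf -> L) (b : T -> R) :
  (forall s, blockfun (G s) (b s)) ->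
  blockfun (fun c => G (c i).1 c) (\sum_s eps i s * b s).
Proof.
move=> h; have h' s := bf_mul (bf_eps tof eps z i s) (h s).
have H := bf_sum h'; apply: (bf_ext H) => c _.
rewrite (bigD1 (c i).1) //= eqxx mul1r big1 ?addr0 // => s /negPf ne.
by rewrite eq_sym ne mul0r.
Qed.

Lemma bf_tcoord i : blockfun (fun c => tlabel (c i)) (tcoord i).
Proof.
apply: (@bf_blocks1 i (fun s _ => rconst tof (w ^+ col s))) => s.
exact: bf_const.
Qed.

Lemma bf_spectral p p' i :
  blockfun (fun c => spectral_label p p' (c i)) (spectral p p' i).
Proof.
apply: (@bf_blocks1 i (fun s c => rconst tof (p s) + rconst tof (p' s)
  * lz tof (c i))) => s.
apply: bf_add; first exact: bf_const.
by rewrite -mulr_algl; apply: bf_mul; [apply: bf_const | apply: bf_z].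
Qed.

Lemma bf_exp G (r : R) k : blockfun G r -> blockfun (fun c => G c ^+ k) (r ^+ k).
Proof.
move=> h; elim: k => [|k IH].
  rewrite expr0 -(scale1r 1); apply: bf_ext (bf_const tof eps z 1) _ => c _.
  by rewrite rmorph1.
by rewrite exprS; apply: bf_ext (bf_mul h IH) _ => c _; rewrite exprS.
Qed.

Lemma bf_color_idem a : blockfun
  (fun c => same_color L col (c (pos a)) (c (pos_succ a)))
  (color_idem d tcoord a).
Proof.
have h (j : 'I_d) : blockfun
    (fun c => tlabel (c (pos a)) ^+ j * tlabel (c (pos_succ a)) ^+ (d - j))
    (tcoord (pos a) ^+ j * tcoord (pos_succ a) ^+ (d - j)).
  by apply: bf_mul; apply: bf_exp; apply: bf_tcoord.
rewrite /color_idem -mulr_algl; have H := bf_sum h.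
apply: (bf_ext (bf_mul (bf_const tof eps z d%:R^-1) H)) => c _.
rewrite /same_color -(rmorph_nat (rconst tof)).
rewrite -(sum_prim_root (col _) (col _) w_prim d_neq0) rmorphM; congr (_ * _).
by rewrite rmorph_sum; apply: eq_bigr => j _;
  rewrite /tlabel rmorphM -!(rmorphXn (rconst tof)).
Qed.

Variables (h0 h1 : F) (p p' : T -> F).
Variables (f : 'I_n.-1 -> A) (alpha beta : label -> label -> L).
Hypothesis src : affine_hecke d h0 h1 f (iota \o tcoord) (iota \o spectral p p').
Hypothesis sym : hecke_symbols col (rconst tof h0) (rconst tof h1)
  (spectral_label p p') alpha beta.
Hypothesis comm_z : forall a i,
  commutation tof eps z iota f beta a (fun c => lz tof (c i)) (z i).
Hypothesis comm_eps : forall a i s,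
  commutation tof eps z iota f beta a (fun c => ((c i).1 == s)%:R) (eps i s).
Local Notation op := (hecke_op alpha beta).
Local Notation opw := (opw alpha beta).
Local Notation fw := (word_product f).
Local Notation span := (span tof eps z iota f alpha beta).
Local Notation eR := (color_idem d tcoord).

Lemma src_quad a : f a * f a = (1 + h1)%:A + h1 *: (f a * iota (eR a)).
Proof. by rewrite (ah_ff src) color_idem_morph. Qed.

Lemma fw_cat u u' : fw (u ++ u') = fw u * fw u'.
Proof. exact: big_cat. Qed.

Lemma fw1 a : fw [:: a] = f a.
Proof. by rewrite /word_product big_seq1. Qed.

Lemma span_quad W u a : span W (opw u) (fw u) ->
  span W (opw (u ++ [:: a])) (fw (u ++ [:: a])) ->
  span W (fun v => opw (u ++ [:: a]) (op a v)) (fw (u ++ [:: a]) * f a).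
Proof.
move=> su sua.
have -> : fw (u ++ [:: a]) * f a = fw u * iota (1 + h1)%:A
    + fw (u ++ [:: a]) * iota (h1%:A * eR a).
  rewrite fw_cat fw1 -mulrA src_quad mulrDr rmorph_alg; congr (_ + _).
  have -> : iota (h1%:A * eR a) = h1 *: iota (eR a).
    by rewrite mulr_algl; apply: linearZ.
  by rewrite -!scalerAr mulrA.
have H := span_bf sua (bf_mul (bf_const tof eps z h1) (bf_color_idem a)).
apply: (span_ext (span_add (span_bf su (bf_const tof eps z (1 + h1))) H)).
move=> v c gc; rewrite !opw_cat -opwD; apply: opw_ext gc => c' gc' /=.
rewrite (op_quad sym) // rmorphD rmorph1; congr (_ + _).
by rewrite /hecke_op; ring.
Qed.

Lemma span_step W u a : uniq W -> u ++ [:: a] \in W ->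
  span W (fun v => opw u (op a v)) (fw u * f a).
Proof.
move=> uW ua; rewrite -fw1 -fw_cat.
apply: (span_ext (span_word tof eps z iota f alpha beta uW ua)) => v c _.
by rewrite opw_cat.
Qed.

Definition closed W a :=
  forall u, u \in W -> span W (fun v => opw u (op a v)) (fw u * f a).

Lemma pair_words_closed a : closed [:: [::]; [:: a]] a.
Proof.
move=> u; rewrite !inE => /orP[]/eqP->; first by apply: span_step; rewrite ?inE ?eqxx ?orbT.
by apply: (@span_quad _ [::] a); apply: span_word; rewrite ?inE ?eqxx ?orbT.
Qed.

Lemma braid_words_uniq a b : b = a.+1 :> nat -> uniq (braid_words a b).
Proof.
move=> ab; have nab : (a == b) = false by rewrite -val_eqE /= ab ltn_eqF.
by rewrite /= !inE !eqseq_cons !eqxx [b == a]eq_sym nab !(andbF, orbF).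
Qed.

Lemma braid_words_closed a b : b = a.+1 :> nat ->
  closed (braid_words a b) a /\ closed (braid_words a b) b.
Proof.
move=> ab; have uW := braid_words_uniq ab.
have wd u : u \in braid_words a b -> span (braid_words a b) (opw u) (fw u).
  by move=> h; apply: span_word.
have st u x : u ++ [:: x] \in braid_words a b ->
    span (braid_words a b) (fun v => opw u (op x v)) (fw u * f x).
  by move=> h; apply: span_step.
have br : f a * f b * f a = f b * f a * f b by exact: ah_braid src _ _ ab.
(* The sixth word could also be spelled bab; the braid relation, in the algebra and for the
   operators, identifies this spelling with the listed aba. *)
have bab : span (braid_words a b) (opw [:: b; a; b]) (fw [:: b; a; b]).
  have := wd [:: a; b; a]; rewrite /word_product !big_cons !big_nil !mulr1 !mulrA br.
  move=> h; apply: (span_ext (h _)) => [|v c gc].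
    by rewrite !inE eqxx !orbT.
  exact: (op_braid sym).
split=> u; rewrite !inE => /or4P[/eqP->|/eqP->|/eqP->|/or3P[]/eqP->].
- by apply: st; rewrite !inE eqxx ?orbT.
- by apply: (@span_quad _ [::] a); apply: wd; rewrite !inE eqxx ?orbT.
- by apply: st; rewrite !inE eqxx ?orbT.
- by apply: st; rewrite !inE eqxx ?orbT.
- by apply: (@span_quad _ [:: b] a); apply: wd; rewrite !inE eqxx ?orbT.
- by apply: (@span_quad _ [:: a; b] a); apply: wd; rewrite !inE eqxx ?orbT.
- by apply: st; rewrite !inE eqxx ?orbT.
- by apply: st; rewrite !inE eqxx ?orbT.
- by apply: (@span_quad _ [::] b); apply: wd; rewrite !inE eqxx ?orbT.
- by apply: (@span_quad _ [:: a] b); apply: wd; rewrite !inE eqxx ?orbT.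
- have := bab; rewrite /word_product !big_cons !big_nil !mulr1 !mulrA => h.
  exact: h.
(* The longest word is respelled to end in b, so that the quadratic relation for [f b] applies. *)
have -> : fw [:: a; b; a] * f b = fw ([:: b; a] ++ [:: b]) * f b.
  by rewrite /word_product !big_cons !big_nil !mulr1 !mulrA br.
apply: (span_ext (@span_quad _ [:: b; a] b _ _)) => [||v c gc].
- by apply: wd; rewrite !inE eqxx ?orbT.
- exact: bab.
- exact/esym/(op_braid sym).
Qed.

Lemma span_additive W m x v v1 v2 : span W m x ->
  (forall c, good c -> v c = v1 c + v2 c) ->
  forall c, good c -> m v c = m v1 c + m v2 c.
Proof.
move=> [G [r [_ _ M]]] E c gc; rewrite !M // -big_split.
apply: eq_bigr => u _ /=; rewrite -opwD; apply: opw_ext gc => c' gc'.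
by rewrite E // mulrDr.
Qed.

Lemma span1 W : uniq W -> [::] \in W -> span W (fun v => v) 1.
Proof.
move=> uW W0; have := span_word tof eps z iota f alpha beta uW W0.
by rewrite /word_product big_nil.
Qed.

Lemma commute_invariant a G r : blockfun G r ->
  (forall c, good c -> G (cswap a c) = G c) -> iota r * f a = f a * iota r.
Proof.
move=> h inv.
have [_ [r' [r'' [h' h'' ->]]]] :=
  blockfun_comm tof_inj eps_sum eps_orth z_nil comm_z comm_eps a h.
have -> : r' = r := blockfun_inj tof_inj eps_sum eps_orth z_nil h' h inv.
have h0'' := bf_const tof eps z 0.
have -> : r'' = 0.
  rewrite -(scale0r 1).
  apply: (blockfun_inj tof_inj eps_sum eps_orth z_nil h'' h0'') => c gc.
  by rewrite inv // subrr mulr0 rmorph0.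
by rewrite rmorph0 addr0.
Qed.

Variables (k0 k1 : F) (q q' : T -> F) (alpha' beta' : label -> label -> L).
Variables (Cf Df : label -> label -> L) (C D : 'I_n.-1 -> R).
Hypothesis sym' : hecke_symbols col (rconst tof k0) (rconst tof k1)
  (spectral_label q q') alpha' beta'.
Hypothesis bfC :
  forall a, blockfun (fun c => Cf (c (pos a)) (c (pos_succ a))) (C a).
Hypothesis bfD :
  forall a, blockfun (fun c => Df (c (pos a)) (c (pos_succ a))) (D a).
Hypothesis alphaE : forall l l', l.2 != l'.2 -> alpha' l l' = alpha l l' * Cf l' l.
Hypothesis betaE : forall l l', l.2 != l'.2 ->
  beta' l l' = beta l l' * Cf l l' + Df l l'.
Local Notation op' := (hecke_op alpha' beta').

Definition transferred a : A := f a * iota (C a) + iota (D a).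
Local Notation g := transferred.

(** Multiplication by C comes before the swap, so C is read at exchanged labels next to [alpha] and
    at the original labels next to [beta]. This is the reason for the order of arguments in [alphaE]
    and [betaE]. *)
Lemma op'E a v c : good c -> op' a v c =
  op a (fun c => Cf (c (pos a)) (c (pos_succ a)) * v c) c
  + Df (c (pos a)) (c (pos_succ a)) * v c.
Proof.
move=> gc; have n12 := good_labels_neq gc (pos_neq a).
by rewrite /hecke_op alphaE // betaE // !cswap_pos; ring.
Qed.

Section ClosedWords.
Variable W : seq (seq 'I_n.-1).
Hypotheses (uW : uniq W) (W0 : [::] \in W) (indepW : independent alpha beta W).

Lemma span_mul_g a m x : closed W a -> span W m x ->
  span W (fun v => m (op' a v)) (x * g a).
Proof.
move=> cl h; rewrite mulrDr mulrA.
have hf : span W (fun v => m (op a v)) (x * f a).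
  apply: (span_mul_f tof_inj eps_sum eps_orth z_nil comm_z comm_eps) h => //.
  by move=> u; apply: span_word.
apply: span_ext (span_add (span_bf hf (bfC a)) (span_bf h (bfD a))) _.
by move=> v c gc; apply/esym; apply: (span_additive h) gc => c' gc'; apply: op'E.
Qed.

Lemma words_inj m x m' x' : span W m x -> span W m' x' ->
  (forall v c, good c -> m v c = m' v c) -> x = x'.
Proof. exact: (span_inj tof_inj eps_sum eps_orth z_nil). Qed.
End ClosedWords.

Lemma pair_independent a : independent alpha beta [:: [::]; [:: a]].
Proof.
move=> t k; apply: (pair_words_independent (symbol_alpha_neq0 sym)).
exact: good_cbase.
Qed.

Lemma braid_independent a b : b = a.+1 :> nat ->
  independent alpha beta (braid_words a b).
Proof.
move=> ab t k; apply: (braid_words_independent ab (symbol_alpha_neq0 sym)).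
exact: good_cbase.
Qed.

Lemma cswapE a c i : cswap a c i = c (s_ a i).
Proof. exact: ffunE. Qed.

Lemma span_pair1 a : span [:: [::]; [:: a]] (fun v => v) 1.
Proof. exact: span1. Qed.

Lemma span_pair_g a m x : span [:: [::]; [:: a]] m x ->
  span [:: [::]; [:: a]] (fun v => m (op' a v)) (x * g a).
Proof. by apply: span_mul_g => //; apply: pair_words_closed. Qed.

Lemma iotaZ k r : iota (k%:A * r) = k *: iota r.
Proof. by rewrite mulr_algl; apply: linearZ. Qed.

(** Both sides lie in the span of the empty word and [:: a], so it suffices to compare operators,
    where the identity is that of the target symbols. The other rank one relations and the braid
    relation follow this pattern. *)
Lemma transferred_quad a :
  g a * g a = (1 + k1)%:A + k1 *: (g a * iota (eR a)).
Proof.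
have -> : (1 + k1)%:A + k1 *: (g a * iota (eR a)) =
    1 * iota (1 + k1)%:A + 1 * g a * iota (k1%:A * eR a).
  by rewrite !mul1r rmorph_alg iotaZ -scalerAr.
rewrite -[g a * g a]mul1r mulrA.
have s1 := span_pair1 a; have sg := span_pair_g s1.
apply: (words_inj (@pair_independent a) (span_pair_g sg)
  (span_add (span_bf s1 (bf_const tof eps z (1 + k1)))
    (span_bf sg (bf_mul (bf_const tof eps z k1) (bf_color_idem a))))).
move=> v c gc; rewrite (op_quad sym') // rmorphD rmorph1; congr (_ + _).
by rewrite /hecke_op; ring.
Qed.

Lemma transferred_t a (b : 'I_n) : iota (tcoord b) * g a = g a * iota (tcoord (s_ a b)).
Proof.
rewrite -[iota _ in LHS]mul1r -[g a in RHS]mul1r; have s1 := span_pair1 a.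
apply: (words_inj (@pair_independent a) (span_pair_g (span_bf s1 (bf_tcoord b)))
  (span_bf (span_pair_g s1) (bf_tcoord (s_ a b)))) => v c gc /=.
rewrite /hecke_op cswapE /s_ tpermK mulrDr; congr (_ + _); first by ring.
have n12 := good_labels_neq gc (pos_neq a); rewrite mulrCA.
(* Either the two strands have the same color, and swapping them does not affect [tlabel], or
   [beta'] is zero. *)
have [e|ne] := eqVneq (col (c (pos a)).1) (col (c (pos_succ a)).1).
  by case: tpermP => [->|->|//]; rewrite /tlabel e.
by rewrite (beta_diff sym') // !mul0r.
Qed.

Lemma transferred_xf a (b : 'I_n) : b != pos a -> b != pos_succ a ->
  iota (spectral q q' b) * g a = g a * iota (spectral q q' b).
Proof.
move=> n1 n2.
rewrite -[iota _ in LHS]mul1r -[g a in RHS]mul1r; have s1 := span_pair1 a.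
apply: (words_inj (@pair_independent a)
  (span_pair_g (span_bf s1 (bf_spectral q q' b)))
  (span_bf (span_pair_g s1) (bf_spectral q q' b))) => v c gc /=.
by rewrite /hecke_op cswapE /s_ tpermD 1?eq_sym //; ring.
Qed.

Definition exchangeR a : R :=
  eR a * (k0%:A + k1%:A * spectral q q' (pos_succ a)).

Lemma bf_exchange a : blockfun (fun c =>
    same_color L col (c (pos a)) (c (pos_succ a)) * (rconst tof k0
      + rconst tof k1 * spectral_label q q' (c (pos_succ a)))) (exchangeR a).
Proof.
apply: bf_mul (bf_color_idem a) (bf_add (bf_const tof eps z k0) _).
exact: bf_mul (bf_const tof eps z k1) (bf_spectral q q' _).
Qed.

Lemma beta'_sub c a : good c ->
  beta' (c (pos a)) (c (pos_succ a)) *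
  (spectral_label q q' (c (pos a)) - spectral_label q q' (c (pos_succ a)))
  = - (same_color L col (c (pos a)) (c (pos_succ a)) * (rconst tof k0
      + rconst tof k1 * spectral_label q q' (c (pos_succ a)))).
Proof.
move=> gc; have n12 := good_labels_neq gc (pos_neq a).
by rewrite (symbol_beta sym') // divfK // (xi_sub_neq0 sym').
Qed.

Lemma transferred_xf1 a : iota (spectral q q' (pos a)) * g a =
  g a * iota (spectral q q' (pos_succ a)) - iota (exchangeR a).
Proof.
rewrite -[iota _ in LHS]mul1r -[g a in RHS]mul1r -[iota (exchangeR _)]mul1r.
have s1 := span_pair1 a.
apply: (words_inj (@pair_independent a)
  (span_pair_g (span_bf s1 (bf_spectral q q' _)))
  (span_add (span_bf (span_pair_g s1) (bf_spectral q q' _))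
     (span_opp (span_bf s1 (bf_exchange a))))) => v c gc /=.
rewrite -mulNr -(beta'_sub _ gc) /hecke_op !cswap_pos; ring.
Qed.

Lemma transferred_xf2 a : iota (spectral q q' (pos_succ a)) * g a =
  g a * iota (spectral q q' (pos a)) + iota (exchangeR a).
Proof.
rewrite -[iota _ in LHS]mul1r -[g a in RHS]mul1r -[iota (exchangeR _)]mul1r.
have s1 := span_pair1 a.
apply: (words_inj (@pair_independent a)
  (span_pair_g (span_bf s1 (bf_spectral q q' _)))
  (span_add (span_bf (span_pair_g s1) (bf_spectral q q' _))
     (span_bf s1 (bf_exchange a)))) => v c gc /=.
rewrite -[X in _ = _ + X * _]opprK -(beta'_sub _ gc) /hecke_op !cswap_pos; ring.
Qed.

(** Words in both generators are avoided: [C] and [D] of one pair of strands are invariant under the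
    swap of the other pair, so they commute with its [f]. *)
Lemma transferred_far a b : (a.+1 < b)%N || (b.+1 < a)%N ->
  g a * g b = g b * g a.
Proof.
move=> far; have far' : (b.+1 < a)%N || (a.+1 < b)%N by rewrite orbC.
have cC (x y : 'I_n.-1) : (x.+1 < y)%N || (y.+1 < x)%N ->
    iota (C y) * f x = f x * iota (C y).
  by move=> fr; apply: commute_invariant (bfC y) _ => c _; rewrite !cswap_far.
have cD (x y : 'I_n.-1) : (x.+1 < y)%N || (y.+1 < x)%N ->
    iota (D y) * f x = f x * iota (D y).
  by move=> fr; apply: commute_invariant (bfD y) _ => c _; rewrite !cswap_far.
have cI r r' : GRing.comm (iota r) (iota r').
  by rewrite /GRing.comm -!rmorphM mulrC.
have cf : GRing.comm (f a) (f b) := ah_far src far.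
have gE (x y : 'I_n.-1) : (x.+1 < y)%N || (y.+1 < x)%N -> GRing.comm (f x) (g y).
  move=> fr; apply: commrD; last exact/commr_sym/cD.
  by apply: commrM; [exact (ah_far src fr) | exact/commr_sym/cC].
have gr r : GRing.comm (iota r) (f b) -> GRing.comm (g b) (iota r).
  by move=> h; apply/commr_sym/commrD => //; apply: commrM.
apply/commr_sym/commrD; last exact/gr/cD.
by apply: commrM; [exact/commr_sym/gE | exact/gr/cC].
Qed.

Lemma transferred_braid a b : b = a.+1 :> nat ->
  g a * g b * g a = g b * g a * g b.
Proof.
move=> ab; have [ca cb] := braid_words_closed ab.
have uW := braid_words_uniq ab.
have s1 : span (braid_words a b) (fun v => v) 1 by apply: span1.
have sa m x (h : span (braid_words a b) m x) := span_mul_g uW ca h.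
have sb m x (h : span (braid_words a b) m x) := span_mul_g uW cb h.
rewrite -[g a * g b * g a]mul1r -[g b * g a * g b]mul1r !mulrA.
apply: (words_inj (braid_independent ab) (sa _ _ (sb _ _ (sa _ _ s1)))
  (sb _ _ (sa _ _ (sb _ _ s1)))) => v c gc.
exact: (op_braid sym').
Qed.

Theorem transfer :
  affine_hecke d k0 k1 g (iota \o tcoord) (iota \o spectral q q').
Proof.
have cI r r' : iota r * iota r' = iota r' * iota r.
  by rewrite -!rmorphM mulrC.
have exE a : exchange d k0 k1 (iota \o tcoord) (iota \o spectral q q') a
    = iota (exchangeR a).
  rewrite /exchange -color_idem_morph /exchangeR rmorphM; congr (_ * _).
  by rewrite rmorphD /= iotaZ rmorph_alg.
apply: AffineHecke.
- exact: ah_tpow src.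
- by move=> b b'; apply: cI.
- by move=> b b'; apply: cI.
- by move=> b b'; apply: cI.
- exact: transferred_t.
- exact: transferred_xf.
- by move=> a; rewrite exE; apply: transferred_xf1.
- by move=> a; rewrite exE; apply: transferred_xf2.
- by move=> a; rewrite -color_idem_morph; apply: transferred_quad.
- exact: transferred_far.
- exact: transferred_braid.
Qed.
End Transfer.

(** * Spectral decomposition *)

Section IdempotentPolynomials.
Variables (F : fieldType) (K : finType) (c : K -> F) (N : nat).
Hypothesis c_inj : injective c.

Definition lagrange k : {poly F} :=
  \prod_(l | l != k) ((c k - c l)^-1 *: ('X - (c l)%:P)).
(* [lagrange k ^+ N] is 0 modulo ('X - c l)^N for l != k but only 1 modulo 'X - c k;
   this is moreover 1 modulo ('X - c k)^N. *)
Definition idem_poly k : {poly F} := 1 - (1 - lagrange k ^+ N) ^+ N.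
Definition full_poly : {poly F} := \prod_k ('X - (c k)%:P) ^+ N.

Lemma lagrangeE k l : (lagrange k).[c l] = (k == l)%:R.
Proof.
rewrite /lagrange horner_prod; have [<-|ne] := eqVneq k l.
  apply: big1 => i ne; rewrite hornerZ hornerXsubC mulVf // subr_eq0.
  by apply: contraNneq ne => /c_inj ->.
by rewrite (bigD1 l) 1?eq_sym //= hornerZ hornerXsubC subrr mulr0 mul0r.
Qed.

Lemma idem_polyP k l :
  (('X - (c l)%:P) ^+ N %| idem_poly k - (k == l)%:R%:P).
Proof.
rewrite /idem_poly; have [<-|ne] := eqVneq k l.
  rewrite polyC1 addrAC subrr add0r dvdpNr.
  apply: dvdp_exp2r; rewrite dvdp_XsubCl /root.
  by rewrite !hornerE lagrangeE eqxx expr1n subrr.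
rewrite polyC0 subr0; apply: (@dvdp_trans _ (lagrange k ^+ N)).
  by apply: dvdp_exp2r; rewrite dvdp_XsubCl /root lagrangeE (negPf ne).
have -> : 1 - (1 - lagrange k ^+ N) ^+ N =
    - ((1 - lagrange k ^+ N) ^+ N - 1) by rewrite opprB.
rewrite subrX1 dvdpNr dvdp_mulr // [1 - _]addrC addrK.
by rewrite dvdpNr.
Qed.

Opaque idem_poly.

(** The Chinese remainder theorem for pairwise coprime powers: identities between the idempotent
    polynomials need only be checked modulo each factor. *)
Lemma full_poly_dvd (p : {poly F}) :
  (forall l, ('X - (c l)%:P) ^+ N %| p) -> full_poly %| p.
Proof.
move=> h; rewrite /full_poly.
have : uniq (index_enum K) by apply: index_enum_uniq.
elim: (index_enum K) => [|k r IH] /=; first by rewrite big_nil dvd1p.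
case/andP=> kr ur; rewrite big_cons Gauss_dvdp ?h ?IH //.
apply/coprimep_expl; elim: r kr {IH ur} => [|l r IH].
  by rewrite big_nil coprimep1.
rewrite inE negb_or big_cons coprimepMr => /andP[ne kr]; rewrite IH // andbT.
apply/coprimep_expr/coprimep_XsubC2.
by rewrite subr_eq0; apply: contraNneq ne => /c_inj ->.
Qed.

Section Evaluation.
Variables (R : comUnitAlgType F).

Lemma horner_alg_dvd (p r : {poly F}) (y : R) :
  p %| r -> horner_alg y p = 0 -> horner_alg y r = 0.
Proof. by case/dvdpP=> u -> py; rewrite rmorphM /= py mulr0. Qed.

Variable y : R.
Hypothesis y_root : horner_alg y full_poly = 0.
Local Notation pi k := (horner_alg y (idem_poly k)).

Lemma idem_sum : \sum_k pi k = 1.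
Proof.
apply/eqP; rewrite -subr_eq0 -rmorph_sum -(rmorph1 (horner_alg y)) -rmorphB.
apply/eqP/(horner_alg_dvd (full_poly_dvd _) y_root) => l.
have -> : \sum_k idem_poly k - 1 = \sum_k (idem_poly k - (k == l)%:R%:P).
  rewrite [RHS]sumrB [X in _ = _ - X](_ : _ = 1) //.
  by rewrite (bigD1 l) //= eqxx big1 ?addr0 // => k /negPf ->.
by elim/big_ind: _ => [|p r|k _]; [exact: dvdp0 | exact: dvdp_add | exact: idem_polyP].
Qed.

Lemma idem_orth k k' : pi k * pi k' = (k == k')%:R * pi k.
Proof.
apply/eqP; rewrite -subr_eq0 -(rmorph_nat (horner_alg y)) -!rmorphM -rmorphB.
apply/eqP/(horner_alg_dvd (full_poly_dvd _) y_root) => l.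
have -> : idem_poly k * idem_poly k' - (k == k')%:R * idem_poly k =
    (idem_poly k - (k == l)%:R%:P) * idem_poly k'
    + (k == l)%:R%:P * (idem_poly k' - (k' == l)%:R%:P)
    - (k == k')%:R * (idem_poly k - (k == l)%:R%:P).
  rewrite !rmorph_nat.
  have : (k == l)%:R * (k' == l)%:R = (k == k')%:R * (k == l)%:R :> {poly F}.
    by rewrite -!natrM !mulnb; congr (nat_of_bool _)%:R;
      have [<-|] := eqVneq k l; rewrite ?andbF ?andbT // eq_sym.
  by move=> E; rewrite !(mulrBl, mulrBr) E; ring.
apply: dvdp_sub; first apply: dvdp_add.
- exact/dvdp_mulr/idem_polyP.
- exact/dvdp_mull/idem_polyP.
- exact/dvdp_mull/idem_polyP.
Qed.

Lemma idem_nilp k : (y - (c k)%:A) ^+ N * pi k = 0.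
Proof.
have -> : (y - (c k)%:A) ^+ N * pi k =
    horner_alg y (('X - (c k)%:P) ^+ N * idem_poly k).
  rewrite [RHS]rmorphM [in RHS]rmorphXn [in RHS]rmorphB.
  by congr ((_ - _) ^+ N * _); apply/esym; [exact: horner_algX | exact: horner_algC].
apply: (horner_alg_dvd (full_poly_dvd _) y_root) => l.
have [->|ne] := eqVneq k l; first by rewrite dvdp_mulr.
have := idem_polyP k l; rewrite (negPf ne) polyC0 subr0 => h.
exact: dvdp_mull.
Qed.

Lemma horner_idem k l v : v ^+ N = 0 ->
  horner_alg ((c l)%:A + v : R) (idem_poly k) = (k == l)%:R.
Proof.
move=> vN; have /dvdpP[u E] := idem_polyP k l.
rewrite -[idem_poly k](subrK (k == l)%:R%:P) E rmorphD rmorphM rmorphXn rmorphB.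
rewrite /= horner_algX !horner_algC addrAC subrr add0r vN mulr0 add0r.
by rewrite -in_algE rmorph_nat.
Qed.
End Evaluation.
End IdempotentPolynomials.

Section Exchange.
Variables (F : fieldType) (n d : nat) (R : comUnitAlgType F) (A : algType F).
Variable iota : {lrmorphism R -> A}.
Variables (h0 h1 : F) (f : 'I_n.-1 -> A) (t x : 'I_n -> R).
Hypothesis src : affine_hecke d h0 h1 f (iota \o t) (iota \o x).
Implicit Types (a : 'I_n.-1) (p : {poly F}).

Definition exchange_term a : R :=
  color_idem d t a * (h0%:A + h1 *: x (pos_succ a)).
Local Notation exch := exchange_term.

Lemma iota_exch a : exchange d h0 h1 (iota \o t) (iota \o x) a = iota (exch a).
Proof.
rewrite /exchange -color_idem_morph /exchange_term rmorphM /=; congr (_ * _).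
by rewrite rmorphD /= rmorph_alg linearZ.
Qed.

Lemma iotaC r r' : iota r * iota r' = iota r' * iota r.
Proof. by rewrite -!rmorphM mulrC. Qed.

Lemma x1_f a : iota (x (pos a)) * f a
  = f a * iota (x (pos_succ a)) - iota (exch a).
Proof. by rewrite -iota_exch; apply: (ah_xf1 src). Qed.

Lemma x2_f a : iota (x (pos_succ a)) * f a
  = f a * iota (x (pos a)) + iota (exch a).
Proof. by rewrite -iota_exch; apply: (ah_xf2 src). Qed.

Lemma horner_alg_rec (B : algType F) (y : B) p k :
  horner_alg y (p * 'X + k%:P) = horner_alg y p * y + k%:A.
Proof.
rewrite rmorphD rmorphM; congr (_ * _ + _);
  [exact: horner_algX | exact: horner_algC].
Qed.

Lemma horner_comm (y y' : R) a p : iota y * f a = f a * iota y' ->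
  iota (horner_alg y p) * f a = f a * iota (horner_alg y' p).
Proof.
move=> E; elim/poly_ind: p => [|p k IH]; first by rewrite !rmorph0 mulr0 mul0r.
rewrite !horner_alg_rec !rmorphD /= !rmorph_alg mulrDl mulrDr.
by rewrite mulr_algl mulr_algr !rmorphM /= -mulrA E mulrA IH mulrA.
Qed.

(** The element G is the divided difference of p at the two spectral variables. It is built by
    recursion on p because the difference of the variables need not be invertible. *)
Lemma horner_exchange a p : exists G : R,
  [/\ iota (horner_alg (x (pos a)) p) * f a
        = f a * iota (horner_alg (x (pos_succ a)) p) - iota (exch a * G),
      iota (horner_alg (x (pos_succ a)) p) * f a
        = f a * iota (horner_alg (x (pos a)) p) + iota (exch a * G) &
      (x (pos a) - x (pos_succ a)) * G
        = horner_alg (x (pos a)) p - horner_alg (x (pos_succ a)) p].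
Proof.
elim/poly_ind: p => [|p k [G [E1 E2 E3]]].
  exists 0; rewrite !rmorph0.
  by split; rewrite ?(mulr0, rmorph0) ?(mul0r, mulr0, subr0, addr0).
set xa := x (pos a) in E1 E2 E3 *; set xb := x (pos_succ a) in E1 E2 E3 *.
rewrite !horner_alg_rec.
set pa := horner_alg xa p in E1 E2 E3 *; set pb := horner_alg xb p in E1 E2 E3 *.
(* Leibniz rule for divided differences: pa xa - pb xb = (pa - pb) xb + pa (xa - xb). *)
exists (G * xb + pa); split.
- rewrite !rmorphD /= !rmorph_alg mulrDl mulrDr mulr_algl mulr_algr.
  rewrite addrAC; congr (_ + _).
  rewrite rmorphM -mulrA x1_f mulrBr mulrA E1 mulrBl -mulrA -!rmorphM.
  rewrite -addrA -opprD -rmorphD /=; congr (_ - iota _); rewrite -/xb; ring.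
- rewrite !rmorphD /= !rmorph_alg mulrDl mulrDr mulr_algl mulr_algr.
  rewrite [in RHS]addrAC; congr (_ + _).
  rewrite rmorphM -mulrA x2_f mulrDr mulrA E2 mulrDl -mulrA -!rmorphM.
  rewrite -addrA -rmorphD /=; congr (_ + iota _).
  have -> : pa = pb + (xa - xb) * G by rewrite E3; ring.
  by rewrite -/xa; ring.
have -> : pb = pa - (xa - xb) * G by rewrite E3; ring.
by ring.
Qed.
End Exchange.

Section SpectralDecomposition.
Variables (F : fieldType) (n d : nat) (K : finType).
Variables (w : F) (p p' : K -> F) (N : nat).
Hypotheses (w_prim : d.-primitive_root w) (d_neq0 : d%:R != 0 :> F).
Hypotheses (p_inj : injective p) (p'_neq0 : forall k, p' k != 0).
Local Notation T := ('I_d * K)%type.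
Variable R : comUnitAlgType F.
Implicit Types (t x : 'I_n -> R) (i : 'I_n) (s : T).

Definition root_color (j : 'I_d) : F := w ^+ j.

Definition eps_of (B : algType F) (t x : 'I_n -> B) i s : B :=
  horner_alg (t i) (idem_poly root_color 1 s.1)
  * horner_alg (x i) (idem_poly p N s.2).

(** The nilpotent part of x divided by the slope [p'], so that the affine descriptions of x and of X
    can share the same z. *)
Definition z_of (B : algType F) (t x : 'I_n -> B) i : B :=
  \sum_s eps_of t x i s * ((p' s.2)^-1 *: (x i - (p s.2)%:A)).

Lemma root_color_inj : injective root_color.
Proof.
move=> i j /eqP; rewrite (eq_prim_root_expr w_prim) !modn_small // => /eqP.
exact: val_inj.
Qed.

Lemma root_color_full (y : R) :
  y ^+ d = 1 -> horner_alg y (full_poly root_color 1) = 0.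
Proof.
move=> yd; have -> : full_poly root_color 1 = 'X^d - 1.
  rewrite -(factor_Xn_sub_1 w_prim) big_mkord /full_poly.
  by apply: eq_bigr => j _; rewrite expr1.
rewrite rmorphB rmorphXn rmorph1.
transitivity (y ^+ d - 1); last by rewrite yd subrr.
congr (_ ^+ d - 1); exact: horner_algX.
Qed.

Variables (t x : 'I_n -> R).
Hypothesis t_pow : forall i, t i ^+ d = 1.
Hypothesis x_root : forall i, horner_alg (x i) (full_poly p N) = 0.
Local Notation eps := (eps_of t x).
Local Notation z := (z_of t x).

Lemma eps_of_sum i : \sum_s eps i s = 1.
Proof.
rewrite -(pair_bigA _ (fun j k => eps i (j, k))) /= /eps_of /=.
under eq_bigr do rewrite -mulr_sumr (idem_sum p_inj (x_root i)) mulr1.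
exact: (idem_sum root_color_inj (root_color_full (t_pow i))).
Qed.

Lemma t_eps_orth i j s : horner_alg (t i) (idem_poly root_color 1 j) * eps i s
  = (j == s.1)%:R * eps i s.
Proof.
rewrite /eps_of mulrA.
rewrite (idem_orth root_color_inj (root_color_full (t_pow i))) [j == _]eq_sym.
by case: eqVneq => [->|_]; rewrite ?mul1r ?mul0r.
Qed.

Lemma x_eps_orth i k s : horner_alg (x i) (idem_poly p N k) * eps i s
  = (k == s.2)%:R * eps i s.
Proof.
rewrite /eps_of mulrCA.
rewrite (idem_orth p_inj (x_root i)) [k == _]eq_sym.
by case: eqVneq => [->|_]; rewrite ?(mul1r, mul0r, mulr0).
Qed.

Lemma eps_of_orth i s s' : eps i s * eps i s' = (s == s')%:R * eps i s.
Proof.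
rewrite {1}/eps_of -mulrA x_eps_orth mulrCA t_eps_orth mulrA -natrM mulnb.
rewrite andbC -pair_eqE /= /pair_eq.
by case: (s.1 =P s'.1) => [e1|]; case: (s.2 =P s'.2) => [e2|];
  rewrite ?(mul0r, mul1r) // /eps_of e1 e2.
Qed.

Lemma z_eps i s :
  z i * eps i s = (p' s.2)^-1 *: (x i - (p s.2)%:A) * eps i s.
Proof.
rewrite /z_of mulr_suml (bigD1 s) //= big1 => [|s' /negPf ne].
  by rewrite addr0 mulrAC eps_of_orth eqxx mul1r mulrC.
by rewrite mulrAC eps_of_orth ne !mul0r.
Qed.

Lemma x_eps i s : x i * eps i s = ((p s.2)%:A + p' s.2 *: z i) * eps i s.
Proof.
rewrite mulrDl -[p' s.2 *: _ * _]scalerAl z_eps [p' _ *: _]scalerAl scalerA divff //.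
by rewrite scale1r -mulrDl addrC subrK.
Qed.

Lemma t_eps i s : t i * eps i s = (w ^+ s.1)%:A * eps i s.
Proof.
have := idem_nilp root_color_inj (root_color_full (t_pow i)) s.1.
rewrite expr1 mulrBl => /eqP; rewrite subr_eq0 => /eqP E.
by rewrite /eps_of mulrA E mulrA.
Qed.

Lemma z_of_nil i : z i ^+ N = 0.
Proof.
have h s k : z i ^+ k * eps i s
    = ((p' s.2)^-1 *: (x i - (p s.2)%:A)) ^+ k * eps i s.
  elim: k => [|k IH]; rewrite ?expr0 // !exprS -!mulrA IH.
  by rewrite mulrCA z_eps mulrCA mulrA.
rewrite -[LHS]mulr1 -(eps_of_sum i) mulr_sumr big1 // => s _.
rewrite h exprZn -scalerAl /eps_of mulrCA.
by rewrite (idem_nilp p_inj (x_root i)) mulr0 scaler0.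
Qed.

Lemma eq_on_blocks i (u v : R) :
  (forall s, u * eps i s = v * eps i s) -> u = v.
Proof.
move=> E; rewrite -[u]mulr1 -[v]mulr1 -(eps_of_sum i) !mulr_sumr.
exact: eq_bigr.
Qed.

Lemma sum_eps i (G : T -> R) s : (\sum_s' eps i s' * G s') * eps i s = G s * eps i s.
Proof.
rewrite mulr_suml (bigD1 s) //= big1 => [|s' /negPf ne].
  by rewrite addr0 mulrAC eps_of_orth eqxx mul1r mulrC.
by rewrite mulrAC eps_of_orth ne !mul0r.
Qed.

Lemma t_tcoord i : t i = tcoord eps fst w i.
Proof. by apply: (@eq_on_blocks i) => s; rewrite sum_eps t_eps. Qed.

Lemma x_spectral i : x i = spectral eps z (p \o snd) (p' \o snd) i.
Proof. by apply: (@eq_on_blocks i) => s; rewrite sum_eps x_eps. Qed.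

Variables (A : algType F) (iota : {lrmorphism R -> A}).
Hypothesis iota_inj : injective iota.
Variables (h0 h1 : F) (f : 'I_n.-1 -> A).
Hypothesis src : affine_hecke d h0 h1 f (iota \o t) (iota \o x).
Variables (L : fieldType) (tof : {rmorphism mpoly n F -> L}).
Hypothesis tof_inj : injective tof.
Variables alpha beta : label n T -> label n T -> L.
Local Notation xi := (spectral_label tof (p \o snd) (p' \o snd)).
Hypothesis sym : hecke_symbols fst (rconst tof h0) (rconst tof h1) xi alpha beta.
Local Notation blockfun := (blockfun tof eps z).
Local Notation commutation := (commutation tof eps z iota f beta).
Local Notation exch := (exchange_term d h0 h1 t x).
Local Notation pt i j := (horner_alg (t i) (idem_poly root_color 1 j)).
Local Notation px i k := (horner_alg (x i) (idem_poly p N k)).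
Implicit Types (c : conf n T) (a : 'I_n.-1).

Lemma bf_x i : blockfun (fun c => xi (c i)) (x i).
Proof. by rewrite x_spectral; apply: bf_spectral. Qed.

Lemma color_idem_blocks a s s' :
  color_idem d t a * (eps (pos a) s * eps (pos_succ a) s')
  = (s.1 == s'.1)%:R * (eps (pos a) s * eps (pos_succ a) s').
Proof.
have tX i s0 k : t i ^+ k * eps i s0 = ((w ^+ s0.1) ^+ k)%:A * eps i s0.
  elim: k => [|k IH]; first by rewrite !expr0 scale1r.
  rewrite !exprS -mulrA IH mulrCA t_eps mulrA; congr (_ * _).
  by rewrite -!in_algE -rmorphM mulrC.
rewrite /color_idem -scalerAl mulr_suml.
have -> : (s.1 == s'.1)%:R = in_alg R (s.1 == s'.1)%:R by rewrite rmorph_nat.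
rewrite -(sum_prim_root s.1 s'.1 w_prim d_neq0) rmorphM rmorph_sum /=.
rewrite mulr_algl -scalerAl mulr_suml; congr (_ *: _).
apply: eq_bigr => j _; rewrite mulrACA !tX mulrACA.
by rewrite -!in_algE -rmorphM.
Qed.

Lemma exch_blocks a s s' :
  exch a * (eps (pos a) s * eps (pos_succ a) s') =
  (s.1 == s'.1)%:R * (h0%:A + h1%:A * ((p s'.2)%:A + p' s'.2 *: z (pos_succ a)))
  * (eps (pos a) s * eps (pos_succ a) s').
Proof.
have Hb : (h0%:A + h1 *: x (pos_succ a)) * eps (pos_succ a) s' =
    (h0%:A + h1%:A * ((p s'.2)%:A + p' s'.2 *: z (pos_succ a)))
    * eps (pos_succ a) s'.
  rewrite mulrDl [RHS]mulrDl; congr (_ + _).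
  by rewrite -[h1 *: x _]mulr_algl -[LHS]mulrA -[RHS]mulrA x_eps.
move: Hb (color_idem_blocks a s s'); rewrite /exchange_term.
move: (eps (pos a) s) (eps (pos_succ a) s') => ea eb Hb E.
rewrite mulrAC E -!mulrA; congr (_ * _).
by rewrite [eb * _]mulrC Hb mulrCA.
Qed.

Lemma sum_blocks2 i j (r : R) :
  r = \sum_s \sum_s' eps i s * eps j s' * r.
Proof.
rewrite -[LHS]mul1r -(eps_of_sum i) mulr_suml; apply: eq_bigr => s _.
rewrite -mulr_suml; congr (_ * r).
by rewrite -mulr_sumr eps_of_sum mulr1.
Qed.

Lemma bf_spectral_block j s : blockfun
  (fun c => rconst tof (p s.2) + rconst tof (p' s.2) * lz tof (c j))
  ((p s.2)%:A + p' s.2 *: z j).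
Proof.
apply: bf_add; first exact: bf_const.
by rewrite -mulr_algl; apply: bf_mul; [apply: bf_const | apply: bf_z].
Qed.

Lemma bf_exch a : blockfun (fun c =>
    same_color L fst (c (pos a)) (c (pos_succ a)) * (rconst tof h0
      + rconst tof h1 * xi (c (pos_succ a)))) (exch a).
Proof.
rewrite [exch a](sum_blocks2 (pos a) (pos_succ a)).
pose G s s' c := rconst tof (s.1 == s'.1)%:R * (rconst tof h0
  + rconst tof h1 * (rconst tof (p s'.2)
    + rconst tof (p' s'.2) * lz tof (c (pos_succ a)))).
pose r s s' : R := (s.1 == s'.1)%:R%:A * (h0%:A + h1%:A * ((p s'.2)%:A
  + p' s'.2 *: z (pos_succ a))).
have h s s' : blockfun (G s s') (r s s').
  apply: bf_mul; first exact: bf_const.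
  apply: bf_add; first exact: bf_const.
  apply: bf_mul; [exact: bf_const | exact: bf_spectral_block].
have := bf_blocks2 (pos a) (pos_succ a) h.
rewrite (_ : \sum_s \sum_s' _ = \sum_s \sum_s' eps (pos a) s
  * eps (pos_succ a) s' * exch a).
  by move/bf_ext; apply=> c gc; rewrite /G rmorph_nat.
apply: eq_bigr => s _; apply: eq_bigr => s' _.
rewrite [RHS]mulrC exch_blocks [LHS]mulrC /r; congr (_ * _ * _).
by rewrite -in_algE rmorph_nat.
Qed.

Lemma commutation_fixed a (G : conf n T -> L) r : blockfun G r ->
  (forall c, G (cswap a c) = G c) -> iota r * f a = f a * iota r ->
  commutation a G r.
Proof.
move=> h inv E; split=> //; exists r, 0%:A; split.
- by apply: bf_ext h _ => c _.
- apply: bf_ext (bf_const tof eps z 0) _ => c _.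
  by rewrite inv subrr mulr0 rmorph0.
- by rewrite rmorph_alg scale0r addr0.
Qed.

Lemma commutation_x a i : commutation a (fun c => xi (c i)) (x i).
Proof.
have [->|n1] := eqVneq i (pos a).
  split; first exact: bf_x; exists (x (pos_succ a)), (- exch a); split.
  - by apply: bf_ext (bf_x (pos_succ a)) _ => c _; rewrite !cswap_pos.
  - apply: bf_ext (bf_opp (bf_exch a)) _ => c gc; rewrite !cswap_pos.
    by rewrite (beta'_sub sym).
  - by rewrite rmorphN (x1_f src).
have [->|n2] := eqVneq i (pos_succ a).
  split; first exact: bf_x; exists (x (pos a)), (exch a); split.
  - by apply: bf_ext (bf_x (pos a)) _ => c _; rewrite !cswap_pos.
  - apply: bf_ext (bf_exch a) _ => c gc; rewrite !cswap_pos.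
    by rewrite -opprB mulrN (beta'_sub sym) // opprK.
  - by rewrite (x2_f src).
apply: commutation_fixed; first exact: bf_x.
  by move=> c; rewrite cswapE /s_ tpermD // eq_sym.
exact: (ah_xf src).
Qed.

Lemma pt_f a i j : iota (pt i j) * f a = f a * iota (pt (s_ a i) j).
Proof. by apply: horner_comm; apply: (ah_tf src). Qed.

(** On this block x_a - x_(a+1) is nilpotent and no division can compute the correction term. The
    product of the two idempotents is symmetric in the strands, so its corrections cancel. *)
Lemma diagonal_block_f a u :
  iota (eps (pos a) u * eps (pos_succ a) u) * f a
  = f a * iota (eps (pos a) u * eps (pos_succ a) u).
Proof.
have [G [E1 E2 _]] := horner_exchange src a (idem_poly p N u.2).
have P1 := pt_f a (pos a) u.1; have P2 := pt_f a (pos_succ a) u.1.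
rewrite /s_ tpermL in P1; rewrite /s_ tpermR in P2.
rewrite /eps_of; move: (pt (pos a) _) (pt (pos_succ a) _) (px (pos a) _)
  (px (pos_succ a) _) E1 E2 P1 P2.
move=> pa pb ra rb E1 E2 P1 P2.
have Er : iota (ra * rb) * f a = f a * iota (ra * rb).
  rewrite rmorphM -mulrA E2 mulrDr mulrA E1 mulrBl [iota (_ * G) * _]iotaC.
  by rewrite subrK -mulrA iotaC.
have cm r1 r1' r2 r2' : iota r1 * f a = f a * iota r1' ->
    iota r2 * f a = f a * iota r2' -> iota (r1 * r2) * f a = f a * iota (r1' * r2').
  by move=> e1 e2; rewrite !rmorphM -mulrA e2 mulrA e1 mulrA.
have -> : pa * ra * (pb * rb) = pa * (pb * (ra * rb)) by ring.
by rewrite (cm _ _ _ _ P1 (cm _ _ _ _ P2 Er)); congr (_ * iota _); ring.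
Qed.

(** The correction is identified block by block. It vanishes for different colors by the factor
    [exch a], and for equal colors and eigenvalues by [diagonal_block_f]; otherwise the defining
    equation of G can be divided by x_a - x_(a+1). *)
Lemma bf_eps_correction a s G (r : R) :
  r = - (pt (pos a) s.1 * (exch a * G)) ->
  (x (pos a) - x (pos_succ a)) * G = px (pos a) s.2 - px (pos_succ a) s.2 ->
  iota (eps (pos a) s) * f a = f a * iota (eps (pos_succ a) s) + iota r ->
  blockfun (fun c => beta (c (pos a)) (c (pos_succ a)) *
    (((c (pos a)).1 == s)%:R - ((c (pos_succ a)).1 == s)%:R)) r.
Proof.
move=> rE GE fE; set ia := pos a in rE GE fE *; set ib := pos_succ a in rE GE fE *.
(* Same color, different eigenvalues: the blocks that may contribute. There [lin] is x_a - x_(a+1),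
   with nonzero constant term. *)
pose off (u v : T) := (u.1 == v.1) && (u.2 != v.2).
pose lin (u v : T) : R := (p u.2 - p v.2)%:A + p' u.2 *: z ia
  + (- p' v.2) *: z ib.
pose linL (u v : T) c : L := rconst tof (p u.2 - p v.2)
  + rconst tof (p' u.2) * lz tof (c ia) + rconst tof (- p' v.2) * lz tof (c ib).
pose b u v : R := if off u v then
  - (h0%:A + h1%:A * ((p v.2)%:A + p' v.2 *: z ib)) *
    ((u == s)%:R - (v == s)%:R)%:A * (lin u v)^-1 else 0%:A.
pose B u v c : L := if off u v then
  - (rconst tof h0 + rconst tof h1 *
      (rconst tof (p v.2) + rconst tof (p' v.2) * lz tof (c ib))) *
    rconst tof ((u == s)%:R - (v == s)%:R) * (linL u v c)^-1 else rconst tof 0.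
have pneq u v : off u v -> p u.2 - p v.2 != 0.
  by case/andP=> _ ne; rewrite subr_eq0; apply: contraNneq ne => /p_inj ->.
have bfb u v : blockfun (B u v) (b u v).
  rewrite /B /b; case ouv: (off u v); last exact: bf_const.
  apply: bf_mul; last exact/bf_inv/pneq.
  apply: bf_mul; last exact: bf_const.
  apply/bf_opp/bf_add; first exact: bf_const.
  by apply: bf_mul; [apply: bf_const | apply: bf_spectral_block].
have := bf_blocks2 ia ib bfb.
have -> : \sum_u \sum_v eps ia u * eps ib v * b u v = r.
  rewrite [RHS](sum_blocks2 ia ib).
  apply: eq_bigr => u _; apply: eq_bigr => v _.
  have XE := exch_blocks a u v; rewrite -/ia -/ib in XE.
  have PE := t_eps_orth ia s.1 u.
  have [RaE RbE] := (x_eps_orth ia s.2 u, x_eps_orth ib s.2 v).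
  have [xaE xbE] := (x_eps ia u, x_eps ib v).
  rewrite /b /off; have [e|ne] := eqVneq u.1 v.1; last first.
    rewrite (negPf ne) mul0r mul0r in XE; rewrite /= scale0r mulr0 rE.
    move: XE; move: (exch a) (eps ia u) (eps ib v) (pt _ _) => X ea eb P XE.
    transitivity (- P * G * (X * (ea * eb))); first by rewrite XE mulr0.
    by ring.
  have [e2|ne2] := eqVneq u.2 v.2.
    have {e e2} uv : v = u by case: u v e e2 {XE PE RaE RbE xaE xbE} => [? ?] [? ?] /= -> ->.
    (* With E the diagonal idempotent, E commutes with [f a] and absorbs both idempotents of s with
       the same coefficient, so E times the correction is 0. *)
    rewrite uv /= scale0r mulr0; apply/esym/iota_inj; rewrite rmorph0.
    have fE' : iota r = iota (eps ia s) * f a - f a * iota (eps ib s).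
      by rewrite fE addrC addKr.
    have Ea : eps ia u * eps ib u * eps ia s = (u == s)%:R * (eps ia u * eps ib u).
      by rewrite mulrAC eps_of_orth -mulrA.
    have Eb : eps ia u * eps ib u * eps ib s = (u == s)%:R * (eps ia u * eps ib u).
      by rewrite -mulrA eps_of_orth mulrCA.
    have := diagonal_block_f a u; rewrite -/ia -/ib; move: Ea Eb fE'.
    move: (eps ia u * eps ib u) (eps ia s) (eps ib s) => E ea eb Ea Eb fE' dE.
    rewrite rmorphM /= fE' mulrBr [X in X - _]mulrA -rmorphM Ea.
    rewrite [X in _ - X]mulrA dE -[X in _ - X]mulrA -rmorphM Eb.
    by case: (u == s); rewrite ?mul1r ?dE ?subrr // mul0r rmorph0 mulr0 mul0r subrr.
  have ou : off u v by rewrite /off e eqxx ne2.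
  have Ul : lin u v \is a GRing.unit.
    by apply: lin_unit (pneq u v ou); apply: z_of_nil.
  (* Multiplying by the unit x_a - x_(a+1) of this block turns G into the difference of the two
     eigenvalue projections. *)
  rewrite rE; apply: (mulIr Ul).
  have linE : lin u v * (eps ia u * eps ib v)
      = (x ia - x ib) * (eps ia u * eps ib v).
    rewrite /lin scalerBl scaleNr; move: xaE xbE.
    move: (eps ia u) (eps ib v) => ea eb xaE xbE.
    transitivity (eb * (x ia * ea) - ea * (x ib * eb)); last by ring.
    by rewrite xaE xbE; ring.
  have dE : ((u == s)%:R - (v == s)%:R)%:A =
      (s.1 == u.1)%:R * ((s.2 == u.2)%:R - (s.2 == v.2)%:R) :> R.
    rewrite -in_algE rmorphB !rmorph_nat ![_ == s]eq_sym -!pair_eqE /pair_eq e.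
    by rewrite mulrBr -!natrM !mulnb.
  rewrite /= dE; move: XE; rewrite e eqxx mul1r.
  move: Ul linE PE RaE RbE GE; rewrite e.
  move: (lin u v) (eps ia u) (eps ib v) (exch a) (pt ia _) (px ia _) (px ib _).
  move=> l ea eb X P Ra Rb Ul lE PE RaE RbE GE XE.
  set H := h0%:A + _ in XE *; set d1 := (_ == _)%:R in PE *.
  set d2 := (_ == u.2)%:R in RaE *; set d3 := (_ == v.2)%:R in RbE *.
  transitivity (- H * d1 * (d2 - d3) * (ea * eb)).
    transitivity (ea * eb * (- H * (d1 * (d2 - d3))) * (l^-1 * l)); first by ring.
    by rewrite mulVr //; ring.
  transitivity (- P * X * G * (l * (ea * eb))); last by ring.
  rewrite lE; transitivity (- P * X * ((x ia - x ib) * G) * (ea * eb)); last by ring.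
  rewrite GE.
  transitivity (- (X * (ea * eb)) * P * (Ra - Rb)); last by ring.
  rewrite XE.
  transitivity (- H * (P * (Ra * ea)) * eb + H * (P * ea) * (Rb * eb)); last by ring.
  rewrite RaE RbE.
  transitivity (- H * d2 * (P * ea) * eb + H * (P * ea) * (d3 * eb)); last by ring.
  by rewrite PE; ring.
move/bf_ext; apply=> c gc; rewrite /B /off.
have n12 := good_labels_neq gc (pos_neq a); rewrite -/ia -/ib in n12.
rewrite (symbol_beta sym) // /same_color.
have [e|ne] := eqVneq (c ia).1.1 (c ib).1.1; last first.
  by rewrite /= mul0r oppr0 !mul0r rmorph0.
have [e2|ne2] := eqVneq (c ia).1.2 (c ib).1.2.
  have -> : (c ia).1 = (c ib).1.
    by case: (c ia).1 (c ib).1 e e2 => [? ?] [? ?] /= -> ->.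
  by rewrite /= subrr mulr0 rmorph0.
rewrite /= mul1r rmorphB !rmorph_nat.
have -> : linL (c ia).1 (c ib).1 c = xi (c ia) - xi (c ib).
  by rewrite /linL /spectral_label /= rmorphB rmorphN; ring.
by rewrite mulrAC.
Qed.

Lemma commutation_eps a i s :
  commutation a (fun c => ((c i).1 == s)%:R) (eps i s).
Proof.
have bfe k := bf_eps tof eps z k s.
have [G [E1 E2 E3]] := horner_exchange src a (idem_poly p N s.2).
(* The exchange term is supported on equal colors, where the color projections of the two strands
   agree. *)
have pt_exch : pt (pos_succ a) s.1 * exch a = pt (pos a) s.1 * exch a.
  rewrite [LHS](sum_blocks2 (pos a) (pos_succ a)).
  rewrite [RHS](sum_blocks2 (pos a) (pos_succ a)).
  apply: eq_bigr => u _; apply: eq_bigr => v _.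
  move: (exch_blocks a u v) (t_eps_orth (pos a) s.1 u)
    (t_eps_orth (pos_succ a) s.1 v).
  move: (exch a) (eps (pos a) u) (eps (pos_succ a) v) (pt (pos a) s.1)
    (pt (pos_succ a) s.1) (h0%:A + _) => X ea eb P P' H E Ea Eb.
  transitivity (P' * (X * (ea * eb))); first by ring.
  transitivity (P * (X * (ea * eb))); last by ring.
  rewrite E; have [e|_] := eqVneq u.1 v.1; last by rewrite !(mul0r, mulr0).
  rewrite mul1r; transitivity (H * ea * (P' * eb)); first by ring.
  transitivity (H * eb * (P * ea)); last by ring.
  by rewrite Ea Eb e; ring.
pose r : R := - (pt (pos a) s.1 * (exch a * G)).
have Ea : iota (eps (pos a) s) * f a
    = f a * iota (eps (pos_succ a) s) + iota r.
  rewrite /eps_of rmorphM -mulrA E1 mulrBr mulrA pt_f -mulrA -rmorphM.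
  by rewrite /s_ tpermL /r rmorphN -rmorphM.
have Eb : iota (eps (pos_succ a) s) * f a
    = f a * iota (eps (pos a) s) + iota (- r).
  rewrite /eps_of rmorphM -mulrA E2 mulrDr mulrA pt_f -mulrA -rmorphM.
  by rewrite /s_ tpermR /r opprK -rmorphM mulrA pt_exch -mulrA.
have bfr : blockfun (fun c => beta (c (pos a)) (c (pos_succ a)) *
    (((c (pos a)).1 == s)%:R - ((c (pos_succ a)).1 == s)%:R)) r.
  exact: bf_eps_correction Ea.
have [->|n1] := eqVneq i (pos a).
  split; first exact: bf_eps; exists (eps (pos_succ a) s), r; split=> //.
  - by apply: bf_ext (bfe (pos_succ a)) _ => c _; rewrite !cswap_pos.
  - by apply: bf_ext bfr _ => c gc; rewrite !cswap_pos.
have [->|n2] := eqVneq i (pos_succ a).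
  split; first exact: bf_eps; exists (eps (pos a) s), (- r); split=> //.
  - by apply: bf_ext (bfe (pos a)) _ => c _; rewrite !cswap_pos.
  - by apply: bf_ext (bf_opp bfr) _ => c gc; rewrite !cswap_pos -mulrN opprB.
have si : s_ a i = i by rewrite /s_ tpermD // eq_sym.
apply: commutation_fixed; first exact: bf_eps.
  by move=> c; rewrite cswapE si.
rewrite /eps_of rmorphM -mulrA (@horner_comm _ _ _ _ _ _ (x i) (x i)).
  by rewrite mulrA pt_f si -mulrA.
exact: (ah_xf src).
Qed.

Lemma commutation_sum a (I : finType) (G : I -> conf n T -> L) (r : I -> R) :
  (forall k, commutation a (G k) (r k)) ->
  commutation a (fun c => \sum_k G k c) (\sum_k r k).
Proof.
move=> h; elim: (index_enum I) => [|k l IH].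
  rewrite big_nil -(scale0r 1).
  apply: commutation_ext (commutation_const tof eps z iota f beta a 0) _ => c _.
  by rewrite big_nil rmorph0.
rewrite big_cons; apply: commutation_ext (commutation_add (h k) IH) _ => c _.
by rewrite big_cons.
Qed.

Lemma commutation_z a i : commutation a (fun c => lz tof (c i)) (z i).
Proof.
have cc k := commutation_const tof eps z iota f beta a k.
have h s : commutation a
    (fun c => ((c i).1 == s)%:R * (rconst tof (p' s.2)^-1 *
       (xi (c i) + rconst tof (- p s.2))))
    (eps i s * ((p' s.2)^-1 *: (x i - (p s.2)%:A))).
  apply: commutation_mul; first exact: commutation_eps.
  rewrite -[_^-1 *: _]mulr_algl -scaleNr.
  apply: commutation_mul; first exact: cc.
  by apply: commutation_add; [apply: commutation_x | apply: cc].
have H := commutation_sum h; apply: (commutation_ext H) => c _.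
rewrite (bigD1 (c i).1) //= eqxx mul1r big1 => [|s /negPf ne]; last first.
  by rewrite eq_sym ne mul0r.
rewrite addr0 /spectral_label /= rmorphN addrAC subrr add0r mulrA -rmorphM.
by rewrite mulVf // rmorph1 mul1r.
Qed.

End SpectralDecomposition.

Section ColorIdempotent.
Variables (F : fieldType) (n d : nat) (R : comUnitAlgType F) (t : 'I_n -> R).
Hypothesis d_neq0 : d%:R != 0 :> F.
Hypothesis t_pow : forall i, t i ^+ d = 1.
Implicit Types a : 'I_n.-1.
Local Notation e := (color_idem d t).

(** A cyclic shift of the summation index: the end terms j = 0 and j = d agree because both t have
    order dividing d. *)
Lemma color_idem_shift a :
  \sum_(j < d) t (pos a) ^+ j.+1 * t (pos_succ a) ^+ (d - j.+1)
  = \sum_(j < d) t (pos a) ^+ j * t (pos_succ a) ^+ (d - j).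
Proof.
apply/eqP; rewrite -subr_eq0 -sumrB.
pose g j := t (pos a) ^+ j * t (pos_succ a) ^+ (d - j).
rewrite -(big_mkord xpredT (fun j => g j.+1 - g j)) telescope_sumr //.
by rewrite /g subnn subn0 !t_pow !expr0 mulr1 subrr.
Qed.

Lemma color_idem_t a : t (pos a) * e a = t (pos_succ a) * e a.
Proof.
rewrite /color_idem -!scalerAr; congr (_ *: _).
rewrite -[in RHS]color_idem_shift !mulr_sumr; apply: eq_bigr => j _.
rewrite -[in LHS](subnSK (ltn_ord j)) !exprS.
by move: (_ ^+ j) (_ ^+ (d - _)) => u v; ring.
Qed.

Lemma color_idem_idem a : e a * e a = e a.
Proof.
have tk k : t (pos a) ^+ k * e a = t (pos_succ a) ^+ k * e a.
  elim: k => [|k IH]; first by rewrite !expr0.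
  by rewrite !exprSr -mulrA color_idem_t mulrCA IH mulrA [_ * t _]mulrC.
rewrite {1}/color_idem -scalerAl mulr_suml.
under eq_bigr => j _.
  rewrite mulrAC tk mulrAC -exprD subnKC ?(ltnW (ltn_ord j)) // t_pow mul1r.
  over.
rewrite sumr_const card_ord -scaler_nat scalerA mulVf // scale1r //.
Qed.

Lemma color_idemC a :
  d%:R^-1 *: \sum_(j < d) t (pos_succ a) ^+ j * t (pos a) ^+ (d - j) = e a.
Proof.
rewrite /color_idem -[in RHS]color_idem_shift; congr (_ *: _).
rewrite [RHS](reindex_inj rev_ord_inj); apply: eq_bigr => j _ /=.
have lej : (j <= d)%N by apply: ltnW.
by rewrite mulrC (subnSK (ltn_ord j)) (subKn lej).
Qed.
End ColorIdempotent.

(** * Integral spectra of the Jucys-Murphy elements *)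

Section Vanishing.
Variables (F : fieldType) (B : algType F) (c : int -> F).
Implicit Types (s : seq int) (y : B).

(** An annihilating polynomial is recorded by its list of roots, with repetitions, so that common
    multiples are concatenations. *)
Definition vanishes s y := \prod_(k <- s) (y - (c k)%:A) = 0.

Lemma vanishes_cat s1 s2 y :
  vanishes s1 y \/ vanishes s2 y -> vanishes (s1 ++ s2) y.
Proof.
by rewrite /vanishes big_cat /=; case=> ->; rewrite ?mul0r ?mulr0.
Qed.
End Vanishing.

(* The intertwiner exchanges x_a and x_(a+1), and its square is a polynomial in them
   that vanishes only when the two eigenvalues are equal or neighbours; so a bound
   on the spectrum of x_a gives one for x_(a+1). *)
Section Spectrum.
Variables (F : fieldType) (n d : nat) (R : comUnitAlgType F) (A : algType F).
Variable iota : {lrmorphism R -> A}.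
Hypothesis iota_inj : injective iota.
Hypothesis d_neq0 : d%:R != 0 :> F.
Variables (h0 h1 : F) (f : 'I_n.-1 -> A) (t x : 'I_n -> R).
Hypothesis src : affine_hecke d h0 h1 f (iota \o t) (iota \o x).
Hypothesis r_neq0 : 1 + h1 != 0.
Variable c : int -> F.
(** Together with [c_mul] these are Vieta's formulas: c (k - 1) and c (k + 1) are the roots v of (h0
    + h1 c_k)(h0 + h1 v) = (1 + h1)(c_k - v)^2. Both c k = k for (1, 0) and c k = q^k for (0, q - 1)
    satisfy them. *)
Hypothesis c_sum : forall k, (1 + h1) * (c (k - 1) + c (k + 1))
  = (1 + h1) * c k *+ 2 + h1 * (h0 + h1 * c k).
Hypothesis c_mul : forall k, (1 + h1) * (c (k - 1) * c (k + 1))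
  = (1 + h1) * c k ^+ 2 - h0 * (h0 + h1 * c k).
Implicit Types (a : 'I_n.-1) (s : seq int).
Local Notation e := (color_idem d t).
Local Notation X := (exchange_term d h0 h1 t x).

Local Notation vanishes := (vanishes c).

Lemma src_t_pow i : t i ^+ d = 1.
Proof.
by apply: iota_inj; rewrite rmorphXn rmorph1; apply: (ah_tpow src).
Qed.

Lemma e_f a : iota (e a) * f a = f a * iota (e a).
Proof.
have tX i k : iota (t i ^+ k) * f a = f a * iota (t (s_ a i) ^+ k).
  elim: k => [|k IH]; first by rewrite !expr0 !rmorph1 mulr1 mul1r.
  by rewrite !exprS !rmorphM /= -mulrA IH !mulrA (ah_tf src).
rewrite -[in RHS](color_idemC src_t_pow) /color_idem !linearZ /=.
rewrite -scalerAl -scalerAr; congr (_ *: _).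
rewrite !rmorph_sum mulr_suml mulr_sumr; apply: eq_bigr => j _.
rewrite !rmorphM /= -mulrA tX mulrA tX -mulrA.
by rewrite /s_ tpermL tpermR.
Qed.

Definition intertwiner a : A :=
  f a * iota (x (pos a) - x (pos_succ a)) + iota (X a).

Lemma intertwiner_x a : intertwiner a * iota (x (pos_succ a))
  = iota (x (pos a)) * intertwiner a.
Proof.
rewrite /intertwiner mulrDl mulrDr !mulrA (x1_f src).
rewrite mulrBl -mulrA -!rmorphM /= -addrA; congr (_ + _).
  by rewrite -!mulrA -!rmorphM mulrC.
by rewrite -rmorphN -rmorphD /=; congr (iota _); ring.
Qed.

Lemma intertwiner_prod a s :
  intertwiner a * iota (\prod_(k <- s) (x (pos_succ a) - (c k)%:A))
  = iota (\prod_(k <- s) (x (pos a) - (c k)%:A)) * intertwiner a.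
Proof.
elim: s => [|k s IH]; first by rewrite !big_nil rmorph1 mulr1 mul1r.
rewrite !big_cons !rmorphM /= mulrA.
have -> : intertwiner a * iota (x (pos_succ a) - (c k)%:A)
    = iota (x (pos a) - (c k)%:A) * intertwiner a.
  by rewrite !rmorphB /= !rmorph_alg mulrBr mulrBl intertwiner_x
    mulr_algl mulr_algr.
by rewrite -mulrA IH mulrA.
Qed.

(** The square of the intertwiner. As a polynomial in v with u = c k, its roots are c (k - 1) and c
    (k + 1) at e' = 1, and c k twice at e' = 0. *)
Definition factor (u v e' : R) : R :=
  e' * (h0%:A + h1%:A * u) * (h0%:A + h1%:A * v) - (1 + h1)%:A * (u - v) ^+ 2.

Lemma intertwiner_sqr a : intertwiner a * intertwiner a
  = iota (factor (x (pos a)) (x (pos_succ a)) (e a)).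
Proof.
set xa := x (pos a); set xb := x (pos_succ a); set u := xa - xb.
have uf : iota u * f a = - (f a * iota u) - iota (X a *+ 2).
  rewrite /u rmorphB /= mulrBl (x1_f src) (x2_f src) -/xa -/xb.
  rewrite mulrBr opprB rmorphMn mulr2n !opprD !addrA; congr (_ - _).
  exact: addrAC.
pose Ha : R := h0%:A + h1%:A * xa; pose Hb : R := h0%:A + h1%:A * xb.
have XE : X a = e a * Hb by rewrite /exchange_term /Hb mulr_algl.
have Xf : iota (X a) * f a = f a * iota (e a * Ha) + iota (h1%:A * e a * X a).
  have Hf Y : iota xb * f a = f a * iota xa + iota Y ->
      iota Hb * f a = f a * iota Ha + iota (h1%:A * Y).
    move=> E; rewrite /Hb /Ha !rmorphD !rmorphM /= !rmorph_alg mulrDl mulrDr.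
    rewrite !mulr_algl mulr_algr -addrA; congr (_ + _).
    by rewrite -scalerAl E scalerDr -scalerAr.
  rewrite {1}XE rmorphM /= -mulrA (Hf _ (x2_f src a)) mulrDr mulrA e_f -mulrA -!rmorphM /=.
  by congr (_ + iota _); ring.
have ff : f a * f a = iota (1 + h1)%:A + f a * iota (h1%:A * e a).
  rewrite (ah_ff src) -color_idem_morph rmorph_alg; congr (_ + _).
  have -> : iota (h1%:A * e a) = h1 *: iota (e a).
    by rewrite mulr_algl; apply: linearZ.
  by rewrite -scalerAr.
have -> : intertwiner a * intertwiner a = f a * (iota u * f a) * iota u
    + f a * iota (u * X a) + iota (X a) * f a * iota u + iota (X a * X a).
  by rewrite /intertwiner -/xa -/xb -/u mulrDl !mulrDr !rmorphM /= !mulrA !addrA.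
rewrite uf Xf; set B := iota (factor _ _ _).
have -> : f a * (- (f a * iota u) - iota (X a *+ 2)) * iota u
    = - (f a * f a * iota (u * u)) - f a * iota (X a *+ 2 * u).
  by rewrite mulrBr mulrN mulrBl mulNr !rmorphM /= !mulrA.
rewrite ff [in X in X + _ + _ + _]mulrDl.
rewrite -(mulrA (f a)) -!rmorphM /=.
rewrite [in X in _ + X + _]mulrDl -(mulrA (f a)) -!rmorphM /=.
have ee := color_idem_idem d_neq0 src_t_pow a.
have regroup (y1 y2 y3 y4 y5 y6 y7 : A) :
    - (y1 + y2) - y3 + y4 + (y5 + y6) + y7
    = (- y2 - y3 + y4 + y5) + (- y1 + y6 + y7).
  rewrite opprD -!addrA; do 4![rewrite addrCA; congr (_ + _)].
rewrite regroup -!mulrN -!rmorphN -!mulrDr -!rmorphD /= XE.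
have -> : - (h1%:A * e a * (u * u)) - e a * Hb *+ 2 * u + u * (e a * Hb)
    + e a * Ha * u = 0 by rewrite /u /Ha /Hb; ring.
rewrite rmorph0 mulr0 add0r /B /factor -/Ha -/Hb; congr (iota _).
transitivity (- ((1 + h1)%:A * (u * u)) + e a * e a * Hb * (h1%:A * u + Hb)).
  by ring.
by rewrite ee /u /Ha /Hb; ring.
Qed.

(** The double k accounts for strands of different colors, and k - 1, k + 1 for strands of the same
    color. *)
Definition neighbours s : seq int :=
  flatten [seq [:: k; k; k - 1; k + 1] | k <- s].

Lemma vanishes_next a s : vanishes s (x (pos a)) ->
  vanishes (s ++ neighbours s) (x (pos_succ a)).
Proof.
rewrite /vanishes => Pa0; set xa := x (pos a) in Pa0 *.
set xb := x (pos_succ a).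
set Pb := \prod_(k <- s) (xb - (c k)%:A).
(* Write the factor as the squared intertwiner; passing one copy over the product turns x_(a+1) into
   x_a, where the product vanishes. *)
have PbS : Pb * factor xa xb (e a) = 0.
  apply: iota_inj; rewrite rmorph0 mulrC rmorphM /= -intertwiner_sqr -mulrA.
  by rewrite intertwiner_prod -/xa Pa0 rmorph0 mul0r mulr0.
(* The quotient by x_a - c_k of the change in [factor] when x_a is replaced by c_k; the product over
   s of these differences is then killed by the hypothesis on x_a. *)
pose D k := (1 + h1)%:A * (xa + (c k)%:A - xb *+ 2)
  - e a * h1%:A * (h0%:A + h1%:A * xb).
have PbSk s' : Pb * \prod_(k <- s') factor (c k)%:A xb (e a)
    = Pb * \prod_(k <- s') ((xa - (c k)%:A) * D k).
  elim: s' => [|k s' IH]; first by rewrite !big_nil.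
  rewrite !big_cons mulrCA IH.
  have -> : factor (c k)%:A xb (e a) = factor xa xb (e a) + (xa - (c k)%:A) * D k.
    by rewrite /factor /D; ring.
  move: {IH} PbS; move: Pb (factor xa xb _) (xa - _) (D k) (\prod_(_ <- _) _).
  move=> P S u v Q PS0; transitivity (P * S * Q + P * (u * v * Q)); first by ring.
  by rewrite PS0 mul0r add0r.
have Pb0 : Pb * \prod_(k <- s) factor (c k)%:A xb (e a) = 0.
  by rewrite PbSk big_split /= Pa0 mul0r mulr0.
(* Multiplication by the factor of the complementary idempotent eliminates e, leaving a polynomial
   in x_(a+1) alone with scalar roots. *)
have fE k : factor (c k)%:A xb (e a) * factor (c k)%:A xb (1 - e a) =
    ((1 + h1)%:A ^+ 2) * \prod_(l <- [:: k; k; k - 1; k + 1]) (xb - (c l)%:A).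
  have ee := color_idem_idem d_neq0 src_t_pow a.
  rewrite !big_cons big_nil.
  have cs : (1 + h1)%:A * ((c (k - 1))%:A + (c (k + 1))%:A)
      = (1 + h1)%:A * (c k)%:A *+ 2 + h1%:A * (h0%:A + h1%:A * (c k)%:A) :> R.
    by rewrite -!in_algE -!(rmorphD, rmorphM, rmorphMn) /= c_sum.
  have cm : (1 + h1)%:A * ((c (k - 1))%:A * (c (k + 1))%:A)
      = (1 + h1)%:A * (c k)%:A ^+ 2 - h0%:A * (h0%:A + h1%:A * (c k)%:A) :> R.
    by rewrite -!in_algE -!(rmorphXn, rmorphM, rmorphD, rmorphB) /= c_mul.
  move: cs cm; rewrite /factor.
  move: (c k)%:A (c (k - 1))%:A (c (k + 1))%:A (1 + h1)%:A h0%:A h1%:A (e a) ee.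
  move=> u u1 u2 r H0 H1 E ee cs cm.
  rewrite mulr1; transitivity (r * (xb - u) ^+ 2 *
      (r * xb ^+ 2 - xb * (r * (u1 + u2)) + r * (u1 * u2))); last by ring.
  rewrite cs cm; transitivity (r * (xb - u) ^+ 2 *
      (r * (xb - u) ^+ 2 - (H0 + H1 * u) * (H0 + H1 * xb))
    + (E - E * E) * ((H0 + H1 * u) * (H0 + H1 * xb)) ^+ 2); first by ring.
  by rewrite ee subrr mul0r addr0; ring.
rewrite big_cat /= -/Pb.
have : Pb * \prod_(k <- s) (factor (c k)%:A xb (e a) * factor (c k)%:A xb (1 - e a)) = 0.
  by rewrite big_split /= mulrA Pb0 mul0r.
under eq_bigr do rewrite fE.
rewrite big_split /= /neighbours big_flatten big_map.
set Q := \prod_(j <- s) \prod_(_ <- _) _; set U := \prod_(i <- s) _ => E.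
have UU : U \is a GRing.unit.
  by apply: rpred_prod => k _; rewrite unitrX // -in_algE rmorph_unit // unitfE.
by apply: (mulrI UU); rewrite mulr0 -E mulrCA.
Qed.

Lemma vanishes_all s (i : 'I_n) :
  (forall j : 'I_n, j = 0%N :> nat -> vanishes s (x j)) ->
  exists s', vanishes s' (x i).
Proof.
move=> x0; case: i; elim=> [|i IH] lti; first by exists s; apply: x0.
have [s' vs'] := IH (ltnW lti).
have lti' : (i < n.-1)%N by rewrite ltn_predRL.
exists (s' ++ neighbours s').
have -> : Ordinal lti = pos_succ (Ordinal lti') by apply: val_inj.
apply: vanishes_next; congr (vanishes _ (x _)): vs'; exact: val_inj.
Qed.
End Spectrum.

(** * The two presentations *)

Section ColorIdempotentCommutes.
Variables (F : fieldType) (n d : nat) (A : algType F).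
Variables (f : 'I_n.-1 -> A) (t : 'I_n -> A).
Hypothesis t_pow : forall i, t i ^+ d = 1.
Hypothesis t_comm : forall i j, t i * t j = t j * t i.
Hypothesis t_f : forall a b, t b * f a = f a * t (s_ a b).

(** Passing [f a] exchanges the two t, and the idempotent is symmetric in them. The symmetry is
    [color_idemC], stated in a commutative algebra; the envelope of the t_b supplies one. *)
Lemma color_idem_f a : color_idem d t a * f a = f a * color_idem d t a.
Proof.
have cS u v : (exists i, u = t i) -> (exists j, v = t j) -> u * v = v * u.
  by move=> [i ->] [j ->].
have [R [iota [iota_inj iotaS _]]] := commutative_envelope cS.
have [tR tRE] := choice (fun i => iotaS (t i) (ex_intro _ i erefl)).
have eR : color_idem d t a = iota (color_idem d tR a).
  rewrite color_idem_morph /color_idem; congr (_ *: _).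
  by apply: eq_bigr => j _; rewrite /= !tRE.
have tR_pow i : tR i ^+ d = 1.
  by apply: iota_inj; rewrite rmorphXn rmorph1 /= tRE.
have tX i k : t i ^+ k * f a = f a * t (s_ a i) ^+ k.
  elim: k => [|k IH]; first by rewrite !expr0 mulr1 mul1r.
  by rewrite !exprS -mulrA IH !mulrA t_f.
rewrite [in RHS]eR -(color_idemC tR_pow) linearZ rmorph_sum /=.
rewrite /color_idem -scalerAl -scalerAr; congr (_ *: _).
rewrite mulr_suml mulr_sumr; apply: eq_bigr => j _.
rewrite rmorphM !rmorphXn /= !tRE -mulrA tX mulrA tX -mulrA.
by rewrite /s_ tpermL tpermR.
Qed.

Lemma color_idem_comm a (u : A) : (forall i, u * t i = t i * u) ->
  u * color_idem d t a = color_idem d t a * u.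
Proof.
move=> cu; have cX i k : GRing.comm u (t i ^+ k) by apply: commrX; apply: cu.
rewrite /color_idem -scalerAl -scalerAr; congr (_ *: _).
rewrite mulr_suml mulr_sumr; apply: eq_bigr => j _; exact: commrM.
Qed.
End ColorIdempotentCommutes.

Section JucysMurphy.
Variables (F : fieldType) (A : algType F) (q : F) (G : nat -> A) (X0 : A).
Hypothesis far : forall k l, (k.+1 < l)%N -> G k * G l = G l * G k.
Hypothesis braid : forall k, G k.+1 * G k * G k.+1 = G k * G k.+1 * G k.
Hypothesis X0_braid : X0 * G 0%N * X0 * G 0%N = G 0%N * X0 * G 0%N * X0.
Hypothesis X0_G : forall k, (0 < k)%N -> X0 * G k = G k * X0.

Fixpoint jm (k : nat) : A :=
  if k is k'.+1 then q^-1 *: (G k' * jm k' * G k') else X0.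

Lemma comm_jmS (u : A) k :
  GRing.comm u (G k) -> GRing.comm u (jm k) -> GRing.comm u (jm k.+1).
Proof.
move=> cG cX; rewrite /GRing.comm /= -scalerAl -scalerAr; congr (_ *: _).
by apply: commrM => //; apply: commrM.
Qed.

Lemma jm_G k l : (k < l)%N || (l.+1 < k)%N -> GRing.comm (G l) (jm k).
Proof.
elim/ltn_ind: k l => -[|k] IH l.
  by rewrite ltn0 orbF => /X0_G E; apply/commr_sym.
case/orP=> [ltkl|]; last rewrite ltnS => ltlk.
  apply: comm_jmS; last by apply: IH; rewrite // ltnW.
  exact/commr_sym/far.
have [ltlk'|] := ltnP l.+1 k.
  by apply: comm_jmS; [apply: far | apply: IH; rewrite // ltlk' orbT].
(* The case out of reach of the induction is [G l] against [jm l.+2]. A braid relation turns [G l]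
   into [G l.+1], which commutes with [jm l], and a second one turns it back. *)
rewrite leq_eqVlt ltnNge ltlk orbF => /eqP ek; subst k.
have cX : GRing.comm (G l.+1) (jm l) by apply: IH; rewrite ?leqnSn ?ltnSn.
have -> : jm l.+2 = q^-1 *: (q^-1 *: (G l.+1 * (G l * jm l * G l) * G l.+1)).
  by rewrite /= -scalerAr -scalerAl.
rewrite /GRing.comm -!scalerAr -!scalerAl; congr (_ *: (_ *: _)).
rewrite !mulrA.
transitivity (G l.+1 * G l * G l.+1 * jm l * G l * G l.+1).
  by rewrite braid.
transitivity (G l.+1 * G l * jm l * (G l.+1 * G l * G l.+1)).
  by rewrite -(mulrA _ (G l.+1) (jm l)) cX !mulrA.
by rewrite braid !mulrA.
Qed.

Lemma jm_comm k l : jm k * jm l = jm l * jm k.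
Proof.
wlog: k l / (k <= l)%N.
  by move=> W; case/orP: (leq_total k l) => h; [|apply/esym]; apply: W.
rewrite leq_eqVlt => /orP[/eqP->//|].
elim: k l => [|k IH] [|l] // ltkl; last first.
  rewrite ltnS in ltkl; apply/commr_sym/comm_jmS.
    by apply/commr_sym/jm_G; rewrite ltnS ltkl orbT.
  by apply/commr_sym/IH; rewrite ltnW.
elim: l {ltkl} => [|l IH].
  rewrite /= -scalerAl -scalerAr; congr (_ *: _).
  by rewrite !mulrA X0_braid.
by apply: comm_jmS; [apply: X0_G | apply: IH].
Qed.
End JucysMurphy.

Section Presentations.
Variables (F : fieldType) (d n : nat) (A : algType F).

Lemma free_eval_eY (G : choiceType) (phi : G -> A) (t : 'I_n -> G) a :
  free_eval phi (eY d (fun b => fgen F (t b)) a)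
  = color_idem d (fun b => phi (t b)) a.
Proof.
rewrite /eY /color_idem free_evalZ free_eval_sum; congr (_ *: _).
apply: eq_bigr => j _.
by rewrite free_evalM !free_evalX !free_eval_gen.
Qed.

Section Evaluates.
Variables (G : choiceType) (phi : G -> A).
Implicit Types (u v : freealg F G) (y : A).

(** A compositional form of evaluation: [evaluate] computes both sides of a relation, and
    [evaluates_eq] converts between the relation and the equation in [A], in either direction. *)
Definition evaluates u y := free_eval phi u = y.

Lemma evaluates_gen i : evaluates (fgen F i) (phi i).
Proof. exact: free_eval_gen. Qed.

Lemma evaluates1 : evaluates 1 1.
Proof. exact: free_eval1. Qed.

Lemma evaluatesD u v y (y' : A) :
  evaluates u y -> evaluates v y' -> evaluates (u + v) (y + y').
Proof. by move=> <- <-; apply: free_evalD. Qed.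

Lemma evaluatesM u v y (y' : A) :
  evaluates u y -> evaluates v y' -> evaluates (u * v) (y * y').
Proof. by move=> <- <-; apply: free_evalM. Qed.

Lemma evaluatesX u y k : evaluates u y -> evaluates (u ^+ k) (y ^+ k).
Proof. by move=> <-; apply: free_evalX. Qed.

Lemma evaluatesZ k u y : evaluates u y -> evaluates (k *: u) (k *: y).
Proof. by move=> <-; apply: free_evalZ. Qed.

Lemma evaluates_eq u v y (y' : A) : evaluates u y -> evaluates v y' ->
  (free_eval phi u = free_eval phi v) <-> y = y'.
Proof. by move=> -> ->. Qed.

Lemma evaluates_cyclotomic (I : Type) (r : seq I) (a : I -> F) (l : I -> nat) i :
  evaluates (\prod_(k <- r) (fgen F i - a k *: 1) ^+ l k)
            (\prod_(k <- r) (phi i - (a k)%:A) ^+ l k).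
Proof.
rewrite /evaluates free_eval_prod; apply: eq_bigr => k _.
by rewrite free_evalX free_evalB free_evalZ free_eval1 free_eval_gen.
Qed.

Lemma evaluates0 : evaluates 0 0.
Proof. by rewrite /evaluates -(scale0r (0 : freealg F G)) free_evalZ scale0r. Qed.

Lemma evaluates_eY (t : 'I_n -> G) a :
  evaluates (eY d (fun b => fgen F (t b)) a) (color_idem d (phi \o t) a).
Proof. exact: free_eval_eY. Qed.
End Evaluates.

Ltac evaluate := repeat match goal with
  | |- evaluates _ (_ * _) _ => apply: evaluatesM
  | |- evaluates _ (_ ^+ _) _ => apply: evaluatesX
  | |- evaluates _ (_ + _) _ => apply: evaluatesD
  | |- evaluates _ (_ *: _) _ => apply: evaluatesZ
  | |- evaluates _ (eY _ _ _) _ => exact: evaluates_eY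
  | |- evaluates _ 1 _ => exact: evaluates1
  | |- evaluates _ 0 _ => exact: evaluates0
  | |- evaluates _ (bigop.body _ _ _) _ => exact: evaluates_cyclotomic
  | |- evaluates _ _ _ => exact: evaluates_gen
  end.

Section Relations.
Variables (c : nat) (L : weight c).

Definition cyclotomic (u : Zmod c -> F) (y : A) : Prop :=
  \prod_(i <- finsupp L) (y - (u i)%:A) ^+ L i = 0.

Section Degenerate.
Variable phi : dYHgens n -> A.
Local Notation f := (fun a => phi (inl (inl a))).
Local Notation t := (fun b => phi (inl (inr b))).
Local Notation x := (fun b => phi (inr b)).
Local Notation ev_eq h h' := (evaluates_eq (phi := phi) h h').

Lemma dYH_affine_hecke :
  (forall u v, dYHrels d L u v -> free_eval phi u = free_eval phi v) ->
  affine_hecke d 1 0 f t x /\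
  forall b : 'I_n, b = 0%N :> nat ->
    cyclotomic (fun i => (Zmod_repr i)%:~R) (x b).
Proof.
move=> rel.
have t_pow b : t b ^+ d = 1.
  by refine (proj1 (ev_eq _ _) (rel _ _ (dYH_torder F d L b))); evaluate.
have t_comm b b' : t b * t b' = t b' * t b.
  by refine (proj1 (ev_eq _ _) (rel _ _ (dYH_tt F d L b b'))); evaluate.
have t_f a b : t b * f a = f a * t (s_ a b).
  by refine (proj1 (ev_eq _ _) (rel _ _ (dYH_tf F d L b a))); evaluate.
have ff a : f a * f a = 1.
  by refine (proj1 (ev_eq _ _) (rel _ _ (dYH_ff F d L a))); evaluate.
have fx a : f a * x (pos_succ a) = x (pos a) * f a + color_idem d t a.
  by refine (proj1 (ev_eq _ _) (rel _ _ (dYH_fx F d L a))); evaluate.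
have ef a := @color_idem_f F n d A f t t_pow t_comm t_f a.
have exE a : exchange d 1 0 t x a = color_idem d t a.
  by rewrite /exchange scale1r scale0r addr0 mulr1.
split; last first.
  move=> b b0.
  by refine (proj1 (ev_eq _ _) (rel _ _ (dYH_cyclotomic F d L b0))); evaluate.
apply: AffineHecke => //.
- move=> b b'.
  by refine (proj1 (ev_eq _ _) (rel _ _ (dYH_xx F d L b b'))); evaluate.
- move=> b b'.
  by refine (proj1 (ev_eq _ _) (rel _ _ (dYH_xt F d L b b'))); evaluate.
- move=> a b n1 n2; apply: esym.
  by refine (proj1 (ev_eq _ _) (rel _ _ (dYH_fxC F d L n1 n2))); evaluate.
- by move=> a; rewrite exE fx addrK.
- move=> a; rewrite exE -[LHS]mul1r -(ff a) -[in LHS]mulrA [X in _ * X]mulrA.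
  rewrite fx mulrDl mulrDr -!mulrA ff mulr1; congr (_ + _).
  by rewrite ef mulrA ff mul1r.
- by move=> a; rewrite ff addr0 scale1r scale0r addr0.
- move=> a b far.
  by refine (proj1 (ev_eq _ _) (rel _ _ (dYH_fC F d L far))); evaluate.
- move=> a b ab; apply: esym.
  by refine (proj1 (ev_eq _ _) (rel _ _ (dYH_braid F d L ab))); evaluate.
Qed.

Lemma affine_hecke_dYH :
  affine_hecke d 1 0 f t x ->
  (forall b : 'I_n, b = 0%N :> nat ->
    cyclotomic (fun i => (Zmod_repr i)%:~R) (x b)) ->
  forall u v, dYHrels d L u v -> free_eval phi u = free_eval phi v.
Proof.
move=> H cyc u v.
case=> {u v}.
- by move=> b; refine (proj2 (ev_eq _ _) (ah_tpow H b)); evaluate.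
- by move=> b b'; refine (proj2 (ev_eq _ _) (ah_tt H b b')); evaluate.
- by move=> b a; refine (proj2 (ev_eq _ _) (ah_tf H a b)); evaluate.
- move=> a; have ff : f a ^+ 2 = 1.
    by rewrite expr2 (ah_ff H) addr0 scale1r scale0r addr0.
  by refine (proj2 (ev_eq _ _) ff); evaluate.
- by move=> a b far; refine (proj2 (ev_eq _ _) (ah_far H far)); evaluate.
- move=> a b ab.
  by refine (proj2 (ev_eq _ _) (esym (ah_braid H ab))); evaluate.
- by move=> b b'; refine (proj2 (ev_eq _ _) (ah_xx H b b')); evaluate.
- move=> a.
  have fx : f a * x (pos_succ a) = x (pos a) * f a + color_idem d t a.
    by rewrite (ah_xf1 H) /exchange scale1r scale0r addr0 mulr1 subrK.
  by refine (proj2 (ev_eq _ _) fx); evaluate.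
- move=> a b n1 n2.
  by refine (proj2 (ev_eq _ _) (esym (ah_xf H n1 n2))); evaluate.
- by move=> b b'; refine (proj2 (ev_eq _ _) (ah_xt H b b')); evaluate.
- by move=> b b0; refine (proj2 (ev_eq _ _) (cyc b b0)); evaluate.
Qed.
End Degenerate.

Section NonDegenerate.
Variables (q : F) (q_neq0 : q != 0).
Variable phi : YHgens n -> A.
Local Notation g := (fun a => phi (inl (inl a))).
Local Notation t := (fun b => phi (inl (inr b))).
Local Notation X1 := (phi (inr tt)).
Local Notation ev_eq h h' := (evaluates_eq (phi := phi) h h').

(* Indices outside the range get the value 0, which satisfies all relations. *)
Definition gnat k : A := if insub k is Some a then g a else 0.

Definition jm_X (b : 'I_n) : A := jm q gnat X1 b.

Lemma gnatE (a : 'I_n.-1) : gnat a = g a.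
Proof. by rewrite /gnat valK. Qed.

(** Since q is invertible, this determines all the X_b from X_1 and the g_a, as Jucys-Murphy
    elements; a morphism is thus controlled on them by its values on generators. *)
Lemma affine_hecke_gXg (x : 'I_n -> A) a : affine_hecke d 0 (q - 1) g t x ->
  g a * x (pos a) * g a = q *: x (pos_succ a).
Proof.
move=> H; rewrite -mulrA (ah_xf1 H) mulrBr mulrA (ah_ff H).
have -> : 1 + (q - 1) = q by rewrite addrC subrK.
rewrite /exchange; move: (color_idem _ _ _) => e.
rewrite scale0r add0r mulrDl -!scalerAl -!scalerAr mul1r.
by rewrite !mulrA addrK.
Qed.

Lemma YH_affine_hecke :
  (forall u v, YHrels d q L u v -> free_eval phi u = free_eval phi v) ->
  affine_hecke d 0 (q - 1) g t jm_X /\ cyclotomic (fun i => q ^ Zmod_repr i) X1.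
Proof.
move=> rel.
have t_pow b : t b ^+ d = 1.
  by refine (proj1 (ev_eq _ _) (rel _ _ (YH_torder d q L b))); evaluate.
have t_comm b b' : t b * t b' = t b' * t b.
  by refine (proj1 (ev_eq _ _) (rel _ _ (YH_tt d q L b b'))); evaluate.
have t_g a b : t b * g a = g a * t (s_ a b).
  by refine (proj1 (ev_eq _ _) (rel _ _ (YH_tg d q L b a))); evaluate.
have gg a : g a * g a = q%:A + (q - 1) *: (g a * color_idem d t a).
  by refine (proj1 (ev_eq _ _) (rel _ _ (YH_gg d q L a))); evaluate.
have g_far (a b : 'I_n.-1) :
    (a.+1 < b)%N || (b.+1 < a)%N -> g a * g b = g b * g a.
  move=> h.
  by refine (proj1 (ev_eq _ _) (rel _ _ (YH_gC d q L h))); evaluate.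
have g_braid (a b : 'I_n.-1) : b = a.+1 :> nat -> g b * g a * g b = g a * g b * g a.
  move=> h.
  by refine (proj1 (ev_eq _ _) (rel _ _ (YH_braid d q L h))); evaluate.
have Xbraid (a : 'I_n.-1) : a = 0%N :> nat -> X1 * g a * X1 * g a = g a * X1 * g a * X1.
  move=> h.
  by refine (proj1 (ev_eq _ _) (rel _ _ (YH_Xbraid d q L h))); evaluate.
have Xg (a : 'I_n.-1) : (0 < a)%N -> X1 * g a = g a * X1.
  move=> h.
  by refine (proj1 (ev_eq _ _) (rel _ _ (YH_Xg d q L h))); evaluate.
have Xt b : X1 * t b = t b * X1.
  by refine (proj1 (ev_eq _ _) (rel _ _ (YH_Xt d q L b))); evaluate.
have eg a := @color_idem_f F n d A g t t_pow t_comm t_g a.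
split; last first.
  by refine (proj1 (ev_eq _ _) (rel _ _ (YH_cyclotomic d n q L))); evaluate.
have out k : (n.-1 <= k)%N -> gnat k = 0.
  by move=> h; rewrite /gnat insubN // -leqNgt.
have inn k : (k < n.-1)%N -> exists2 a : 'I_n.-1, a = k :> nat & gnat k = g a.
  by move=> h; exists (Ordinal h) => //; rewrite -gnatE.
have far k l : (k.+1 < l)%N -> gnat k * gnat l = gnat l * gnat k.
  move=> kl; case: (leqP n.-1 k) => [/out->|/inn[a ak ->]]; first by rewrite mul0r mulr0.
  case: (leqP n.-1 l) => [/out->|/inn[b bl ->]]; first by rewrite mul0r mulr0.
  by apply: g_far; rewrite ak bl kl.
have braid k : gnat k.+1 * gnat k * gnat k.+1 = gnat k * gnat k.+1 * gnat k.
  case: (leqP n.-1 k) => [/out->|/inn[a ak ->]]; first by rewrite !(mul0r, mulr0).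
  case: (leqP n.-1 k.+1) => [/out->|/inn[b bl ->]]; first by rewrite !(mul0r, mulr0).
  by apply: g_braid; rewrite ak bl.
have X0b : X1 * gnat 0 * X1 * gnat 0 = gnat 0 * X1 * gnat 0 * X1.
  case: (leqP n.-1 0) => [/out->|/inn[a ak ->]]; first by rewrite !(mul0r, mulr0).
  exact: Xbraid.
have X0G k : (0 < k)%N -> X1 * gnat k = gnat k * X1.
  move=> kp; case: (leqP n.-1 k) => [/out->|/inn[a ak ->]]; first by rewrite mul0r mulr0.
  by apply: Xg; rewrite ak.
have XS a : jm_X (pos_succ a) = q^-1 *: (g a * jm_X (pos a) * g a).
  by rewrite /jm_X /= gnatE.
have Xt' k b : GRing.comm (t b) (jm q gnat X1 k).
  elim: k b => [|k IH] b; first exact/commr_sym/Xt.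
  rewrite /GRing.comm /= -scalerAr -scalerAl; congr (_ *: _).
  case: (leqP n.-1 k) => [/out->|/inn[a ak ->]]; first by rewrite !(mul0r, mulr0).
  move: (jm q gnat X1 k) (IH (s_ a b)) => J cJ.
  transitivity (g a * (t (s_ a b) * J) * g a); first by rewrite !mulrA t_g.
  by rewrite cJ -!mulrA t_g /s_ tpermK.
have eX a b : jm_X b * color_idem d t a = color_idem d t a * jm_X b.
  by apply: color_idem_comm => i; apply/esym/Xt'.
have gXg a : g a * jm_X (pos a) * g a = q *: jm_X (pos_succ a).
  by rewrite XS scalerA divff // scale1r.
have exE a : exchange d 0 (q - 1) t jm_X a
    = (q - 1) *: (color_idem d t a * jm_X (pos_succ a)).
  by rewrite /exchange scale0r add0r -scalerAr.
apply: AffineHecke => //.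
- by move=> b b'; apply: jm_comm.
- by move=> b b'; apply/esym/Xt'.
- move=> a b n1 n2; apply/esym; rewrite -[g a]gnatE; apply: jm_G => //.
  move: n1 n2; rewrite -!val_eqE /=; lia.
- move=> a; rewrite exE; have gXg' := gXg a; rewrite -mulrA in gXg'.
  have eg' := eg a; have gg' := gg a; move: eg' gg' => {eX}.
  move: (color_idem d t a) => e eg' gg'.
  apply: (scalerI q_neq0); rewrite scalerBr [X in _ = X - _]scalerAr -gXg !mulrA gg'.
  rewrite !mulrDl -!scalerAl mul1r -eg' -!mulrA gXg' -scalerAr !scalerA.
  by rewrite [q * _]mulrC addrK.
- move=> a; rewrite exE; move: (eX a (pos_succ a)) (eg a) (gg a) (gXg a).
  move: (color_idem d t a) (jm_X (pos_succ a)) (jm_X (pos a)).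
  move=> e Xb Xa eXb {eg} _ gga gXa.
  apply: (scalerI q_neq0); rewrite [LHS]scalerAl -gXa -[LHS]mulrA gga scalerDr.
  rewrite mulrDr -!scalerAr mulr1 mulrA gXa -scalerAl eXb !scalerA.
  by rewrite [q * _]mulrC.
- by move=> a; rewrite gg [1 + _]addrC subrK.
- by move=> a b ab; apply/esym/g_braid.
Qed.

Lemma affine_hecke_YH (x : 'I_n -> A) :
  affine_hecke d 0 (q - 1) g t x ->
  (forall b : 'I_n, b = 0%N :> nat -> x b = X1) -> (0 < n)%N ->
  cyclotomic (fun i => q ^ Zmod_repr i) X1 ->
  forall u v, YHrels d q L u v -> free_eval phi u = free_eval phi v.
Proof.
move=> H x0 n_gt0 cyc u v.
have xX : x (Ordinal n_gt0) = X1 by apply: x0.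
case=> {u v}.
- by move=> b; refine (proj2 (ev_eq _ _) (ah_tpow H b)); evaluate.
- by move=> b b'; refine (proj2 (ev_eq _ _) (ah_tt H b b')); evaluate.
- by move=> b a; refine (proj2 (ev_eq _ _) (ah_tf H a b)); evaluate.
- move=> a; have gg : g a ^+ 2 = q%:A + (q - 1) *: (g a * color_idem d t a).
    by rewrite expr2 (ah_ff H) [1 + (q - 1)]addrC subrK.
  by refine (proj2 (ev_eq _ _) gg); evaluate.
- by move=> a b far; refine (proj2 (ev_eq _ _) (ah_far H far)); evaluate.
- move=> a b ab.
  by refine (proj2 (ev_eq _ _) (esym (ah_braid H ab))); evaluate.
- move=> a a0; have xa : x (pos a) = X1 by apply: x0.
  (* As g X_1 g = q X_2, this says that X_1 and X_2 commute. *)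
  have xb : X1 * g a * X1 * g a = g a * X1 * g a * X1.
    have := affine_hecke_gXg a H; rewrite xa => E.
    transitivity (X1 * (g a * X1 * g a)); first by rewrite !mulrA.
    by rewrite E -scalerAr -xa (ah_xx H) scalerAl -E xa.
  by refine (proj2 (ev_eq _ _) xb); evaluate.
- move=> a a_gt0; have xg : X1 * g a = g a * X1.
    by rewrite -xX; apply: (ah_xf H); rewrite -val_eqE /=; lia.
  by refine (proj2 (ev_eq _ _) xg); evaluate.
- move=> b; have xt : X1 * t b = t b * X1 by rewrite -xX (ah_xt H).
  by refine (proj2 (ev_eq _ _) xt); evaluate.
- by refine (proj2 (ev_eq _ _) cyc); evaluate.
Qed.

End NonDegenerate.
End Relations.
End Presentations.

(** * The change of generators *)

Section Formulas.
Variable F : fieldType.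

(* Rational expressions in two variables whose denominators are affine forms. *)
Inductive rexp :=
| RConst of F
| RLin of F & F & F
| RInv of F & F & F
| RAdd of rexp & rexp
| RMul of rexp & rexp.

(** One syntactic formula is evaluated in the field of the operators and in the commutative
    subalgebras of both algebras, which is how C and D are compared across them. *)
Fixpoint reval (S : comUnitRingType) (k : F -> S) (u v : S) (e : rexp) : S :=
  match e with
  | RConst c => k c
  | RLin c0 c1 c2 => k c0 + k c1 * u + k c2 * v
  | RInv c0 c1 c2 => (k c0 + k c1 * u + k c2 * v)^-1
  | RAdd e1 e2 => reval k u v e1 + reval k u v e2
  | RMul e1 e2 => reval k u v e1 * reval k u v e2
  end.

(** Nonzero constant terms in the denominators make them units at nilpotent arguments. *)
Fixpoint rwf (e : rexp) : bool :=
  match e with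
  | RConst _ | RLin _ _ _ => true
  | RInv c0 _ _ => c0 != 0
  | RAdd e1 e2 | RMul e1 e2 => rwf e1 && rwf e2
  end.

Variables (n : nat) (T : finType) (L : fieldType).
Variable tof : {rmorphism mpoly n F -> L}.
Hypothesis tof_inj : injective tof.
Variable R : comUnitAlgType F.
Variables (eps : 'I_n -> T -> R) (z : 'I_n -> R).

Lemma bf_reval i j e : rwf e -> blockfun tof eps z
  (fun c => reval (rconst tof) (lz tof (c i)) (lz tof (c j)) e)
  (reval (in_alg R) (z i) (z j) e).
Proof.
have lin c0 c1 c2 : c0%:A + c1%:A * z i + c2%:A * z j
    = c0%:A + c1 *: z i + c2 *: z j :> R by rewrite !mulr_algl.
elim: e => [c|c0 c1 c2|c0 c1 c2|e1 IH1 e2 IH2|e1 IH1 e2 IH2] /=.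
- by move=> _; apply: bf_const.
- move=> _; apply: bf_add; first apply: bf_add; first exact: bf_const.
    by apply: bf_mul; [apply: bf_const | apply: bf_z].
  by apply: bf_mul; [apply: bf_const | apply: bf_z].
- by rewrite lin => nz; apply: bf_inv.
- by case/andP=> w1 w2; apply: bf_add; [apply: IH1 | apply: IH2].
- by case/andP=> w1 w2; apply: bf_mul; [apply: IH1 | apply: IH2].
Qed.

Definition block_element (E : T -> T -> rexp) i j : R :=
  \sum_s \sum_s' eps i s * eps j s' * reval (in_alg R) (z i) (z j) (E s s').

Definition block_label (E : T -> T -> rexp) (l l' : label n T) : L :=
  reval (rconst tof) (lz tof l) (lz tof l') (E l.1 l'.1).

Lemma bf_block_element E i j : (forall s s', rwf (E s s')) ->
  blockfun tof eps z (fun c => block_label E (c i) (c j)) (block_element E i j).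
Proof. by move=> wf; have := bf_blocks2 i j (fun s s' => bf_reval i j (wf s s')). Qed.
End Formulas.

Section Comparison.
Variables (F : fieldType) (d : nat) (K : finType) (kappa theta : K -> F) (q : F).
Local Notation T := ('I_d * K)%type.
Implicit Types s : T.
Hypothesis q_neq0 : q != 0.
Hypothesis theta_neq0 : forall k, theta k != 0.
Hypothesis kappa_inj : injective kappa.
Hypothesis theta_inj : injective theta.
Hypothesis adjacent : forall k k', (kappa k == kappa k' + 1) = (theta k == q * theta k').

Definition RDiff c k k' := RLin (kappa k - kappa k' - c) 1 (-1).
Definition RDiffV c k k' := RInv (kappa k - kappa k' - c) 1 (-1).

(* vexp is (X - q X') / (x - x' - 1) and wexp is (X - X') / (x - x'), for
   x = kappa k + z and X = theta k (1 + z); in the first branch numerator and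
   denominator are proportional, so that no nilpotent is inverted. *)
Definition vexp k k' : rexp F := if kappa k == kappa k' + 1 then RConst (theta k)
  else RMul (RLin (theta k - q * theta k') (theta k) (- (q * theta k')))
            (RDiffV 1 k k').
Definition vexpV k k' : rexp F :=
  if kappa k == kappa k' + 1 then RConst (theta k)^-1
  else RMul (RInv (theta k - q * theta k') (theta k) (- (q * theta k')))
            (RDiff 1 k k').
Definition wexp k k' : rexp F := if k == k' then RConst (theta k)
  else RMul (RLin (theta k - theta k') (theta k) (- theta k')) (RDiffV 0 k k').
Definition wexpV k k' : rexp F := if k == k' then RConst (theta k)^-1
  else RMul (RInv (theta k - theta k') (theta k) (- theta k')) (RDiff 0 k k').

(** For different colors the product of [alpha l l'] and [alpha l' l] must pass from 1 to q; the
    whole factor is put on one of the two orders of the colors. *)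
Definition Cexp s s' : rexp F :=
  if s.1 == s'.1 then RMul (vexp s.2 s'.2) (wexpV s.2 s'.2)
  else RConst (if (s.1 < s'.1)%N then q else 1).
Definition CVexp s s' : rexp F :=
  if s.1 == s'.1 then RMul (wexp s.2 s'.2) (vexpV s.2 s'.2)
  else RConst (if (s.1 < s'.1)%N then q^-1 else 1).
(** For equal eigenvalues X - X' is a multiple of z - z', and so is the numerator of D; the first
    branch is the quotient after cancellation, (1 - (q - 1)(1 + z')) / (z - z' - 1). *)
Definition Dexp s s' : rexp F :=
  if s.1 == s'.1 then
    if s.2 == s'.2 then
      RMul (RLin (1 - (q - 1)) 0 (- (q - 1))) (RDiffV 1 s.2 s'.2)
    else RMul (RAdd (vexp s.2 s'.2)
        (RLin (- ((q - 1) * theta s'.2)) 0 (- ((q - 1) * theta s'.2))))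
      (RInv (theta s.2 - theta s'.2) (theta s.2) (- theta s'.2))
  else RConst 0.
Definition DCVexp s s' : rexp F :=
  RMul (RConst (-1)) (RMul (Dexp s s') (CVexp s s')).

(** By [adjacent], the constant terms of X - q X' and x - x' - 1 vanish for the same pairs, namely
    those sent to the constant branch; so the quotient and its inverse are both regular. *)
Lemma vexp_wf k k' : rwf (vexp k k') && rwf (vexpV k k').
Proof.
rewrite /vexp /vexpV; case: ifP => //= ne; rewrite !andbT.
by rewrite -subr_eq0 opprD addrA in ne; rewrite ne -subr_eq0 subr0 subr_eq0
  -adjacent -subr_eq0 opprD addrA ne.
Qed.

Lemma wexp_wf k k' : rwf (wexp k k') && rwf (wexpV k k').
Proof.
rewrite /wexp /wexpV; case: eqP => //= /eqP ne; rewrite subr0 !andbT !subr_eq0.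
by rewrite (inj_eq kappa_inj) (inj_eq theta_inj) ne.
Qed.

Lemma exp_wf s s' :
  [/\ rwf (Cexp s s'), rwf (CVexp s s'), rwf (Dexp s s') & rwf (DCVexp s s')].
Proof.
have /andP[v1 v2] := vexp_wf s.2 s'.2; have /andP[w1 w2] := wexp_wf s.2 s'.2.
have C1 : rwf (CVexp s s') by rewrite /CVexp; case: ifP => //= _; rewrite w1 v2.
have D1 : rwf (Dexp s s').
  rewrite /Dexp; case: ifP => //= _; case: eqP => [->|ne] /=.
    by rewrite subrr sub0r oppr_eq0 oner_eq0.
  by rewrite v1 subr_eq0; apply/eqP => /theta_inj.
split=> //; last by rewrite /= D1 C1.
by rewrite /Cexp; case: ifP => //= _; rewrite v1 w2.
Qed.

Section Symbols.
Variables (n : nat) (L : fieldType) (tof : {rmorphism mpoly n F -> L}).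
Hypothesis tof_inj : injective tof.
Local Notation label := (label n T).
Local Notation k_ := (rconst tof).
Local Notation x := (spectral_label tof (kappa \o snd) (fun=> 1)).
Local Notation X := (spectral_label tof (theta \o snd) (theta \o snd)).
Local Notation ev l l' := (reval (rconst tof) (lz tof l) (lz tof l')).
Implicit Types l : label.

Lemma lin_label_neq0 l l' (c0 c1 c2 : F) : l.2 != l'.2 -> c1 != 0 ->
  k_ c0 + k_ c1 * lz tof l + k_ c2 * lz tof l' != 0.
Proof. exact: rvar_lin_neq0_distinct. Qed.

Lemma label_diffs l l' : l.2 != l'.2 ->
  [/\ x l - x l' != 0, x l - x l' - 1 != 0, X l - X l' != 0
    & X l - k_ q * X l' != 0].
Proof.
move=> n12; rewrite /spectral_label /= !rmorph1 !mul1r.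
have E c : k_ (kappa l.1.2) + lz tof l - (k_ (kappa l'.1.2) + lz tof l') - k_ c
    = k_ (kappa l.1.2 - kappa l'.1.2 - c) + k_ 1 * lz tof l + k_ (-1) * lz tof l'.
  by rewrite !rmorphB rmorphN !rmorph1; ring.
have E' c : k_ (theta l.1.2) + k_ (theta l.1.2) * lz tof l
      - k_ c * (k_ (theta l'.1.2) + k_ (theta l'.1.2) * lz tof l')
    = k_ (theta l.1.2 - c * theta l'.1.2) + k_ (theta l.1.2) * lz tof l
      + k_ (- (c * theta l'.1.2)) * lz tof l'.
  by rewrite !(rmorphB, rmorphN, rmorphM); ring.
have := E 0; rewrite rmorph0 [LHS]subr0 => E0.
have := E 1; rewrite [X in _ - X = _]rmorph1 => E1.
have := E' 1; rewrite [k_ 1]rmorph1 [1 * (_ + _)]mul1r mul1r => E1'.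
split.
- by rewrite E0; apply: lin_label_neq0; rewrite ?oner_neq0.
- by rewrite E1; apply: lin_label_neq0; rewrite ?oner_neq0.
- by rewrite E1'; apply: lin_label_neq0.
- by rewrite E'; apply: lin_label_neq0.
Qed.

Lemma vexpE l l' : l.2 != l'.2 ->
  ev l l' (vexp l.1.2 l'.1.2) = (X l - k_ q * X l') / (x l - x l' - 1).
Proof.
move=> n12; have [n1 n2 n3 n4] := label_diffs n12.
rewrite /vexp; case: eqP => [e|_] /=.
  have e' : theta l.1.2 = q * theta l'.1.2 by apply/eqP; rewrite -adjacent e.
  apply: (mulIf n2); rewrite divfK // /spectral_label /= e e'.
  by rewrite !rmorph1 !(rmorphD, rmorphM) rmorph1 /=; ring.
congr (_ / _); rewrite /spectral_label /=.
  by rewrite !(rmorphB, rmorphN, rmorphM) /=; ring.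
by rewrite !(rmorphB, rmorphN) !rmorph1 /=; ring.
Qed.

Lemma vexpVE l l' : l.2 != l'.2 ->
  ev l l' (vexpV l.1.2 l'.1.2) = (x l - x l' - 1) / (X l - k_ q * X l').
Proof.
move=> n12; rewrite -[RHS]invf_div -vexpE // /vexp /vexpV.
case: ifP => _ /=; first by rewrite fmorphV.
by rewrite invfM invrK.
Qed.

Lemma wexpE l l' : l.2 != l'.2 ->
  ev l l' (wexp l.1.2 l'.1.2) = (X l - X l') / (x l - x l').
Proof.
move=> n12; have [n1 n2 n3 n4] := label_diffs n12.
rewrite /wexp; case: eqP => [e|_] /=.
  apply: (mulIf n1); rewrite divfK // /spectral_label /= e.
  by rewrite !rmorph1; ring.
congr (_ / _); rewrite /spectral_label /=.
  by rewrite !(rmorphB, rmorphN, rmorphM) /=; ring.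
by rewrite !(rmorphB, rmorphN) !rmorph1 rmorph0 /=; ring.
Qed.

Lemma wexpVE l l' : l.2 != l'.2 ->
  ev l l' (wexpV l.1.2 l'.1.2) = (x l - x l') / (X l - X l').
Proof.
move=> n12; rewrite -[RHS]invf_div -wexpE // /wexp /wexpV.
case: ifP => _ /=; first by rewrite fmorphV.
by rewrite invfM invrK.
Qed.

Local Notation Cl := (block_label tof Cexp).
Local Notation CVl := (block_label tof CVexp).
Local Notation Dl := (block_label tof Dexp).
Local Notation DCVl := (block_label tof DCVexp).

Lemma Cl_same l l' : l.2 != l'.2 -> l.1.1 = l'.1.1 ->
  Cl l l' = (X l - k_ q * X l') / (x l - x l' - 1) * ((x l - x l') / (X l - X l')).
Proof. by move=> n12 e; rewrite /block_label /Cexp e eqxx /= vexpE // wexpVE. Qed.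

Lemma CVl_same l l' : l.2 != l'.2 -> l.1.1 = l'.1.1 ->
  CVl l l' = (X l - X l') / (x l - x l') * ((x l - x l' - 1) / (X l - k_ q * X l')).
Proof. by move=> n12 e; rewrite /block_label /CVexp e eqxx /= vexpVE // wexpE. Qed.

Lemma Dl_same l l' : l.2 != l'.2 -> l.1.1 = l'.1.1 ->
  Dl l l' = ((X l - k_ q * X l') / (x l - x l' - 1) - (k_ q - 1) * X l')
            / (X l - X l').
Proof.
move=> n12 e; have [n1 n2 n3 n4] := label_diffs n12.
rewrite /block_label /Dexp e eqxx; case: eqP => [e2|_] /=; last first.
  rewrite vexpE //; congr ((_ + _) / _); rewrite /spectral_label /=.
    by rewrite !(rmorphN, rmorphM, rmorphB) rmorph0 rmorph1 /=; ring.
  by rewrite !(rmorphN, rmorphB) /=; ring.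
have -> : k_ (1 - (q - 1)) + k_ 0 * lz tof l + k_ (- (q - 1)) * lz tof l'
    = 1 - (k_ q - 1) * (1 + lz tof l').
  by rewrite !(rmorphN, rmorphB) rmorph0 rmorph1; ring.
have -> : k_ (kappa l.1.2 - kappa l'.1.2 - 1) + k_ 1 * lz tof l
    + k_ (-1) * lz tof l' = lz tof l - lz tof l' - 1.
  by rewrite e2 subrr sub0r rmorphN rmorph1; ring.
have xE : x l - x l' = lz tof l - lz tof l'.
  by rewrite /spectral_label /= e2 rmorph1; ring.
have XE : X l - X l' = k_ (theta l'.1.2) * (lz tof l - lz tof l').
  by rewrite /spectral_label /= e2; ring.
rewrite XE in n3; rewrite xE in n1 n2 *; rewrite XE.
have nt : k_ (theta l'.1.2) != 0 by rewrite fmorph_eq0.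
rewrite /spectral_label /= e2.
move: (k_ _) (k_ q) (lz tof l) (lz tof l') n1 n2 nt => t Q a b n1 n2 nt.
by field; rewrite nt n1 n2.
Qed.

Lemma Cl_diff l l' : l.1.1 != l'.1.1 ->
  Cl l l' = if (l.1.1 < l'.1.1)%N then k_ q else 1.
Proof.
by move=> ne; rewrite /block_label /Cexp (negPf ne) /=; case: ifP; rewrite ?rmorph1.
Qed.

Lemma CVl_diff l l' : l.1.1 != l'.1.1 ->
  CVl l l' = if (l.1.1 < l'.1.1)%N then (k_ q)^-1 else 1.
Proof.
by move=> ne; rewrite /block_label /CVexp (negPf ne) /=; case: ifP;
  rewrite ?rmorph1 ?fmorphV.
Qed.

Lemma Dl_diff l l' : l.1.1 != l'.1.1 -> Dl l l' = 0.
Proof. by move=> ne; rewrite /block_label /Dexp (negPf ne) /= rmorph0. Qed.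

Lemma DCVlE l l' : DCVl l l' = - (Dl l l' * CVl l l').
Proof. by rewrite /block_label /DCVexp /= rmorphN1 mulN1r. Qed.

Lemma CVlK l l' : l.2 != l'.2 -> Cl l l' * CVl l l' = 1.
Proof.
move=> n12; have [n1 n2 n3 n4] := label_diffs n12.
have nq : k_ q != 0 by rewrite fmorph_eq0.
case: (eqVneq l.1.1 l'.1.1) => [e|ne]; last first.
  by rewrite Cl_diff // CVl_diff //; case: ifP; rewrite ?mulr1 ?mulfV.
rewrite Cl_same // CVl_same //.
move: (X l) (X l') (k_ q) (x l) (x l') n1 n2 n3 n4 => a b c u v n1 n2 n3 n4.
by field; rewrite n1 n2 n3 n4.
Qed.

Definition beta1 l l' : L := if l.1.1 == l'.1.1 then - (x l - x l')^-1 else 0.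
Definition alpha1 l l' : L := 1 - beta1 l l'.
Definition betaq l l' : L :=
  if l.1.1 == l'.1.1 then - ((k_ q - 1) * X l') / (X l - X l') else 0.
Definition alphaq l l' : L := if l.1.1 == l'.1.1 then k_ q - betaq l l'
  else if (l'.1.1 < l.1.1)%N then k_ q else 1.

Lemma symbols1 :
  hecke_symbols fst (k_ 1) (k_ 0) x alpha1 beta1.
Proof.
split=> [l l' n12|l l' n12|l l' n12 e|l l' n12 ne|l l' n12].
- by have [n1 _ _ _] := label_diffs n12; rewrite -subr_eq0.
- rewrite /beta1 /same_color; case: eqP => _ /=; last by rewrite mul0r oppr0 mul0r.
  by rewrite rmorph0 mul0r addr0 mul1r [k_ 1]rmorph1 mulNr mul1r.
- by rewrite /alpha1 rmorph0 addr0.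
- by rewrite /alpha1 /beta1 (negPf ne) eq_sym (negPf ne) rmorph0 !subr0 addr0 mulr1.
- rewrite /alpha1 /beta1; case: (l.1.1 =P l'.1.1) => _; last by rewrite subr0 oner_neq0.
  have n21 : l'.2 != l.2 by rewrite eq_sym.
  have [n1 _ _ _] := label_diffs n12; have [_ n2 _ _] := label_diffs n21.
  have -> : 1 - - (x l - x l')^-1 = - (x l' - x l - 1) / (x l - x l').
    by move: (x l) (x l') n1 => a b n1; field.
  by rewrite mulf_neq0 ?invr_eq0 // oppr_eq0.
Qed.

Lemma symbolsq :
  hecke_symbols fst (k_ 0) (k_ (q - 1)) X alphaq betaq.
Proof.
have nq : k_ q != 0 by rewrite fmorph_eq0.
have kq1 : k_ (q - 1) = k_ q - 1 by rewrite rmorphB rmorph1.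
split=> [l l' n12|l l' n12|l l' n12 e|l l' n12 ne|l l' n12].
- by have [_ _ n1 _] := label_diffs n12; rewrite -subr_eq0.
- rewrite /betaq /same_color; case: eqP => _ /=; last by rewrite mul0r oppr0 mul0r.
  by rewrite [k_ 0]rmorph0 kq1 mul1r add0r.
- by rewrite /alphaq e eqxx kq1 [1 + _]addrC subrK.
- rewrite /alphaq (negPf ne) eq_sym (negPf ne) kq1 [1 + _]addrC subrK.
  by move: ne; rewrite neq_ltn => /orP[h|h]; rewrite h ltnNge (ltnW h) ?mulr1 ?mul1r.
- rewrite /alphaq /betaq; case: (l.1.1 =P l'.1.1) => _; last by case: ifP; rewrite ?oner_neq0.
  have n21 : l'.2 != l.2 by rewrite eq_sym.
  have [_ _ n1 _] := label_diffs n12; have [_ _ _ n2] := label_diffs n21.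
  have -> : k_ q - - ((k_ q - 1) * X l') / (X l - X l')
      = - (X l' - k_ q * X l) / (X l - X l').
    by move: (X l) (X l') n1 => a b n1; field.
  by rewrite mulf_neq0 ?invr_eq0 // oppr_eq0.
Qed.

Lemma betaqE l l' : l.2 != l'.2 -> betaq l l' = beta1 l l' * Cl l l' + Dl l l'.
Proof.
move=> n12; have [n1 n2 n3 n4] := label_diffs n12.
rewrite /betaq /beta1; case: eqP => [e|/eqP ne]; last first.
  by rewrite mul0r add0r Dl_diff.
rewrite Cl_same // Dl_same //.
move: (X l) (X l') (k_ q) (x l) (x l') n1 n2 n3 => a b c u v n1 n2 n3.
by field; rewrite n1 n2 n3.
Qed.

Lemma alphaqE l l' : l.2 != l'.2 -> alphaq l l' = alpha1 l l' * Cl l' l.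
Proof.
move=> n12; have n21 : l'.2 != l.2 by rewrite eq_sym.
have [n1 n2 n3 n4] := label_diffs n21; have [n5 _ n6 _] := label_diffs n12.
rewrite /alphaq /betaq /alpha1 /beta1; case: eqP => [e|/eqP ne]; last first.
  by rewrite subr0 mul1r Cl_diff // eq_sym.
rewrite Cl_same //.
move: (X l) (X l') (k_ q) (x l) (x l') n1 n2 n3 n5 n6 => a b c u v n1 n2 n3 n5 n6.
by field; rewrite n2 n3 n5 n6.
Qed.

Lemma beta1E l l' : l.2 != l'.2 ->
  beta1 l l' = betaq l l' * CVl l l' + DCVl l l'.
Proof.
move=> n12; rewrite betaqE // DCVlE mulrDl -mulrA CVlK //.
by rewrite mulr1 addrK.
Qed.

Lemma alpha1E l l' : l.2 != l'.2 -> alpha1 l l' = alphaq l l' * CVl l' l.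
Proof.
by move=> n12; rewrite alphaqE // -mulrA CVlK ?mulr1 // eq_sym.
Qed.
End Symbols.
End Comparison.

Section SpectralBound.
Variables (F : fieldType) (c : int -> F).

(* The index k in 0..2M stands for the integer k - M. *)
Definition shifted M (k : 'I_M.*2.+1) : F := c (k%:Z - M%:Z).

Lemma cyclotomic_vanishes (R : algType F) m (L : weight m) :
  exists s, forall y : R,
    cyclotomic L (c \o @Zmod_repr m) y -> vanishes c s y.
Proof.
exists (flatten [seq nseq (L i) (Zmod_repr i) | i <- finsupp L]) => y.
rewrite /vanishes /cyclotomic big_flatten big_map => E; rewrite -[RHS]E.
by apply: eq_bigr => i _; rewrite big_nseq iter_mulr_1.
Qed.

Lemma dvdp_shifted M (s : seq int) : all (fun k => `|k| <= M%:Z) s ->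
  \prod_(k <- s) ('X - (c k)%:P) %| full_poly (@shifted M) (size s).
Proof.
elim: s => [|k s IH] /=; first by rewrite big_nil dvd1p.
case/andP=> kM /IH{}IH; rewrite big_cons /full_poly.
rewrite [X in _ %| X](eq_bigr _ (fun l _ => exprS _ _)).
rewrite big_split /=; apply: dvdp_mul => //.
have lt : (absz (k + M%:Z)%R < M.*2.+1)%N by lia.
rewrite (bigD1 (Ordinal lt)) //= dvdp_mulr // /shifted /=.
suff -> : (absz (k + M%:Z))%:Z - M%:Z = k by [].
lia.
Qed.

Lemma full_polyD (K : finType) (p : K -> F) N N' :
  full_poly p (N + N') = full_poly p N * full_poly p N'.
Proof.
by rewrite /full_poly -big_split; apply: eq_bigr => k _; rewrite exprD.
Qed.

Lemma vanishes_full_poly (R : comUnitAlgType F) (y : R) s M N :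
  all (fun k => `|k| <= M%:Z) s -> (size s <= N)%N -> vanishes c s y ->
  horner_alg y (full_poly (@shifted M) N) = 0.
Proof.
move=> sM sN ys; apply: (@horner_alg_dvd _ _ (\prod_(k <- s) ('X - (c k)%:P))).
  rewrite -(subnKC sN) full_polyD; apply: dvdp_mulr; exact: dvdp_shifted.
rewrite rmorph_prod -ys; apply: eq_bigr => k _.
by rewrite rmorphB /= horner_algX horner_algC.
Qed.
End SpectralBound.

(** * The cyclotomic relation for the new spectral elements, and recovery of the blocks *)

Section BlockTransfer.
Variables (F : fieldType) (n : nat) (T : finType) (R : comUnitAlgType F).
Variables (eps : 'I_n -> T -> R) (z : 'I_n -> R) (N : nat).
Hypothesis eps_sum : forall i, \sum_t eps i t = 1.
Hypothesis eps_orth : forall i t t', eps i t * eps i t' = (t == t')%:R * eps i t.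
Hypothesis z_nil : forall i, z i ^+ N = 0.
Variables (p p' q q' : T -> F).

Lemma spectral_eps (u u' : T -> F) i s :
  spectral eps z u u' i * eps i s = ((u s)%:A + u' s *: z i) * eps i s.
Proof.
rewrite mulr_suml (bigD1 s) //= big1 => [|s' /negPf ne].
  by rewrite addr0 mulrAC eps_orth eqxx mul1r mulrC.
by rewrite mulrAC eps_orth ne !mul0r.
Qed.

Hypothesis p'_neq0 : forall s, p' s != 0.

(** On each block, every factor of the new product is a multiple of the corresponding old one: if p
    s = u k both are scalar multiples of z; otherwise the old factor is a unit. *)
Lemma cyclotomic_transfer m (L : weight m) (u v : Zmod m -> F) i :
  (forall s k, p s = u k -> q s = v k) ->
  cyclotomic L u (spectral eps z p p' i) -> cyclotomic L v (spectral eps z q q' i).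
Proof.
move=> E; rewrite /cyclotomic => cyc.
have div s k : exists U : R, (spectral eps z q q' i - (v k)%:A) * eps i s
    = U * (spectral eps z p p' i - (u k)%:A) * eps i s.
  have XE (u0 u' : T -> F) (c : F) : (spectral eps z u0 u' i - c%:A) * eps i s
      = ((u0 s - c)%:A + u' s *: z i) * eps i s.
    by rewrite mulrBl spectral_eps -mulrBl addrAC -scalerBl.
  have [e|ne] := eqVneq (p s) (u k).
    exists (q' s / p' s)%:A; rewrite -mulrA !XE e (E _ _ e) !subrr !scale0r !add0r.
    by rewrite mulrA mulr_algl scalerA divfK.
  pose b : R := (p s - u k)%:A + p' s *: z i.
  exists (((q s - v k)%:A + q' s *: z i) * b^-1).
  rewrite -[RHS]mulrA !XE mulrA divrK // /b.
  have := @lin_unit _ _ _ z N z_nil (p s - u k) (p' s) 0 i i.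
  by rewrite scale0r addr0; apply; rewrite subr_eq0.
suff blk s : \prod_(k <- finsupp L) (spectral eps z q q' i - (v k)%:A) ^+ L k
    * eps i s = 0.
  by rewrite -[LHS]mulr1 -[X in _ * X](eps_sum i) mulr_sumr big1.
have [U UE] := choice (div s).
have congrM (a b a' b' : R) : a * eps i s = b * eps i s ->
    a' * eps i s = b' * eps i s -> a * a' * eps i s = b * b' * eps i s.
  by move=> e1 e2; rewrite -mulrA e2 mulrCA e1 mulrCA mulrA.
have step r : \prod_(k <- r) (spectral eps z q q' i - (v k)%:A) ^+ L k * eps i s
    = \prod_(k <- r) (U k * (spectral eps z p p' i - (u k)%:A)) ^+ L k * eps i s.
  elim: r => [|k r IH]; first by rewrite !big_nil.
  rewrite !big_cons; apply: (congrM) => //; elim: (L k) => [|j IHj] //.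
  by rewrite !exprS; apply: (congrM).
rewrite step; under eq_bigr do rewrite exprMn.
by rewrite big_split /= cyc mulr0 mul0r.
Qed.
End BlockTransfer.
Lemma horner_alg_congr (F : fieldType) (R : comUnitAlgType F) (a b e : R) P :
  a * e = b * e -> horner_alg a P * e = horner_alg b P * e.
Proof.
move=> E; elim/poly_ind: P => [|P c IH]; first by rewrite !rmorph0.
rewrite !rmorphD !rmorphM /= !horner_algX !horner_algC !mulrDl; congr (_ + _).
by rewrite -mulrA E mulrCA IH mulrCA mulrA.
Qed.

Section SpectralRecovery.
Variables (F : fieldType) (n d : nat) (K : finType) (R : comUnitAlgType F).
Local Notation T := ('I_d * K)%type.
Variables (eps : 'I_n -> T -> R) (z : 'I_n -> R) (N : nat).
Hypothesis eps_sum : forall i, \sum_t eps i t = 1.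
Hypothesis eps_orth : forall i t t', eps i t * eps i t' = (t == t')%:R * eps i t.
Hypothesis z_nil : forall i, z i ^+ N = 0.
Variables (w : F) (p p' : K -> F).
Hypotheses (w_prim : d.-primitive_root w).
Hypotheses (p_inj : injective p) (p'_neq0 : forall k, p' k != 0).
Local Notation t := (tcoord eps fst w).
Local Notation x := (spectral eps z (p \o snd) (p' \o snd)).

(** On each block x is an eigenvalue plus a nilpotent, where the idempotent polynomials take the
    values 0 and 1. So the blocks are polynomials in t and in any such x, and morphisms can follow
    them. *)
Lemma eps_recovered i s : eps_of w p N t x i s = eps i s.
Proof.
rewrite -[LHS]mulr1 -[eps i s]mul1r -[X in _ * X](eps_sum i) -[1](eps_sum i).
rewrite mulr_sumr mulr_suml; apply: eq_bigr => s' _.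
have tE : t i * eps i s' = ((w ^+ s'.1)%:A + 0) * eps i s'.
  rewrite addr0 mulr_suml (bigD1 s') //= big1 => [|s0 /negPf ne].
    by rewrite addr0 mulrAC eps_orth eqxx mul1r mulrC.
  by rewrite mulrAC eps_orth ne !mul0r.
have xE := spectral_eps z eps_orth (p \o snd) (p' \o snd) i s'.
have zn : (p' s'.2 *: z i) ^+ N = 0 by rewrite exprZn z_nil scaler0.
rewrite /eps_of -mulrA (horner_alg_congr _ xE) mulrCA (horner_alg_congr _ tE).
rewrite (horner_idem p_inj _ _ zn) (horner_idem (root_color_inj w_prim)) ?expr1 //.
rewrite eps_orth mulrA -natrM mulnb [s' == s]eq_sym -pair_eqE.
by rewrite andbC.
Qed.

Lemma z_recovered i : z_of d w p p' N t x i = z i.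
Proof.
rewrite -[RHS]mul1r -(eps_sum i) mulr_suml; apply: eq_bigr => s _.
rewrite eps_recovered mulrC -scalerAl mulrBl.
rewrite (spectral_eps z eps_orth (p \o snd) (p' \o snd)) -mulrBl addrAC subrr add0r.
by rewrite -scalerAl scalerA mulVf ?scale1r 1?mulrC.
Qed.
End SpectralRecovery.

(** * Compatibility of morphisms with the spectral data *)

Section Compatible.
Variables (F : fieldType) (A B : algType F) (h : {lrmorphism A -> B}).
Variables (R S : comUnitAlgType F).
Variables (iota : {lrmorphism R -> A}) (iota' : {lrmorphism S -> B}).

Definition compatible r s := h (iota r) = iota' s.

Lemma compatibleD r s r' s' :
  compatible r s -> compatible r' s' -> compatible (r + r') (s + s').
Proof. by move=> e e'; rewrite /compatible !rmorphD /= e e'. Qed.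

Lemma compatibleM r s r' s' :
  compatible r s -> compatible r' s' -> compatible (r * r') (s * s').
Proof. by move=> e e'; rewrite /compatible !rmorphM /= e e'. Qed.

Lemma compatibleC k : compatible k%:A k%:A.
Proof. by rewrite /compatible !rmorph_alg. Qed.

Lemma compatibleZ k r s : compatible r s -> compatible (k *: r) (k *: s).
Proof.
move=> e; rewrite -(mulr_algl k r) -(mulr_algl k s); apply: compatibleM => //.
exact: compatibleC.
Qed.

Lemma compatibleV r s : r \is a GRing.unit -> s \is a GRing.unit ->
  compatible r s -> compatible r^-1 s^-1.
Proof.
move=> Ur Us e; rewrite /compatible -[LHS]mulr1 -(rmorph1 iota') -(divrr Us).
by rewrite rmorphM mulrA /= -e -!rmorphM /= mulVr // !rmorph1 mul1r.
Qed.

Lemma compatible_sum (I : finType) (G : I -> R) (G' : I -> S) :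
  (forall k, compatible (G k) (G' k)) -> compatible (\sum_k G k) (\sum_k G' k).
Proof. by move=> e; rewrite /compatible !rmorph_sum; apply: eq_bigr => k _; apply: e. Qed.

Lemma compatible_horner r s P :
  compatible r s -> compatible (horner_alg r P) (horner_alg s P).
Proof.
move=> e; elim/poly_ind: P => [|P c IH]; first by rewrite /compatible !rmorph0.
rewrite !(rmorphD (horner_alg _)) !(rmorphM (horner_alg _)) /=.
rewrite !horner_algX !horner_algC; apply: compatibleD (compatibleC c).
exact: compatibleM.
Qed.

Section SpectralData.
Variables (n d : nat) (K : finType) (w : F) (p p' : K -> F) (N : nat).
Variables (t x : 'I_n -> R) (t' x' : 'I_n -> S).
Hypothesis compatible_t : forall i, compatible (t i) (t' i).
Hypothesis compatible_x : forall i, compatible (x i) (x' i).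

Lemma compatible_eps_of i (s : 'I_d * K) :
  compatible (eps_of w p N t x i s) (eps_of w p N t' x' i s).
Proof. by apply: compatibleM; apply: compatible_horner. Qed.

Lemma compatible_z_of i :
  compatible (z_of d w p p' N t x i) (z_of d w p p' N t' x' i).
Proof.
apply: compatible_sum => s; apply: compatibleM; first exact: compatible_eps_of.
apply: compatibleZ; rewrite -!scaleNr; apply: compatibleD => //.
exact: compatibleC.
Qed.
End SpectralData.

Section BlockElements.
Variables (n : nat) (T : finType).
Variables (eps : 'I_n -> T -> R) (z : 'I_n -> R).
Variables (eps' : 'I_n -> T -> S) (z' : 'I_n -> S) (N : nat).
Hypothesis z_nil : forall i, z i ^+ N = 0.
Hypothesis z'_nil : forall i, z' i ^+ N = 0.
Hypothesis compatible_eps : forall i s, compatible (eps i s) (eps' i s).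
Hypothesis compatible_z : forall i, compatible (z i) (z' i).

Lemma compatible_spectral p p' i :
  compatible (spectral eps z p p' i) (spectral eps' z' p p' i).
Proof.
apply: compatible_sum => s; apply: compatibleM => //.
by apply: compatibleD; [apply: compatibleC | apply: compatibleZ].
Qed.

Lemma compatible_reval i j e : rwf e ->
  compatible (reval (in_alg R) (z i) (z j) e) (reval (in_alg S) (z' i) (z' j) e).
Proof.
have lin c0 c1 c2 : compatible (c0%:A + c1%:A * z i + c2%:A * z j)
    (c0%:A + c1%:A * z' i + c2%:A * z' j).
  by do !apply: compatibleD; do ?apply: compatibleM => //; exact: compatibleC.
elim: e => [c|c0 c1 c2|c0 c1 c2|e1 IH1 e2 IH2|e1 IH1 e2 IH2] /=.
- by move=> _; apply: compatibleC.
- by [].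
- move=> nz; apply: compatibleV => //; rewrite !mulr_algl; exact: lin_unit.
- by case/andP=> w1 w2; apply: compatibleD; [apply: IH1 | apply: IH2].
- by case/andP=> w1 w2; apply: compatibleM; [apply: IH1 | apply: IH2].
Qed.

Lemma compatible_block_element E i j : (forall s s', rwf (E s s')) ->
  compatible (block_element eps z E i j) (block_element eps' z' E i j).
Proof.
move=> wf; do 2!apply: compatible_sum => ?.
by apply: compatibleM; [apply: compatibleM | apply: compatible_reval].
Qed.
End BlockElements.
End Compatible.

Section SpectralData.
Variables (F : fieldType) (n d : nat) (K : finType) (w : F).
Variables (L : fieldType) (tof : {rmorphism mpoly n F -> L}).
Local Notation T := ('I_d * K)%type.

Record spectral_data (N : nat) (p p' : K -> F) (beta : label n T -> label n T -> L)
    (A : algType F) (f : 'I_n.-1 -> A) (t x : 'I_n -> A) (R : comUnitAlgType F)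
    (iota : {lrmorphism R -> A}) (eps : 'I_n -> T -> R) (z : 'I_n -> R) : Prop :=
  SpectralData {
  sd_inj : injective iota;
  sd_sum : forall i, \sum_s eps i s = 1;
  sd_orth : forall i s s', eps i s * eps i s' = (s == s')%:R * eps i s;
  sd_nil : forall i, z i ^+ N = 0;
  sd_t : t = iota \o tcoord eps fst w;
  sd_x : x = iota \o spectral eps z (p \o snd) (p' \o snd);
  sd_comm_z : forall a i,
    commutation tof eps z iota f beta a (fun c => lz tof (c i)) (z i);
  sd_comm_eps : forall a i s,
    commutation tof eps z iota f beta a (fun c => ((c i).1 == s)%:R) (eps i s) }.

Hypotheses (w_prim : d.-primitive_root w) (d_neq0 : d%:R != 0 :> F).
Variables (A : algType F) (h0 h1 : F) (f : 'I_n.-1 -> A) (t x : 'I_n -> A).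
Hypothesis src : affine_hecke d h0 h1 f t x.

Lemma affine_hecke_envelope : exists (R : comUnitAlgType F)
    (iota : {lrmorphism R -> A}) (tR xR : 'I_n -> R),
  [/\ injective iota, t = iota \o tR & x = iota \o xR].
Proof.
pose S u := (exists i, u = t i) \/ (exists i, u = x i).
have commS u v : S u -> S v -> u * v = v * u.
  case=> [[i ->]|[i ->]] [[j ->]|[j ->]].
  - exact: ah_tt src _ _.
  - exact/esym/(ah_xt src).
  - exact: ah_xt src _ _.
  - exact: ah_xx src _ _.
have [R [iota [iota_inj iotaS _]]] := commutative_envelope commS.
have [tR tRE] := choice (fun i => iotaS (t i) (or_introl (ex_intro _ i erefl))).
have [xR xRE] := choice (fun i => iotaS (x i) (or_intror (ex_intro _ i erefl))).
exists R, iota, tR, xR; split=> //; apply/funext => i /=; exact/esym.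
Qed.

Lemma vanishes_iota (R : comUnitAlgType F) (iota : {lrmorphism R -> A}) c s (y : R) :
  injective iota -> vanishes c s (iota y) <-> vanishes c s y.
Proof.
move=> iota_inj; rewrite /vanishes.
have -> : \prod_(k <- s) (iota y - (c k)%:A) = iota (\prod_(k <- s) (y - (c k)%:A)).
  rewrite rmorph_prod; apply: eq_bigr => k _.
  by rewrite rmorphB /= rmorph_alg.
by split=> [e|->]; [apply: iota_inj; rewrite e rmorph0 | rewrite rmorph0].
Qed.

Section Bound.
Hypothesis r_neq0 : 1 + h1 != 0.
Variable c : int -> F.
Hypothesis c_sum : forall k, (1 + h1) * (c (k - 1) + c (k + 1))
  = (1 + h1) * c k *+ 2 + h1 * (h0 + h1 * c k).
Hypothesis c_mul : forall k, (1 + h1) * (c (k - 1) * c (k + 1))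
  = (1 + h1) * c k ^+ 2 - h0 * (h0 + h1 * c k).

Lemma common_vanishing s :
  (forall i : 'I_n, i = 0%N :> nat -> vanishes c s (x i)) ->
  exists s', forall i, vanishes c s' (x i).
Proof.
have [R [iota [tR [xR [iota_inj tE xE]]]]] := affine_hecke_envelope.
move: src; rewrite xE tE => srcR x0.
have v i : exists s', vanishes c s' (xR i).
  apply: (vanishes_all iota_inj d_neq0 srcR r_neq0 c_sum c_mul) => j /x0.
  by move/vanishes_iota; apply.
have [S SE] := choice v; exists (flatten [seq S i | i <- enum 'I_n]) => i.
apply/vanishes_iota => //; have : i \in enum 'I_n by rewrite mem_enum.
elim: (enum 'I_n) => //= j r IH; rewrite inE => /orP[/eqP <-|/IH ir].
  by apply: vanishes_cat; left.
by apply: vanishes_cat; right.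
Qed.
End Bound.

Lemma spectral_data_exists (p p' : K -> F) N alpha beta :
  injective p -> (forall k, p' k != 0) ->
  (forall i, forall (R : comUnitAlgType F) (iota : {lrmorphism R -> A}) y,
     injective iota -> iota y = x i -> horner_alg y (full_poly p N) = 0) ->
  hecke_symbols fst (rconst tof h0) (rconst tof h1)
    (spectral_label tof (p \o snd) (p' \o snd)) alpha beta ->
  exists (R : comUnitAlgType F) (iota : {lrmorphism R -> A})
    (eps : 'I_n -> T -> R) (z : 'I_n -> R),
    spectral_data N p p' beta f t x iota eps z.
Proof.
move=> p_inj p'_neq0 x_root sym.
have [R [iota [tR [xR [iota_inj tE xE]]]]] := affine_hecke_envelope.
move: src; rewrite xE tE => srcR; rewrite xE in x_root.
have xR_root i : horner_alg (xR i) (full_poly p N) = 0 by apply: (x_root i _ iota).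
have tR_pow := src_t_pow iota_inj srcR.
exists R, iota, (eps_of w p N tR xR), (z_of d w p p' N tR xR).
split=> //.
- exact: eps_of_sum.
- exact: eps_of_orth.
- exact: z_of_nil.
- by apply/funext => i /=; rewrite -t_tcoord.
- by apply/funext => i /=; rewrite -x_spectral.
- exact: (commutation_z w_prim d_neq0 p_inj p'_neq0 tR_pow xR_root iota_inj srcR sym).
- exact: (commutation_eps w_prim d_neq0 p_inj p'_neq0 tR_pow xR_root iota_inj srcR sym).
Qed.
End SpectralData.

(** * The mutually inverse morphisms *)

Section Naturality.
Variables (F : fieldType) (n d : nat) (K : finType) (w : F).
Variables (L : fieldType) (tof : {rmorphism mpoly n F -> L}).
Local Notation T := ('I_d * K)%type.
Hypothesis w_prim : d.-primitive_root w.
Variables (N : nat) (p p' u u' : K -> F) (beta beta' : label n T -> label n T -> L).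
Hypotheses (p_inj : injective p) (p'_neq0 : forall k, p' k != 0).
Variables (A : algType F) (f : 'I_n.-1 -> A) (t x : 'I_n -> A).
Variables (R : comUnitAlgType F) (iota : {lrmorphism R -> A}).
Variables (eps : 'I_n -> T -> R) (z : 'I_n -> R).
Hypothesis data : spectral_data w tof N p p' beta f t x iota eps z.
Variables (A' : algType F) (f' : 'I_n.-1 -> A') (t' x' : 'I_n -> A').
Variables (R' : comUnitAlgType F) (iota' : {lrmorphism R' -> A'}).
Variables (eps' : 'I_n -> T -> R') (z' : 'I_n -> R').
Hypothesis data' : spectral_data w tof N u u' beta' f' t' x' iota' eps' z'.
Variable h : {lrmorphism A -> A'}.
Hypothesis h_t : forall i, h (t i) = t' i.
Hypothesis h_x : forall i,
  h (x i) = iota' (spectral eps' z' (p \o snd) (p' \o snd) i).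

Let compatible_t i : compatible h iota iota' (tcoord eps fst w i) (tcoord eps' fst w i).
Proof. by have := h_t i; rewrite (sd_t data) (sd_t data'). Qed.

Let compatible_x i : compatible h iota iota'
  (spectral eps z (p \o snd) (p' \o snd) i) (spectral eps' z' (p \o snd) (p' \o snd) i).
Proof. by have := h_x i; rewrite (sd_x data). Qed.

(** The target idempotents are recovered from the spectral elements for the pair (p, p') of the
    source, which are the images of x under h. *)
Lemma compatible_eps i s : compatible h iota iota' (eps i s) (eps' i s).
Proof.
have E := eps_recovered (sd_sum data) (sd_orth data) (sd_nil data) p' w_prim p_inj.
have E' := eps_recovered (sd_sum data') (sd_orth data') (sd_nil data') p' w_prim p_inj.
by rewrite -E -E'; apply: compatible_eps_of.
Qed.

Lemma compatible_z i : compatible h iota iota' (z i) (z' i).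
Proof.
have E := z_recovered (sd_sum data) (sd_orth data) (sd_nil data) w_prim p_inj p'_neq0.
have E' := z_recovered (sd_sum data') (sd_orth data') (sd_nil data') w_prim p_inj p'_neq0.
by rewrite -E -E'; apply: compatible_z_of.
Qed.

Lemma h_spectral v v' i :
  h (iota (spectral eps z v v' i)) = iota' (spectral eps' z' v v' i).
Proof. exact: (compatible_spectral compatible_eps compatible_z). Qed.

Lemma h_block_element E i j : (forall s s', rwf (E s s')) ->
  h (iota (block_element eps z E i j)) = iota' (block_element eps' z' E i j).
Proof.
exact: (compatible_block_element (sd_nil data) (sd_nil data') compatible_eps compatible_z).
Qed.
End Naturality.

Section MutualTransfer.
Variables (F : fieldType) (n d : nat) (K : finType) (w : F).
Variables (L : fieldType) (tof : {rmorphism mpoly n F -> L}).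
Local Notation T := ('I_d * K)%type.
Hypotheses (w_prim : d.-primitive_root w) (d_neq0 : d%:R != 0 :> F).
Hypothesis tof_inj : injective tof.
Variables (kappa theta : K -> F) (q : F) (N : nat).
Hypothesis q_neq0 : q != 0.
Hypothesis theta_neq0 : forall k, theta k != 0.
Hypothesis kappa_inj : injective kappa.
Hypothesis theta_inj : injective theta.
Hypothesis adjacent : forall k k', (kappa k == kappa k' + 1) = (theta k == q * theta k').
Variables (A : algType F) (f : 'I_n.-1 -> A) (t x : 'I_n -> A).
Variables (R : comUnitAlgType F) (iota : {lrmorphism R -> A}).
Variables (eps : 'I_n -> T -> R) (z : 'I_n -> R).

Definition adjacent_element (E : T -> T -> rexp F) (a : 'I_n.-1) : R :=
  block_element eps z E (pos a) (pos_succ a).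
Local Notation C := (adjacent_element (Cexp kappa theta q)).
Local Notation CV := (adjacent_element (CVexp kappa theta q)).
Local Notation D := (adjacent_element (Dexp kappa theta q)).
Local Notation DCV := (adjacent_element (DCVexp kappa theta q)).

Definition transferred_g := transferred iota f C D.
Definition transferred_f := transferred iota f CV DCV.
Definition spectral_X := iota \o spectral eps z (theta \o snd) (theta \o snd).
Definition spectral_x := iota \o spectral eps z (kappa \o snd) (fun=> 1).

Let wfC (s s' : T) : rwf (Cexp kappa theta q s s').
Proof. by case: (exp_wf kappa_inj theta_inj adjacent s s'). Qed.
Let wfCV (s s' : T) : rwf (CVexp kappa theta q s s').
Proof. by case: (exp_wf kappa_inj theta_inj adjacent s s'). Qed.
Let wfD (s s' : T) : rwf (Dexp kappa theta q s s').
Proof. by case: (exp_wf kappa_inj theta_inj adjacent s s'). Qed.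
Let wfDCV (s s' : T) : rwf (DCVexp kappa theta q s s').
Proof. by case: (exp_wf kappa_inj theta_inj adjacent s s'). Qed.

Lemma affine_hecke_transferred_g : affine_hecke d 1 0 f t x ->
  spectral_data w tof N kappa (fun=> 1) (beta1 kappa tof) f t x iota eps z ->
  affine_hecke d 0 (q - 1) transferred_g t spectral_X.
Proof.
move=> src data; rewrite (sd_x data) (sd_t data) in src *.
apply: (transfer tof_inj (sd_sum data) (sd_orth data) (sd_nil data) w_prim d_neq0
  src (symbols1 d kappa q theta_neq0 tof_inj) (sd_comm_z data) (sd_comm_eps data)
  (symbolsq d kappa q_neq0 theta_neq0 tof_inj)).
- by move=> a; apply: bf_block_element.
- by move=> a; apply: bf_block_element.
- exact: alphaqE.
- exact: betaqE.
Qed.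

Lemma affine_hecke_transferred_f : affine_hecke d 0 (q - 1) f t x ->
  spectral_data w tof N theta theta (betaq theta q tof) f t x iota eps z ->
  affine_hecke d 1 0 transferred_f t spectral_x.
Proof.
move=> src data; rewrite (sd_x data) (sd_t data) in src *.
apply: (transfer tof_inj (sd_sum data) (sd_orth data) (sd_nil data) w_prim d_neq0
  src (symbolsq d kappa q_neq0 theta_neq0 tof_inj)
  (sd_comm_z data) (sd_comm_eps data) (symbols1 d kappa q theta_neq0 tof_inj)).
- by move=> a; apply: bf_block_element.
- by move=> a; apply: bf_block_element.
- exact: alpha1E.
- exact: beta1E.
Qed.
Section Inverse.
Hypothesis eps_sum : forall i, \sum_s eps i s = 1.
Hypothesis eps_orth : forall i s s', eps i s * eps i s' = (s == s')%:R * eps i s.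
Hypothesis z_nil : forall i, z i ^+ N = 0.
Implicit Types a : 'I_n.-1.

Let bfE (E : T -> T -> rexp F) a (wE : forall s s', rwf (E s s')) :
  blockfun tof eps z (fun c => block_label tof E (c (pos a)) (c (pos_succ a)))
    (adjacent_element E a).
Proof. exact: bf_block_element. Qed.

Lemma C_CV a : C a * CV a = 1.
Proof.
rewrite -(scale1r 1); apply: (blockfun_inj tof_inj eps_sum eps_orth z_nil
  (bf_mul (bfE a wfC) (bfE a wfCV)) (bf_const tof eps z 1)) => c gc.
rewrite rmorph1; apply: CVlK => //.
exact: good_labels_neq gc (pos_neq a).
Qed.

Lemma DCV_E a : DCV a = - (D a * CV a).
Proof.
apply: (blockfun_inj tof_inj eps_sum eps_orth z_nil
  (bfE a wfDCV) (bf_opp (bf_mul (bfE a wfD) (bfE a wfCV)))) => c gc.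
exact: DCVlE.
Qed.

Lemma transferred_fg a : transferred iota transferred_g CV DCV a = f a.
Proof.
rewrite /transferred_g /transferred DCV_E mulrDl -mulrA -!rmorphM C_CV.
by rewrite rmorph1 mulr1 rmorphN addrK.
Qed.

Lemma transferred_gf a : transferred iota transferred_f C D a = f a.
Proof.
rewrite /transferred_f /transferred DCV_E mulrDl -mulrA -!rmorphM.
by rewrite mulNr -mulrA [CV a * _]mulrC C_CV !mulr1 rmorph1 rmorphN mulr1 subrK.
Qed.
End Inverse.
End MutualTransfer.

Section Images.
Variables (F : fieldType) (n : nat) (A : Type).

Definition YH_images (g : 'I_n.-1 -> A) (t : 'I_n -> A) (X1 : A) (u : YHgens n) : A :=
  match u with inl (inl a) => g a | inl (inr b) => t b | inr _ => X1 end.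

Definition dYH_images (f : 'I_n.-1 -> A) (t x : 'I_n -> A) (u : dYHgens n) : A :=
  match u with inl (inl a) => f a | inl (inr b) => t b | inr b => x b end.
End Images.

Lemma seq_int_bound (s : seq int) : exists M, all (fun k => `|k| <= M%:Z) s.
Proof.
elim: s => [|k s [M sM]]; first by exists 0%N.
exists (M + absz k)%N => /=; apply/andP; split; first by lia.
by apply: sub_all sM => l; lia.
Qed.

Lemma cyclotomic_iota (F : fieldType) (R : comUnitAlgType F) (A : algType F)
    (iota : {lrmorphism R -> A}) m (L : weight m) u (y : R) :
  injective iota -> cyclotomic L u (iota y) <-> cyclotomic L u y.
Proof.
move=> iota_inj; rewrite /cyclotomic.
have -> : \prod_(k <- finsupp L) (iota y - (u k)%:A) ^+ L k
    = iota (\prod_(k <- finsupp L) (y - (u k)%:A) ^+ L k).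
  rewrite rmorph_prod; apply: eq_bigr => k _.
  by rewrite rmorphXn rmorphB /= rmorph_alg.
by split=> [e|->]; [apply: iota_inj; rewrite e rmorph0 | rewrite rmorph0].
Qed.

Section Comparison.
Variables (F : fieldType) (d n : nat) (w q : F).
Hypotheses (n_gt0 : (0 < n)%N).
Hypotheses (w_prim : d.-primitive_root w) (d_neq0 : d%:R != 0 :> F).
Hypothesis q_neq0 : q != 0.
Hypothesis intr_inj : injective (fun k : int => k%:~R : F).
Hypothesis expq_inj : injective (fun k : int => q ^ k).
Variables (m : nat) (L : weight m).
Local Notation o0 := (Ordinal n_gt0).
Local Notation tof := (@tofrac (mpoly n F)).

Lemma tofrac_injective : injective (tof : mpoly n F -> {fraction mpoly n F}).
Proof. by move=> x y /eqP; rewrite tofrac_eq => /eqP. Qed.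

Section Levels.
Variables M N : nat.
Definition kappa := @shifted F (fun k => k%:~R) M.
Definition theta := @shifted F (fun k => q ^ k) M.

Lemma shifted_inj (c : int -> F) : injective c -> injective (@shifted F c M).
Proof. by move=> c_inj k l /c_inj E; apply: val_inj => /=; lia. Qed.

Lemma kappa_inj : injective kappa. Proof. exact: shifted_inj. Qed.
Lemma theta_inj : injective theta. Proof. exact: shifted_inj. Qed.

Lemma theta_neq0 k : theta k != 0. Proof. exact: expfz_neq0. Qed.

Lemma adjacent k k' : (kappa k == kappa k' + 1) = (theta k == q * theta k').
Proof.
have -> : kappa k' + 1 = (k'%:Z - M%:Z + 1)%:~R by rewrite intrD.
have -> : q * theta k' = q ^ (k'%:Z - M%:Z + 1) by rewrite expfzDr // expr1z mulrC.
by rewrite (inj_eq intr_inj) (inj_eq expq_inj).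
Qed.

Lemma kappa_theta k (i : Zmod m) : kappa k = (Zmod_repr i)%:~R <-> theta k = q ^ Zmod_repr i.
Proof. by split=> [/intr_inj|/expq_inj] E; rewrite /kappa /theta /shifted E. Qed.
End Levels.

Section DegenerateSide.
Variables (A : algType F) (phi : dYHgens n -> A).
Hypothesis rel : forall u v, dYHrels d L u v -> free_eval phi u = free_eval phi v.
Local Notation f := (fun a => phi (inl (inl a))).
Local Notation t := (fun b => phi (inl (inr b))).
Local Notation x := (fun b => phi (inr b)).

Lemma dYH_vanishing : exists s, forall i, vanishes (fun k => k%:~R) s (x i).
Proof.
have [src cyc] := dYH_affine_hecke rel.
have [s0 s0P] := @cyclotomic_vanishes F (fun k => k%:~R) A m L.
apply: (@common_vanishing _ _ _ d_neq0 _ _ _ _ _ _ src) => [||k|i i0].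
- by rewrite addr0 oner_neq0.
- by move=> k; rewrite !intrD mulrNz; ring.
- by rewrite !intrD mulrNz; ring.
- by apply: s0P; apply: cyc.
Qed.

(** The range M of eigenvalues and the nilpotency bound N are arguments, so that both algebras can
    be decomposed with the same index set and exponent. *)
Lemma dYH_side s M : all (fun k => `|k| <= M%:Z) s ->
  (forall i, vanishes (fun k => k%:~R) s (x i)) ->
  forall N, (size s <= N)%N ->
  exists (R : comUnitAlgType F) (iota : {lrmorphism R -> A})
    (eps : 'I_n -> 'I_d * 'I_M.*2.+1 -> R) (z : 'I_n -> R),
  let kappa := @kappa M in let theta := @theta M in
  let X := spectral_X theta iota eps z in
  let g := transferred_g kappa theta q f iota eps z in
  [/\ spectral_data w tof N kappa (fun=> 1) (beta1 kappa tof) f t x iota eps z,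
    affine_hecke d 0 (q - 1) g t X
  & forall u v, YHrels d q L u v ->
      free_eval (YH_images g t (X o0)) u = free_eval (YH_images g t (X o0)) v].
Proof.
move=> sM vx N sN; have [src cyc] := dYH_affine_hecke rel.
have [|R [iota [eps [z data]]]] := spectral_data_exists (N := N) w_prim d_neq0 src
    (@kappa_inj M) (fun=> oner_neq0 F) _
    (symbols1 d (@kappa M) q (theta_neq0 (M := M)) tofrac_injective).
  move=> i R iota y iota_inj yx; apply: (vanishes_full_poly sM sN).
  by apply/(vanishes_iota _ _ _ iota_inj); rewrite yx.
exists R, iota, eps, z => /=.
have H := affine_hecke_transferred_g w_prim d_neq0 tofrac_injective q_neq0
  (theta_neq0 (M := M)) (@kappa_inj M) (@theta_inj M) (@adjacent M) src data.
split=> //; apply: affine_hecke_YH H _ n_gt0 _ => //=.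
  by move=> b b0; congr (spectral_X _ _ _ _ _); apply: val_inj.
have := cyc o0 erefl; rewrite (congr1 (fun x => x o0) (sd_x data)) /=.
move/(cyclotomic_iota _ _ _ (sd_inj data)) => cycR.
apply/(cyclotomic_iota _ _ _ (sd_inj data)).
apply: (cyclotomic_transfer (sd_sum data) (sd_orth data) (sd_nil data) _ _ _ cycR).
  by move=> k; apply: oner_neq0.
by move=> k i /kappa_theta.
Qed.
End DegenerateSide.

Section NonDegenerateSide.
Variables (A : algType F) (phi : YHgens n -> A).
Hypothesis rel : forall u v, YHrels d q L u v -> free_eval phi u = free_eval phi v.
Local Notation g := (fun a => phi (inl (inl a))).
Local Notation t := (fun b => phi (inl (inr b))).
Local Notation X := (jm_X q phi).

Lemma YH_vanishing : exists s, forall i, vanishes (fun k => q ^ k) s (X i).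
Proof.
have [src cyc] := YH_affine_hecke q_neq0 rel.
have [s0 s0P] := @cyclotomic_vanishes F (fun k => q ^ k) A m L.
apply: (@common_vanishing _ _ _ d_neq0 _ _ _ _ _ _ src) => [||k|i i0].
- by rewrite addrC subrK.
- move=> k; rewrite !expfzDr // exprN1 expr1z; by field.
- rewrite !expfzDr // exprN1 expr1z; by field.
- by apply: s0P; rewrite /jm_X i0; apply: cyc.
Qed.

Lemma YH_side s M : all (fun k => `|k| <= M%:Z) s ->
  (forall i, vanishes (fun k => q ^ k) s (X i)) ->
  forall N, (size s <= N)%N ->
  exists (R : comUnitAlgType F) (iota : {lrmorphism R -> A})
    (eps : 'I_n -> 'I_d * 'I_M.*2.+1 -> R) (z : 'I_n -> R),
  let kappa := @kappa M in let theta := @theta M in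
  let x := spectral_x kappa iota eps z in
  let f := transferred_f kappa theta q g iota eps z in
  [/\ spectral_data w tof N theta theta (betaq theta q tof) g t X iota eps z,
    affine_hecke d 1 0 f t x
  & forall u v, dYHrels d L u v ->
      free_eval (dYH_images f t x) u = free_eval (dYH_images f t x) v].
Proof.
move=> sM vx N sN; have [src cyc] := YH_affine_hecke q_neq0 rel.
have [|R [iota [eps [z data]]]] := spectral_data_exists (N := N) w_prim d_neq0 src
    (@theta_inj M) (@theta_neq0 M) _
    (symbolsq d (@kappa M) q_neq0 (theta_neq0 (M := M)) tofrac_injective).
  move=> i R iota y iota_inj yx; apply: (vanishes_full_poly sM sN).
  by apply/(vanishes_iota _ _ _ iota_inj); rewrite yx.
exists R, iota, eps, z => /=.
have H := affine_hecke_transferred_f w_prim d_neq0 tofrac_injective q_neq0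
  (theta_neq0 (M := M)) (@kappa_inj M) (@theta_inj M) (@adjacent M) src data.
split=> //; apply: affine_hecke_dYH H _ => b b0 /=.
have : X b = phi (inr tt) by rewrite /jm_X b0.
move: cyc => /[swap] <-; rewrite (congr1 (fun x => x b) (sd_x data)) /=.
move/(cyclotomic_iota _ _ _ (sd_inj data)) => cycR.
apply/(cyclotomic_iota _ _ _ (sd_inj data)).
apply: (cyclotomic_transfer (sd_sum data) (sd_orth data) (sd_nil data) _ _ _ cycR).
  by move=> k; apply: theta_neq0.
by move=> k i /kappa_theta.
Qed.
End NonDegenerateSide.
Local Notation P := (YHpres d n q L).
Local Notation P1 := (dYHpres F d n L).

(** The transferred elements of the nonzero algebra satisfy the other presentation, hence define a
    unital map to it from the algebra so presented. *)
Lemma dYH_nontrivial : 1 != 0 :> palg P -> 1 != 0 :> palg P1.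
Proof.
move=> nz; apply/eqP => e.
have [s vs] := YH_vanishing (@free_eval_rels _ _ nz).
have [M sM] := seq_int_bound s.
have [R [iota [eps [z [_ _ rel]]]]] := YH_side (@free_eval_rels _ _ nz) sM vs (leqnn _).
have [h _] := @palg_lift F P1 _ _ rel.
by have := oner_neq0 (palg_alg nz); rewrite -(rmorph1 h) e rmorph0 eqxx.
Qed.

Lemma YH_nontrivial : 1 != 0 :> palg P1 -> 1 != 0 :> palg P.
Proof.
move=> nz; apply/eqP => e.
have [s vs] := dYH_vanishing (@free_eval_rels _ _ nz).
have [M sM] := seq_int_bound s.
have [R [iota [eps [z [_ _ rel]]]]] := dYH_side (@free_eval_rels _ _ nz) sM vs (leqnn _).
have [h _] := @palg_lift F P _ _ rel.
by have := oner_neq0 (palg_alg nz); rewrite -(rmorph1 h) e rmorph0 eqxx.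
Qed.

Theorem YH_isomorphic_dYH : palg_isomorphic P P1.
Proof.
have [e|nz] := eqVneq (1 : palg P) 0.
  apply: palg_isomorphic_trivial => //; apply/eqP/negPn/negP => /YH_nontrivial.
  by rewrite e eqxx.
have nz1 := dYH_nontrivial nz.
have rel1 := @free_eval_rels _ _ nz1; have rel := @free_eval_rels _ _ nz.
have [s1 vs1] := dYH_vanishing rel1; have [s2 vs2] := YH_vanishing rel.
(* A common list of roots gives both sides the same M and, through its size, the same N. *)
pose s := s1 ++ s2; have [M sM] := seq_int_bound s.
have vs1' i : vanishes (fun k => k%:~R) s (pgen nz1 (inr i)).
  by apply: vanishes_cat; left.
have vs2' i : vanishes (fun k => q ^ k) s (jm_X q (pgen nz) i).
  by apply: vanishes_cat; right.
have [R1 [iota1 [eps1 [z1 [data1 H1 relP]]]]] := dYH_side rel1 sM vs1' (leqnn _).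
have [R2 [iota2 [eps2 [z2 [data2 H2 relP1]]]]] := YH_side rel sM vs2' (leqnn _).
have [h hE] := palg_alg_lift nz relP; have [k kE] := palg_alg_lift nz1 relP1.
pose X1 := spectral_X (@theta M) iota1 eps1 z1.
pose x2 := spectral_x (@kappa M) iota2 eps2 z2.
pose g1 := transferred_g (@kappa M) (@theta M) q (fun a => pgen nz1 (inl (inl a)))
  iota1 eps1 z1.
(* Only the first X is a generator; the others are reached by induction, both families obeying g_a
   X_a g_a = q X_(a+1). *)
have h_X i : h (jm_X q (pgen nz) i) = X1 i.
  case: i; elim=> [|i IH] lti.
    rewrite [LHS]hE /=; congr (spectral_X _ _ _ _ _); exact: val_inj.
  have lti' : (i < n.-1)%N by rewrite ltn_predRL.
  pose a := Ordinal lti'.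
  have -> : Ordinal lti = pos_succ a by apply: val_inj.
  have E := affine_hecke_gXg a (proj1 (YH_affine_hecke q_neq0 rel)).
  pose psi := YH_images g1 (fun b => pgen nz1 (inl (inr b))) (X1 o0).
  have E1 := @affine_hecke_gXg _ d n _ q psi X1 a H1.
  have hX : h (jm_X q (pgen nz) (pos a)) = X1 (pos a).
    by have -> : pos a = Ordinal (ltnW lti) by apply: val_inj.
  have hM u v y : h (u * v * y) = h u * h v * h y by rewrite !rmorphM.
  by apply: (scalerI q_neq0); rewrite -E1 -linearZ -E [LHS]hM hX hE.
have h_t i : h (pgen nz (inl (inr i))) = pgen nz1 (inl (inr i)) by rewrite hE.
have k_t i : k (pgen nz1 (inl (inr i))) = pgen nz (inl (inr i)) by rewrite kE.
have k_x i : k (pgen nz1 (inr i)) = x2 i by rewrite kE.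
have th_inj := @theta_inj M; have ka_inj := @kappa_inj M.
have nth := @theta_neq0 M; have adj := @adjacent M.
have n1 (j : 'I_M.*2.+1) : (fun=> 1 : F) j != 0 by apply: oner_neq0.
have wf := exp_wf (d := d) ka_inj th_inj adj.
have wC s0 s' := let: And4 w1 _ _ _ := wf s0 s' in w1.
have wCV s0 s' := let: And4 _ w2 _ _ := wf s0 s' in w2.
have wD s0 s' := let: And4 _ _ w3 _ := wf s0 s' in w3.
have wDCV s0 s' := let: And4 _ _ _ w4 := wf s0 s' in w4.
have hB E i j := h_block_element w_prim th_inj nth data2 data1 h_t h_X (E := E) i j.
have kB E i j := h_block_element w_prim ka_inj n1 data1 data2 k_t k_x (E := E) i j.
have hS v v' i := h_spectral w_prim th_inj nth data2 data1 h_t h_X v v' i.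
have kS v v' i := h_spectral w_prim ka_inj n1 data1 data2 k_t k_x v v' i.
apply: (palg_isomorphic_inverses (h := h) (k := k)) => -[[a|i]|i].
(* The image of g_a under h is f_a C + D; k sends C and D to the elements given by the same formulas
   in the other algebra and f_a to the transferred f, so the composite undoes the change of
   generators. *)
- rewrite hE /= /transferred_g /transferred rmorphD rmorphM /= kE /=.
  rewrite !kB //; exact: (transferred_gf tofrac_injective q_neq0 nth ka_inj th_inj adj _ iota2
    (sd_sum data2) (sd_orth data2) (sd_nil data2)).
- by rewrite h_t k_t.
- rewrite hE /= /spectral_X /= kS; case: i.
  exact: esym (congr1 (fun x => x o0) (sd_x data2)).
- rewrite kE /= /transferred_f /transferred rmorphD rmorphM /= hE /=.
  rewrite !hB //; exact: (transferred_fg tofrac_injective q_neq0 nth ka_inj th_inj adj _ iota1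
    (sd_sum data1) (sd_orth data1) (sd_nil data1)).
- by rewrite k_t h_t.
- rewrite kE /= /spectral_x /= hS.
  exact: esym (congr1 (fun x => x i) (sd_x data1)).
Qed.
End Comparison.

(** * Characteristics and reduction to characteristic 0 *)

Section Characteristics.
Variable F : fieldType.
Implicit Type q : F.

Lemma characteristicP : characteristic F = 0%N -> [pchar F] =i pred0.
Proof.
rewrite /characteristic; case: pselect => [h|nh _ p]; last first.
  by apply/negP => pF; apply: nh; exists p.
by case: ex_minnP => p pF _ p0; move: pF; rewrite p0 inE.
Qed.

Lemma characteristic_pchar :
  characteristic F != 0%N -> characteristic F \in [pchar F].
Proof.
by rewrite /characteristic; case: pselect => // h _; case: ex_minnP.
Qed.

Lemma char_q_sum q : \sum_(k < char_q q) q ^+ k = 0.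
Proof.
rewrite /char_q; case: pselect => [h|_]; last by rewrite big_ord0.
by case: ex_minnP => e /andP[_ /eqP].
Qed.

Lemma char_q_eq0P q :
  char_q q = 0%N <-> forall e, (0 < e)%N -> \sum_(k < e) q ^+ k != 0.
Proof.
rewrite /char_q; case: pselect => [h|nh]; split=> //.
- by case: ex_minnP => e /andP[e_gt0 _] _ e0; rewrite e0 in e_gt0.
- by case: ex_minnP => e /andP[e_gt0 e0] _ nz; have := nz e e_gt0; rewrite e0.
- by move=> _ e e_gt0; apply/negP => e0; apply: nh; exists e; rewrite e_gt0.
Qed.

Lemma intr_injective : [pchar F] =i pred0 -> injective (fun k : int => k%:~R : F).
Proof.
move/pcharf0P => F0 k l /eqP; rewrite -subr_eq0 -intrB => /eqP E.
apply/eqP; rewrite -subr_eq0 -absz_eq0 -F0.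
case: (k - l) E => m E; apply/eqP; first exact: E.
by apply/eqP; rewrite -oppr_eq0; apply/eqP; exact: E.
Qed.

Lemma expz_injective q : q != 0 -> (forall m, (0 < m)%N -> q ^+ m != 1) ->
  injective (fun k : int => q ^ k).
Proof.
move=> q_neq0 q_inf k l /= E; apply/eqP; rewrite -subr_eq0.
have : q ^ (k - l) = 1 by rewrite expfzDr // E -expfzDr // subrr expr0z.
case: (k - l) => [[|m]|m] //=.
  by move=> E1; have := q_inf m.+1 isT; rewrite -[q ^+ _]/(q ^ m.+1%:Z) E1 eqxx.
rewrite NegzE -[_ ^ _]/(q ^ (- m.+1%:Z)) -invr_expz => /(canRL invrK); rewrite invr1 => E1.
by have := q_inf m.+1 isT; rewrite -[q ^+ _]/(q ^ m.+1%:Z) E1 eqxx.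
Qed.

Lemma char_q_positive_eq1 q :
  characteristic F = char_q q -> characteristic F != 0%N -> q = 1.
Proof.
move=> E /characteristic_pchar; rewrite E => pF.
have E1 : (q - 1) ^+ char_q q = 0.
  rewrite -(pFrobenius_autE pF) rmorphB rmorph1 /= pFrobenius_autE.
  by rewrite subrX1 char_q_sum mulr0.
by apply/eqP; rewrite -subr_eq0; move/eqP: E1; rewrite expf_eq0 => /andP[].
Qed.
End Characteristics.

Theorem corollary5p17 (F : fieldType) (d n : nat)
    (d_gt0 : (0 < d)%N) (n_gt0 : (0 < n)%N)
    (root_d : exists w : F, d.-primitive_root w)
    (q : F) (q_neq0 : q != 0) :
  (characteristic F = char_q q ->
     forall L : weight (char_q q), (0 < level L)%N ->
       palg_isomorphic (cycYH d n q L) (cycYH d n 1 L))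
  /\
  (characteristic F = 0%N -> (forall m : nat, (0 < m)%N -> q ^+ m != 1) ->
     characteristic F = char_q q /\
     forall L : weight (char_q q), (0 < level L)%N ->
       palg_isomorphic (cycYH d n q L) (cycYH d n 1 L)).
Proof.
have main : characteristic F = char_q q ->
    forall L : weight (char_q q), (0 < level L)%N ->
    palg_isomorphic (cycYH d n q L) (cycYH d n 1 L).
  move=> char_eq L _; rewrite /cycYH eqxx.
  have [_|q_neq1] := eqVneq q 1; first exact: palg_isomorphic_refl.
  have [char0|charp] := eqVneq (characteristic F) 0%N; last first.
    by rewrite (char_q_positive_eq1 char_eq charp) eqxx in q_neq1.
  have pchar0 := characteristicP char0; have [w w_prim] := root_d.
  have q_inf m : (0 < m)%N -> q ^+ m != 1.
    move=> m_gt0; have := subrX1 q m; apply: contra_eq_neq => ->.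
    rewrite subrr eq_sym mulf_neq0 ?subr_eq0 //.
    by apply: (proj1 (char_q_eq0P q)); rewrite // -char_eq.
  have d_neq0 : d%:R != 0 :> F by rewrite (proj1 (pcharf0P F) pchar0) -lt0n.
  exact: (YH_isomorphic_dYH n_gt0 w_prim d_neq0 q_neq0
    (intr_injective pchar0) (expz_injective q_neq0 q_inf)).
split=> // char0 q_inf.
have char_q0 : char_q q = 0%N.
  apply/char_q_eq0P => e e_gt0; apply: contraNneq (q_inf e e_gt0) => e0.
  by rewrite -subr_eq0 subrX1 e0 mulr0.
by split; [rewrite char0 | apply: main; rewrite char0].
Qed.
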